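(* Let $\mathsf k\in\mathbb N$. Assume that (QG) $\mu$ is a $(\Phi,\Psi)$-quasi-Gibbs measure, and there exist upper semi-continuous functions $\Phi_0,\Psi_0:S\to\mathbb R\cup\{\infty\}$ and positive constants $c_1,c_2$ such that $c_1^{-1}\Phi_0(x)\le\Phi(x)\le c_1\Phi_0(x)$ for all $x\in S$ and $c_2^{-1}\Psi_0(x-y)\le\Psi(x,y)\le c_2\Psi_0(x-y)$ for all $x,y\in S$; (EQ) for any $m\in\mathbb N$ and Lebesgue-almost all $\mathbf x_m,\mathbf y_m\in S^m$, the reduced Palm measures $\mu_{\mathbf x_m}$ and $\mu_{\mathbf y_m}$ are equivalent and $\rho^m(\mathbf x_m)>0$. Then $(\mathcal E^{\mu^{[\mathsf k]}},\mathcal D_\circ^{\mu^{[\mathsf k]}})$ is closable on $L^2(S^{\mathsf k}\times\mathfrak M,\mu^{[\mathsf k]})$.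
   Context: $S\subset\mathbb R^d$ is a closed set with $0\in S$ and $\overline{S^{\rm int}}=S$. $\mathfrak M$ is the set of measures $\xi=\sum_{j\in\Lambda}\delta_{x^j}$ on $S$ ($\Lambda$ countable) with $\xi(K)<\infty$ for all compact $K\subset S$, with the vague topology. $\xi^{xy}=\xi-\delta_x+\delta_y$. $U_r=\{x\in S:|x|\le r\}$, $\pi_r(\xi)=\xi(\cdot\cap U_r)$, $\pi_r^c(\xi)=\xi(\cdot\cap U_r^c)$, $\mathfrak M_{r,m}=\{\xi:\xi(U_r)=m\}$. $\mu$ is a probability measure on $\mathfrak M$. Its $\mathsf k$-correlation function $\rho^{\mathsf k}$ is the nonnegative permutation-invariant function on $S^{\mathsf k}$ with $\int_{A_1^{k_1}\times\cdots\times A_\ell^{k_\ell}}\rho^{\mathsf k}d\mathbf x_{\mathsf k}=\int_{\mathfrak M}\prod_i\frac{\xi(A_i)!}{(\xi(A_i)-k_i)!}\mu(d\xi)$ for disjoint bounded measurable $A_i$ and positive integers $k_i$ with $k_1+\dots+k_\ell=\mathsf k$ (terms with $\xi(A_i)<k_i$ are $0$). The Palm measures $\tilde\mu_{\mathbf x_{\mathsf k}}$ satisfy $\int_{\prod_i A_i^{k_i}}\tilde\mu_{\mathbf x_{\mathsf k}}(\mathfrak N)\rho^{\mathsf k}(\mathbf x_{\mathsf k})d\mathbf x_{\mathsf k}=\int_{\mathfrak N}\prod_i\frac{\xi(A_i)!}{(\xi(A_i)-k_i)!}\mu(d\xi)$; the reduced Palm measure $\mu_{\mathbf x_{\mathsf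 k}}$ is the law of $\xi-\sum_j\delta_{x_{\mathsf k}^j}$ under $\tilde\mu_{\mathbf x_{\mathsf k}}$. The (reduced) $\mathsf k$-Campbell measure is $\mu^{[\mathsf k]}(d\mathbf x_{\mathsf k}d\eta)=\mu_{\mathbf x_{\mathsf k}}(d\eta)\rho^{\mathsf k}(\mathbf x_{\mathsf k})d\mathbf x_{\mathsf k}$; it is assumed to exist for every $\mathsf k\in\mathbb N$. Quasi-Gibbs: $\Phi:S\to\mathbb R\cup\{\infty\}$ is a self-potential, $\Psi:S\times S\to\mathbb R\cup\{\infty\}$ a symmetric interaction potential, $\mathcal H_r(\zeta)=\sum_{x^j\in U_r}\Phi(x^j)+\sum_{x^i,x^j\in U_r,i<j}\Psi(x^i,x^j)$ for $\zeta=\sum_j\delta_{x^j}$. $\Lambda_r$ is the law of the Poisson random point field with intensity Lebesgue measure on $U_r$ and $\Lambda_r^m=\Lambda_r(\cdot\cap\mathfrak M_{r,m})$. $\mu$ is a $(\Phi,\Psi)$-quasi-Gibbs measure if its regular conditional probabilities $\mu_{r,\xi}^m(\cdot)=\mu(\pi_r(\eta)\in\cdot\mid\pi_r^c(\eta)=\pi_r^c(\xi),\eta(U_r)=m)$ satisfy, for all $r,m\in\mathbb N$ and $\mu$-a.s. $\xi$, $c^{-1}e^{-\mathcal H_r(\zeta)}\Lambda_r^m(d\zeta)\le\mu_{r,\xi}^m(d\zeta)\le c\,e^{-\mathcal H_r(\zeta)}\Lambda_r^m(d\zeta)$ for some positive constant $c=c(r,m,\xi)$. $p$ is a nonnegative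 measurable symmetric function on $\{(x,y)\in S\times S:x\ne y\}$ with (p.1) $p(x,y)=O(|x-y|^{-(d+\alpha)})$ as $|x-y|\to\infty$ for some $\alpha>0$, and (p.2) $p(x,y)=O(|x-y|^{-(d+\gamma)})$ as $|x-y|\to0$ for some $0<\gamma<2$; in particular $\int_S(1\wedge|y-x|^2)p(x,y)dy<\infty$ for every $x\in S$. $f:\mathfrak M\to\mathbb R$ is local if it is $\sigma[\pi_r]$-measurable for some $r\in\mathbb N$; then for every $m$ there is a permutation-invariant $f_r^m$ on $U_r^m$ with $f(\xi)=f_r^m(x^1,\dots,x^m)$ whenever $\pi_r(\xi)=\sum_{j=1}^m\delta_{x^j}$; a local $f$ is smooth if all $f_r^m$ are smooth. $\mathcal D_\circ$ is the space of smooth local functions, $\mathcal D_\circ^{\mathsf k}=C_0^\infty(S^{\mathsf k})\otimes\mathcal D_\circ$. For $f,g\in\mathcal D_\circ$, $\mathbb D[f,g](\xi)=\frac12\sum_{j\in\Lambda}\int_S\{f(\xi^{x^jy})-f(\xi)\}\{g(\xi^{x^jy})-g(\xi)\}p(x^j,y)dy$ for $\xi=\sum_{j\in\Lambda}\delta_{x^j}$. For $\mathfrak f,\mathfrak g\in\mathcal D_\circ^{\mathsf k}$, $\mathbb D^{\mathsf k}[\mathfrak f,\mathfrak g](\mathbf x_{\mathsf k},\eta)=\frac12\sum_{j=1}^{\mathsf k}\int_S\nabla_j^y\mathfrak f(\mathbf x_{\mathsf k},\eta)\nabla_j^y\mathfrak g(\mathbf x_{\mathsf k},\eta)p(x_{\mathsf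 k}^j,y)dy+\mathbb D[\mathfrak f(\mathbf x_{\mathsf k},\cdot),\mathfrak g(\mathbf x_{\mathsf k},\cdot)](\eta)$, where $\nabla_j^y\mathfrak f(\mathbf x_{\mathsf k},\eta)=\mathfrak f(\mathbf x_{\mathsf k}^{j,y},\eta)-\mathfrak f(\mathbf x_{\mathsf k},\eta)$ and $\mathbf x_{\mathsf k}^{j,y}$ is $\mathbf x_{\mathsf k}$ with $j$-th component replaced by $y$. $\mathcal E^{\mu^{[\mathsf k]}}(\mathfrak f,\mathfrak g)=\int_{S^{\mathsf k}\times\mathfrak M}\mathbb D^{\mathsf k}[\mathfrak f,\mathfrak g]\,d\mu^{[\mathsf k]}$, $\mathcal D_\circ^{\mu^{[\mathsf k]}}=\{\mathfrak f\in\mathcal D_\circ^{\mathsf k}\cap L^2(S^{\mathsf k}\times\mathfrak M,\mu^{[\mathsf k]}):\mathcal E^{\mu^{[\mathsf k]}}(\mathfrak f,\mathfrak f)<\infty\}$. *)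

(* Defs.v *)
From HB Require Import structures.
From mathcomp Require Import all_boot all_order all_algebra fingroup perm.
From mathcomp Require Import all_classical all_reals all_analysis.
From mathcomp Require Import measurable_realfun.

Set Implicit Arguments.
Unset Strict Implicit.
Unset Printing Implicit Defensive.

Import Order.TTheory GRing.Theory Num.Theory.
Import numFieldNormedType.Exports.

Local Open Scope classical_set_scope.
Local Open Scope ring_scope.

Section borel_matrix.
Context (R : realType) (m n : nat).
Let G : set (set 'M[R]_(m, n)) := open.

HB.instance Definition _ := @isMeasurable.Build (sigma_display G)
  'M[R]_(m, n) <<s G >> (@sigma_algebra0 _ setT G) (@sigma_algebraC _ G)
  (@sigma_algebra_bigcup _ setT G).

Lemma open_measurable_mx (A : set 'M[R]_(m, n)) : open A -> measurable A.
Proof. exact: sub_sigma_algebra. Qed.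

Lemma measurable_mx_coord i j :
  measurable_fun setT (fun M : 'M[R]_(m, n) => M i j).
Proof.
apply: (measurability _ (RGenOpens.measurableE R)).
move=> _ [_ [a [b ->]] <-]; rewrite setTI; apply: open_measurable_mx.
apply: open_comp; last exact: interval_open.
by move=> M _; apply: coord_continuous.
Qed.

Lemma mx_ball_rat (A : set 'M[R]_(m, n)) (M : 'M[R]_(m, n)) : open A -> A M ->
  exists (Q : 'M[rat]_(m, n)) (e : rat),
    ball (map_mx ratr Q : 'M[R]_(m, n)) (ratr e) M /\
    ball (map_mx ratr Q : 'M[R]_(m, n)) (ratr e) `<=` A.
Proof.
move=> oA AM; have /nbhs_ballP[r /= r0 rA] : nbhs M A by exact: open_nbhs_nbhs.
have [e] : exists e : rat, ratr e \in `]0, r / 2[%R.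
  by apply/rat_in_itvoo; rewrite divr_gt0.
rewrite in_itv/= => /andP[e0 er].
have [Q HQ] : exists Q : 'M[rat]_(m, n),
    forall i j, `|M i j - ratr (Q i j)| < ratr e.
  have /choice[q Hq] : forall ij : 'I_m * 'I_n,
      exists q : rat, `|M ij.1 ij.2 - ratr q| < ratr e.
    move=> [i j]; have [q] : exists q : rat,
        ratr q \in `]M i j - ratr e, M i j + ratr e[%R.
      by apply/rat_in_itvoo; rewrite ltrD2l gtrN.
    rewrite in_itv/= => /andP[q1 q2]; exists q => /=.
    by rewrite ltr_distlC q1 q2.
  by exists (\matrix_(i, j) q (i, j)) => i j; rewrite mxE (Hq (i, j)).
exists Q, e; split.
  by split=> // i j; rewrite mxE /ball/= distrC.
move=> N [_ QN]; apply: rA; split=> // i j.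
have := QN i j; rewrite /ball/= mxE => QNij.
rewrite (splitr r) -(subrKA (ratr (Q i j))).
rewrite (le_lt_trans (ler_normD _ _))// ltrD// (lt_trans _ er)//.
Qed.

End borel_matrix.

Definition row_tuple (R : realType) (n : nat) (t : n.-tuple R) : 'rV[R]_n :=
  \row_j tnth t j.

Definition tuple_row (R : realType) (n : nat) (x : 'rV[R]_n) : n.-tuple R :=
  [tuple x 0 j | j < n].

Section row_tuple.
Context (R : realType) (n : nat).

Lemma row_tupleK : cancel (@row_tuple R n) (@tuple_row R n).
Proof. by move=> t; apply: eq_from_tnth => j; rewrite tnth_mktuple mxE. Qed.

Lemma measurable_tuple_row : measurable_fun setT (@tuple_row R n).
Proof.
apply/measurable_fun_tnthP => j; rewrite [X in measurable_fun _ X](_ : _ =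
  fun x : 'rV[R]_n => x 0 j); first exact: measurable_mx_coord.
by apply/funext => x; rewrite /= tnth_mktuple.
Qed.

Lemma measurable_row_tuple : measurable_fun setT (@row_tuple R n).
Proof.
apply: (@measurability _ _ _ _ _ _ (open : set (set 'rV[R]_n))) => //.
move=> _ [A oA <-]; rewrite setTI.
pose B (q : 'rV[rat]_n * rat) : set 'rV[R]_n :=
  if `[< ball (map_mx ratr q.1 : 'rV[R]_n) (ratr q.2) `<=` A >]
  then ball (map_mx ratr q.1 : 'rV[R]_n) (ratr q.2) else set0.
have -> : A = \bigcup_q B q.
  apply/seteqP; split=> [x Ax|x [q _]]; last first.
    by rewrite /B; case: asboolP => // + qx; apply.
  have [Q [e [Qex QeA]]] := mx_ball_rat oA Ax.
  by exists (Q, e) => //; rewrite /B/=; case: asboolP.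
rewrite preimage_bigcup; apply: countable_bigcupT_measurable => [|[Q e]]; first exact: countableP.
rewrite /B/=; case: asboolP => _; last by rewrite preimage_set0.
have [e0|e0] := ltP 0 (ratr e : R); last first.
  rewrite (_ : _ @^-1` _ = set0)//; apply/seteqP; split=> // t [].
  by rewrite ltNge e0.
rewrite (_ : _ @^-1` _ = \bigcap_(j in [set: 'I_n])
    ((fun t : n.-tuple R => tnth t j) @^-1` ball (ratr (Q 0 j) : R) (ratr e))).
  apply: fin_bigcap_measurable => // j _.
  rewrite -[X in measurable X]setTI; apply: measurable_tnth => //.
  by apply: open_measurable; exact: ball_open.
apply/seteqP; split=> [t [_ Qt] j _|t Qt].
  by have := Qt 0 j; rewrite !mxE.
by split=> // i j; rewrite !mxE ord1; exact: Qt.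
Qed.

End row_tuple.

Section pushforward_can.
Local Open Scope ereal_scope.
Context d1 d2 (X : measurableType d1) (Y : measurableType d2) (R : realType).
Variables (m : {sigma_finite_measure set X -> \bar R}) (f : X -> Y) (g : Y -> X).
Hypotheses (mf : measurable_fun setT f) (mg : measurable_fun setT g)
  (fK : cancel f g).

(* The image of m under f; the left inverse g keeps it sigma-finite. *)
Definition pushforward_can of measurable_fun setT f & measurable_fun setT g &
  cancel f g : set Y -> \bar R := pushforward m f.

Let pc := pushforward_can mf mg fK.
Let pm : {measure set Y -> \bar R} :=
  measure_function_pushforward__canonical__measure_function_Measure m mf.

Let pc0 : pc set0 = 0.
Proof. by rewrite /pc /pushforward_can /pushforward preimage_set0 measure0. Qed.

Let pc_ge0 A : 0 <= pc A.
Proof. exact: (measure_ge0 m). Qed.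

Let pc_sigma_additive : semi_sigma_additive pc.
Proof. exact: (@measure_semi_sigma_additive _ _ _ pm). Qed.

HB.instance Definition _ := isMeasure.Build _ _ _ (pushforward_can mf mg fK)
  pc0 pc_ge0 pc_sigma_additive.

Let pc_sigma_finite : sigma_finite setT pc.
Proof.
have /sigma_finiteP[F [TF _ Foo]] := sigma_finiteT m.
exists (fun i => g @^-1` (F i)).
  by rewrite -preimage_bigcup -TF preimage_setT.
move=> i; have [mFi Fioo] := Foo i; split.
  by rewrite -[X in measurable X]setTI; exact: mg.
rewrite /pc /pushforward_can /pushforward (_ : f @^-1` _ = F i)//.
by apply/seteqP; split=> x /=; rewrite fK.
Qed.

HB.instance Definition _ := Measure_isSigmaFinite.Build _ _ _
  (pushforward_can mf mg fK) pc_sigma_finite.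

End pushforward_can.

(* The library's product [m1 \x m2] of sigma-finite measures; its sigma-finite
   instance is shadowed there by the one for subprobabilities. *)
Section product_sigma_finite.
Local Open Scope ereal_scope.
Context d1 d2 (T1 : measurableType d1) (T2 : measurableType d2) (R : realType).
Variables (m1 : {sigma_finite_measure set T1 -> \bar R})
  (m2 : {sigma_finite_measure set T2 -> \bar R}).

Definition product_sfm : set (T1 * T2) -> \bar R := m1 \x m2.

HB.instance Definition _ := Measure.on product_sfm.

Let product_sigma_finite : sigma_finite setT product_sfm.
Proof.
have /sigma_finiteP[F [TF ndF Foo]] := sigma_finiteT m1.
have /sigma_finiteP[G [TG ndG Goo]] := sigma_finiteT m2.
exists (fun n => F n `*` G n).
  rewrite -setXTT TF TG predeqE => -[x y]; split.
    move=> [/= [n _ Fnx] [k _ Gky]]; exists (maxn n k) => //; split.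
    - by move: x Fnx; exact/subsetPset/ndF/leq_maxl.
    - by move: y Gky; exact/subsetPset/ndG/leq_maxr.
  by move=> [n _ []/= ? ?]; split; exists n.
move=> k; have [? ?] := Foo k; have [? ?] := Goo k.
split; first exact: measurableX.
by rewrite /product_sfm product_measure1E// lte_mul_pinfty// ge0_fin_numE.
Qed.

HB.instance Definition _ := Measure_isSigmaFinite.Build _ _ _
  product_sfm product_sigma_finite.

End product_sigma_finite.

Section power_measure.
Local Open Scope ereal_scope.
Context dT (T : measurableType dT) (R : realType).
Variable m : {sigma_finite_measure set T -> \bar R}.

Definition tcons n (z : T * n.-tuple T) : n.+1.-tuple T := [tuple of z.1 :: z.2].

Definition tuncons n (t : n.+1.-tuple T) : T * n.-tuple T :=
  (thead t, [tuple of behead t]).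

Lemma tconsK n : cancel (@tcons n) (@tuncons n).
Proof. by move=> [x t]; congr (_, _); apply: val_inj. Qed.

Lemma measurable_tcons n : measurable_fun setT (@tcons n).
Proof. by apply: measurable_cons. Qed.

Lemma measurable_tuncons n : measurable_fun setT (@tuncons n).
Proof.
by apply: measurable_fun_pair; [exact: measurable_tnth|exact: measurable_behead].
Qed.

Fixpoint powm n : {sigma_finite_measure set (n.-tuple T) -> \bar R} :=
  if n is n'.+1 then
    pushforward_can (product_sfm m (powm n')) (@measurable_tcons n')
      (@measurable_tuncons n') (@tconsK n')
  else \d_([tuple] : 0.-tuple T).

End power_measure.

Definition lebd (R : realType) (d : nat) :
    {sigma_finite_measure set 'rV[R]_d -> \bar R} :=
  pushforward_can (powm (@lebesgue_measure R) d)
    (@measurable_row_tuple R d) (@measurable_tuple_row R d)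
    (@row_tupleK R d).

Definition lebdn (R : realType) (d n : nat) :
    {sigma_finite_measure set (n.-tuple 'rV[R]_d) -> \bar R} :=
  powm (@lebd R d) n.

Section geometry.
Context (R : realType) (d : nat).
Implicit Types (S D A : set 'rV[R]_d).

(* The Euclidean norm: the library norm on row vectors is the sup norm, which
   has the same topology and the same bounded sets. *)
Definition enorm (x : 'rV[R]_d) : R := Num.sqrt (\sum_(i < d) x 0 i ^+ 2).

Definition Uball S (r : nat) : set 'rV[R]_d := [set x | S x /\ enorm x <= r%:R].

(* A^m, as a set of m-tuples. *)
Definition tpow m A : set (m.-tuple 'rV[R]_d) := [set x | forall i, A (tnth x i)].

Definition set_tnth m (x : m.-tuple 'rV[R]_d) (j : 'I_m) y :
  m.-tuple 'rV[R]_d := [tuple if i == j then y else tnth x i | i < m].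

Definition perm_invariant_on m (D : set (m.-tuple 'rV[R]_d))
    (g : m.-tuple 'rV[R]_d -> R) : Prop :=
  forall (s : 'S_m) x, D x -> g [tuple tnth x (s i) | i < m] = g x.

(* The m x d matrix whose rows are the points of an m-tuple; it identifies
   (R^d)^m with a normed space. *)
Definition mx_of_tuple m (x : m.-tuple 'rV[R]_d) : 'M[R]_(m, d) :=
  \matrix_(i, j) tnth x i 0 j.

Definition iter_derive (V : normedModType R) (vs : seq V) (h : V -> R) : V -> R :=
  foldr (fun v g => 'D_v g) h vs.

(* C^oo: iterated directional derivatives of all orders exist and are
   continuous. *)
Definition smooth (V : normedModType R) (h : V -> R) : Prop :=
  forall vs : seq V, continuous (iter_derive vs h) /\
    forall x v, derivable (iter_derive vs h) x v.

(* Smoothness on a closed subset of (R^d)^m, which need not be open: being there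
   the restriction of a C^oo function on (R^d)^m. *)
Definition smooth_on m (D : set (m.-tuple 'rV[R]_d))
    (g : m.-tuple 'rV[R]_d -> R) : Prop :=
  exists h : 'M[R]_(m, d) -> R,
    smooth h /\ forall x, D x -> g x = h (mx_of_tuple x).

(* C_0^oo(S^k); its elements are extended by 0 outside S^k. *)
Definition C0oo S k (phi : k.-tuple 'rV[R]_d -> R) : Prop :=
  smooth_on (@tpow k S) phi /\
  exists K : set 'M[R]_(k, d),
    [/\ compact K, (@mx_of_tuple k) @^-1` K `<=` tpow S &
        forall x, ~ K (mx_of_tuple x) -> phi x = 0].

Definition upper_semicontinuous_on (D : set 'rV[R]_d) (f : 'rV[R]_d -> \bar R)
    : Prop :=
  forall x (a : R), D x -> (f x < a%:E)%E ->
    \forall y \near within D (nbhs x), (f y < a%:E)%E.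

End geometry.
Arguments tpow {R d} m A.

(* Configurations: the Radon sums of Dirac masses at points of S. The Dirac mass
   is defined on all subsets of R^d, and so is a configuration, which is thereby
   determined by its values as a function of sets. *)
Definition is_config (R : realType) (d : nat) (S : set 'rV[R]_d)
    (xi : set 'rV[R]_d -> \bar R) : Prop :=
  (exists (L : set nat) (x : nat -> 'rV[R]_d),
     (forall j, L j -> S (x j)) /\
     forall A, xi A = \esum_(j in L) \d_(x j) A) /\
  (forall K, compact K -> K `<=` S -> (xi K < +oo)%E).

Record config (R : realType) (d : nat) (S : set 'rV[R]_d) := Config {
  cmeas :> set 'rV[R]_d -> \bar R;
  cmeasP : is_config S cmeas }.

Section config_type.
Context (R : realType) (d : nat) (S : set 'rV[R]_d).

Lemma is_config0 : is_config S (fun=> 0%E).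
Proof.
split=> [|K _ _]; last by rewrite ltry.
by exists set0, (fun=> 0); split=> // A; rewrite esum_set0.
Qed.

HB.instance Definition _ := gen_eqMixin (config S).
HB.instance Definition _ := gen_choiceMixin (config S).
HB.instance Definition _ := isPointed.Build (config S) (Config is_config0).

(* The configuration with values nu, if there is one. *)
Definition config_of (nu : set 'rV[R]_d -> \bar R) : config S :=
  xget point [set xi : config S | cmeas xi = nu].

(* The sum of G over the particles of xi, i.e. the integral of G against xi, as
   a difference of two nonnegative sums. *)
Definition psum (xi : config S) (G : 'rV[R]_d -> \bar R) : \bar R :=
  (\esum_(x in [set: 'rV[R]_d]) (xi [set x] * G^\+ x) -
   \esum_(x in [set: 'rV[R]_d]) (xi [set x] * G^\- x))%E.

Definition Cc (phi : 'rV[R]_d -> R) : Prop :=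
  {within S, continuous phi} /\
  exists K, [/\ compact K, K `<=` S & forall x, S x -> ~ K x -> phi x = 0].

(* The open sets of the vague topology, the coarsest one that makes the
   integrals of the functions of C_c(S) continuous. *)
Definition vague_open : set (set (config S)) := [set O |
  forall xi, O xi -> exists (n : nat) (phi : 'I_n -> 'rV[R]_d -> R) (e : R),
    [/\ forall i, Cc (phi i), 0 < e &
        forall eta : config S,
          (forall i, `|psum eta (EFin \o phi i) - psum xi (EFin \o phi i)|
                     < e%:E)%E ->
          O eta]].

End config_type.

Definition mconfig (R : realType) (d : nat) (S : set 'rV[R]_d) :=
  g_sigma_algebraType (@vague_open R d S).

HB.instance Definition _ (R : realType) (d : nat) (S : set 'rV[R]_d) :=
  Measurable.on (mconfig S).

Section config_operations.
Context (R : realType) (d : nat) (S : set 'rV[R]_d).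
Implicit Types (xi : mconfig S).

(* pi_r xi and pi_r^c xi *)
Definition restr (r : nat) xi : mconfig S :=
  config_of S (fun A => xi (A `&` Uball S r)).

Definition restrC (r : nat) xi : mconfig S :=
  config_of S (fun A => xi (A `&` ~` Uball S r)).

(* xi^{xy} *)
Definition jump xi (x y : 'rV[R]_d) : mconfig S :=
  config_of S (fun A => xi A - \d_x A + \d_y A)%E.

Definition remove n (x : n.-tuple 'rV[R]_d) xi : mconfig S :=
  config_of S (fun A => xi A - \sum_(j < n) \d_(tnth x j) A)%E.

(* The integer xi(A), for bounded A. *)
Definition count_in xi (A : set 'rV[R]_d) : nat := Num.truncn (fine (xi A)).

Definition M_ (r m : nat) : set (mconfig S) :=
  [set xi | xi (Uball S r) = m%:R%:E].

End config_operations.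
Arguments M_ {R d} S r m.

Section correlation_and_palm.
Local Open Scope ereal_scope.
Context (R : realType) (d : nat) (S : set 'rV[R]_d).

(* The blocks A_1^{k_1} x ... x A_l^{k_l} that test the n-point correlation
   function, with A_i = A i and k_i = kk i. *)
Definition test_family (n l : nat) (A : 'I_l -> set 'rV[R]_d)
    (kk : 'I_l -> nat) : Prop :=
  [/\ forall i, [/\ measurable (A i), bounded_set (A i) & A i `<=` S],
      forall i j, i != j -> A i `&` A j = set0,
      forall i, (0 < kk i)%N & (\sum_(i < l) kk i)%N = n].

Definition block (n l : nat) (A : 'I_l -> set 'rV[R]_d)
    (kk : 'I_l -> nat) : set (n.-tuple 'rV[R]_d) :=
  [set x | forall j : 'I_n,
     nth set0 (flatten [seq nseq (kk i) (A i) | i <- enum 'I_l]) j (tnth x j)].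

Arguments test_family n {l} A kk.
Arguments block n {l} A kk.

(* The product of the xi(A_i)! / (xi(A_i) - k_i)!. *)
Definition falling (l : nat) (A : 'I_l -> set 'rV[R]_d) (kk : 'I_l -> nat)
    (xi : mconfig S) : \bar R :=
  (\prod_(i < l) (count_in xi (A i)) ^_ (kk i))%N%:R%:E.

Definition is_correlation (mu : probability (mconfig S) R) (n : nat)
    (rho : n.-tuple 'rV[R]_d -> R) : Prop :=
  [/\ measurable_fun (tpow n S) rho,
      forall x, tpow n S x -> (0 <= rho x)%R,
      perm_invariant_on (tpow n S) rho &
      forall l (A : 'I_l -> set 'rV[R]_d) (kk : 'I_l -> nat),
        test_family n A kk ->
        \int[lebdn R d n]_(x in block n A kk) (rho x)%:E =
        \int[mu]_xi falling A kk xi].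

Definition is_palm (mu : probability (mconfig S) R) (n : nat)
    (rho : n.-tuple 'rV[R]_d -> R)
    (palm : R.-pker (n.-tuple 'rV[R]_d) ~> mconfig S) : Prop :=
  forall l (A : 'I_l -> set 'rV[R]_d) (kk : 'I_l -> nat) (N : set (mconfig S)),
    test_family n A kk -> measurable N ->
    \int[lebdn R d n]_(x in block n A kk) (palm x N * (rho x)%:E) =
    \int[mu]_(xi in N) falling A kk xi.

Definition reduced_palm (n : nat)
    (palm : R.-pker (n.-tuple 'rV[R]_d) ~> mconfig S)
    (x : n.-tuple 'rV[R]_d) : set (mconfig S) -> \bar R :=
  pushforward (palm x) (remove x).

Definition is_campbell (n : nat) (rho : n.-tuple 'rV[R]_d -> R)
    (palm : R.-pker (n.-tuple 'rV[R]_d) ~> mconfig S)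
    (cm : {measure set (n.-tuple 'rV[R]_d * mconfig S) -> \bar R}) : Prop :=
  forall A, measurable A ->
    cm A = \int[lebdn R d n]_(x in tpow n S)
             (reduced_palm palm x (xsection A x) * (rho x)%:E).

End correlation_and_palm.

Section quasi_gibbs.
Local Open Scope ereal_scope.
Context (R : realType) (d : nat) (S : set 'rV[R]_d).

Definition is_poisson (nu : set 'rV[R]_d -> \bar R)
    (P : probability (mconfig S) R) : Prop :=
  forall l (A : 'I_l -> set 'rV[R]_d) (c : 'I_l -> nat),
    (forall i, [/\ measurable (A i), bounded_set (A i) & A i `<=` S]) ->
    (forall i j, i != j -> A i `&` A j = set0) ->
    P [set xi | forall i, xi (A i) = (c i)%:R%:E] =
    (\prod_(i < l) (expR (- fine (nu (A i))) * fine (nu (A i)) ^+ c i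
                    / (c i)`!%:R))%:E.

(* A labelling of the particles of zeta in U_r. *)
Definition labels (r : nat) (zeta : mconfig S) : seq 'rV[R]_d :=
  xget [::] [set s | forall A : set 'rV[R]_d,
                       zeta (A `&` Uball S r) = \sum_(x <- s) \d_x A].

Definition hamiltonian (Phi : 'rV[R]_d -> \bar R)
    (Psi : 'rV[R]_d -> 'rV[R]_d -> \bar R) (r : nat) (zeta : mconfig S) : \bar R :=
  let s := labels r zeta in
  \sum_(j < size s) Phi s`_j +
  \sum_(j < size s) \sum_(i < size s | (i < j)%N) Psi s`_i s`_j.

(* Conditional laws are only determined up to mu-null subsets of M_{r,m}. *)
Definition is_cond_law (mu : probability (mconfig S) R) (r m : nat)
    (kappa : R.-pker (mconfig S) ~> mconfig S) : Prop :=
  (forall N : set (mconfig S), measurable N ->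
     measurable_fun [set: g_sigma_algebra_preimageType (@restrC R d S r)]
       (fun xi => kappa xi N)) /\
  (forall N C : set (mconfig S), measurable N ->
     g_sigma_algebra_preimage (@restrC R d S r) C ->
     \int[mu]_(xi in C `&` M_ S r m) kappa xi N =
     mu (restr r @^-1` N `&` C `&` M_ S r m)).

Definition quasi_gibbs (Lambda : nat -> probability (mconfig S) R)
    (Phi : 'rV[R]_d -> \bar R) (Psi : 'rV[R]_d -> 'rV[R]_d -> \bar R)
    (mu : probability (mconfig S) R) : Prop :=
  forall r m, (0 < r)%N -> (0 < m)%N ->
  exists kappa : R.-pker (mconfig S) ~> mconfig S, is_cond_law mu r m kappa /\
  {ae mu, forall xi, M_ S r m xi ->
    exists c : R, (0 < c)%R /\ forall N : set (mconfig S), measurable N ->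
      let I := \int[Lambda r]_(zeta in N `&` M_ S r m)
                 expeR (- hamiltonian Phi Psi r zeta) in
      c^-1%:E * I <= kappa xi N /\ kappa xi N <= c%:E * I}.

End quasi_gibbs.

Section jump_form.
Context (R : realType) (d : nat) (S : set 'rV[R]_d).

Definition jump_rate (p : 'rV[R]_d -> 'rV[R]_d -> R) : Prop :=
  [/\ forall x y, S x -> S y -> x != y -> 0 <= p x y,
      measurable_fun [set z : 'rV[R]_d * 'rV[R]_d | [/\ S z.1, S z.2 & z.1 != z.2]]
        (fun z => p z.1 z.2),
      forall x y, S x -> S y -> x != y -> p x y = p y x,
      exists alpha C M : R, [/\ 0 < alpha, 0 < M &
        forall x y, S x -> S y -> M <= enorm (x - y) ->
          p x y <= C * enorm (x - y) `^ (- (d%:R + alpha))] &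
      exists gamma C delta : R, [/\ 0 < gamma, gamma < 2, 0 < delta &
        forall x y, S x -> S y -> x != y -> enorm (x - y) <= delta ->
          p x y <= C * enorm (x - y) `^ (- (d%:R + gamma))]].

Definition local_at (r : nat) (f : mconfig S -> R) : Prop :=
  measurable_fun [set: g_sigma_algebra_preimageType (@restr R d S r)] f.

(* g is f_r^m. *)
Definition representation (f : mconfig S -> R) (r m : nat)
    (g : m.-tuple 'rV[R]_d -> R) : Prop :=
  perm_invariant_on (tpow m (Uball S r)) g /\
  forall (xi : mconfig S) (x : m.-tuple 'rV[R]_d), tpow m (Uball S r) x ->
    (forall A, restr r xi A = \sum_(j < m) \d_(tnth x j) A)%E -> f xi = g x.

(* The smooth local functions. Smoothness is required for every r for which f_r^m
   makes sense, so that they form a vector space: with a single r, the function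
   xi |-> xi(U_r) would qualify. *)
Definition Dcirc (f : mconfig S -> R) : Prop :=
  (exists2 r, (0 < r)%N & local_at r f) /\
  forall r m, (0 < r)%N -> local_at r f ->
    exists g : m.-tuple 'rV[R]_d -> R,
      representation f r g /\ smooth_on (tpow m (Uball S r)) g.

Variable p : 'rV[R]_d -> 'rV[R]_d -> R.

Definition carre (f g : mconfig S -> R) (xi : mconfig S) : \bar R :=
  (2^-1%:E * psum xi (fun x =>
     \int[lebd R d]_(y in S)
       ((f (jump xi x y) - f xi) * (g (jump xi x y) - g xi) * p x y)%:E))%E.

Variable k : nat.
Local Notation T := (k.-tuple 'rV[R]_d * mconfig S)%type.

(* The algebraic tensor product of C_0^oo(S^k) and Dcirc. *)
Definition Dcirck (f : T -> R) : Prop :=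
  exists n (phi : 'I_n -> k.-tuple 'rV[R]_d -> R) (h : 'I_n -> mconfig S -> R),
    [/\ forall i, C0oo S (phi i), forall i, Dcirc (h i) &
        forall x eta, f (x, eta) = \sum_(i < n) phi i x * h i eta].

Definition nabla (j : 'I_k) (y : 'rV[R]_d) (f : T -> R) (z : T) : R :=
  f (set_tnth z.1 j y, z.2) - f z.

Definition carrek (f g : T -> R) (z : T) : \bar R :=
  (2^-1%:E * (\sum_(j < k) \int[lebd R d]_(y in S)
      (nabla j y f z * nabla j y g z * p (tnth z.1 j) y)%:E) +
   carre (fun eta => f (z.1, eta)) (fun eta => g (z.1, eta)) z.2)%E.

Variable cm : {measure set T -> \bar R}.

Definition jform (f g : T -> R) : \bar R :=
  (\int[cm]_(z in tpow k S `*` setT) carrek f g z)%E.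

Definition jform_domain : set (T -> R) :=
  [set f | [/\ Dcirck f, f \in Lfun cm 2%:E & (jform f f < +oo)%E]].

End jump_form.

(* Closability on L^2(mu) of a bilinear form E with domain D. *)
Definition closable dT (T : measurableType dT) (R : realType)
    (mu : {measure set T -> \bar R}) (E : (T -> R) -> (T -> R) -> \bar R)
    (D : set (T -> R)) : Prop :=
  forall f : nat -> T -> R, (forall n, D (f n)) ->
    Lnorm mu 2%:E (EFin \o f n) @[n --> \oo] --> 0%E ->
    (forall e : R, 0 < e -> exists N, forall m n, (N <= m)%N -> (N <= n)%N ->
       (E (f m \- f n)%R (f m \- f n)%R < e%:E)%E) ->
    E (f n) (f n) @[n --> \oo] --> 0%E.

(* Main.v *)
Require Import Defs.
From HB Require Import structures.
From mathcomp Require Import all_boot all_order all_algebra fingroup perm.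
From mathcomp Require Import finmap.
From mathcomp Require Import all_classical all_reals all_analysis.
From mathcomp Require Import measurable_realfun ring lra.
Set Implicit Arguments.
Unset Strict Implicit.
Unset Printing Implicit Defensive.
Import Order.TTheory GRing.Theory Num.Theory.
Import numFieldNormedType.Exports.
Local Open Scope classical_set_scope.
Local Open Scope ring_scope.

(** The form integrates squared increments along jumps, of one point of the tuple or
of one particle of the configuration, so its closability comes down to a property
of null sets. Let [f n] be a Cauchy sequence for the form that tends to [0] in [L^2]
of the Campbell measure of degree [k]. Along a subsequence it converges almost
everywhere. Suppose that, for every null set of this measure, almost every jump from
almost every state avoids it. Then the increments along jumps converge as well, and
Fatou's lemma bounds the energy of [f n] by the limit inferior of the energies of
[f n - f l], which is small by the Cauchy property ([jump_energy_lsc],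
[energy_cvg0]).

That jumps avoid null sets rests on the equivalence of the reduced Palm measures. It
allows one to replace all of them by a single measure [nu], so that the Campbell
measure has the null sets of the product of the Lebesgue measure on [S^k] with [nu]
([reduced_palm_pivot], [campbell_eq0P]). By Fubini, replacing one coordinate of the
tuple by almost any other point then preserves null sets ([reduced_palm_resample]),
which settles the jumps of the points of the tuple ([campbell_tuple_jump]).

The jumps of the particles of the configuration are reduced to the same statement in
degree [k.+1] ([campbell_particle_jump]). Put the points of the tuple back into the
configuration. The resulting measure is the law of [mu] together with the choices of
[k] distinct particles, because it has the same values on the boxes with disjoint
sides ([factorial_campbell_palm], [factorial_campbell_unique]); the one of degree
[k.+1] is therefore obtained from it by choosing one more particle
([factorial_campbell_extend]). Thus a particle of the configuration that jumps is a
point of a longer tuple that is resampled. Since the second correlation measure has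
a density, [mu] is carried by configurations without multiple points
([ae_simple]), so that removing the tuple from the configuration leaves exactly the
other particles.

All of this requires the measurability of the operations on configurations, which is
read off from the counts because these generate the vague Borel sets
([measurable_to_config]). *)

(** * Configurations as measures *)

Section configurations.
Local Open Scope ereal_scope.
Context (R : realType) (d : nat) (S : set 'rV[R]_d).
Implicit Types xi : mconfig S.

Lemma config_eqP xi (eta : mconfig S) : (forall A, xi A = eta A) -> xi = eta.
Proof.
case: xi eta => [c cP] [e eP] /= ce.
have ce' : c = e by apply/funext.
by case: _ / ce' in eP *; rewrite (Prop_irrelevance cP eP).
Qed.

Lemma config_ofE (nu : set 'rV[R]_d -> \bar R) : is_config S nu ->
  cmeas (config_of S nu) = nu.
Proof.
move=> nuP; rewrite /config_of; case: xgetP => //= /(_ (Config nuP)).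
by move=> /(_ erefl).
Qed.

Lemma config_esum xi : exists (L : set nat) (x : nat -> 'rV[R]_d),
  (forall j, L j -> S (x j)) /\
  forall A, cmeas xi A = \esum_(j in L) \d_(x j) A.
Proof. by case: xi => c [[L [x ?]] ?]; exists L, x. Qed.

Lemma config_ge0 xi A : 0 <= xi A.
Proof.
by have [L [x [_ ->]]] := config_esum xi; apply: esum_ge0 => j _; exact: measure_ge0.
Qed.

Lemma config_le xi (A B : set 'rV[R]_d) : A `&` S `<=` B -> xi A <= xi B.
Proof.
have [L [x [Lx xiE]]] := config_esum xi; rewrite !xiE => AB.
apply: le_esum => j Lj; rewrite !diracE lee_fin ler_nat.
by have [/set_mem Ax|//] := boolP (x j \in A); rewrite mem_set//; apply: AB; split=> //; exact: Lx.
Qed.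

Lemma config_setIS xi A : xi (A `&` S) = xi A.
Proof. by apply/eqP; rewrite eq_le !config_le// => x [] []. Qed.

Lemma config_setI0 xi A : A `&` S = set0 -> xi A = 0.
Proof.
move=> A0; apply/eqP; rewrite eq_le config_ge0 andbT -config_setIS A0.
have [L [x [_ ->]]] := config_esum xi.
by rewrite esum1// => j _; rewrite dirac0.
Qed.

(** A copy of the coercion [cmeas], to carry the structure of a Borel measure. *)
Definition pts xi : set 'rV[R]_d -> \bar R := cmeas xi.

Let atoms (L : set nat) (x : nat -> 'rV[R]_d) (j : nat) :
    {measure set 'rV[R]_d -> \bar R} :=
  match j \in L return {measure set 'rV[R]_d -> \bar R} with
  | true => \d_(x j) | false => mzero end.

Let atomsE L x j A : atoms L x j A = if j \in L then \d_(x j) A else 0.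
Proof. by rewrite /atoms; case: (j \in L). Qed.

Lemma pts_series xi : exists (L : set nat) (x : nat -> 'rV[R]_d),
  [/\ (forall j, L j -> S (x j)),
      (forall A, cmeas xi A = \esum_(j in L) \d_(x j) A) &
      pts xi = mseries (atoms L x) 0].
Proof.
have [L [x [Lx xiE]]] := config_esum xi; exists L, x; split=> //.
apply/funext => A; rewrite /pts xiE /mseries esum_mkcond nneseries_esumT//.
by apply: eq_esum => j _; rewrite atomsE.
Qed.

Let pts0 xi : pts xi set0 = 0.
Proof. by have [L [x [_ _ ->]]] := pts_series xi; exact: measure0. Qed.

Let pts_sigma_additive xi : semi_sigma_additive (pts xi).
Proof.
by have [L [x [_ _ ->]]] := pts_series xi; exact: measure_semi_sigma_additive.
Qed.

HB.instance Definition _ xi := isMeasure.Build _ _ _ (pts xi)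
  (pts0 xi) (config_ge0 xi) (pts_sigma_additive (xi := xi)).

Lemma ge0_integral_pts_esum xi (L : set nat) (x : nat -> 'rV[R]_d)
    (G : 'rV[R]_d -> \bar R) :
  (forall A, cmeas xi A = \esum_(j in L) \d_(x j) A) ->
  measurable_fun setT G -> (forall y, 0 <= G y) ->
  \int[pts xi]_y G y = \esum_(j in L) G (x j).
Proof.
move=> xiE mG G0.
transitivity (\int[mseries (atoms L x) 0]_y G y).
  apply: eq_measure_integral => A _ _.
  rewrite -[LHS]/(cmeas xi A) xiE -[RHS]/(\sum_(0 <= k <oo) atoms L x k A).
  rewrite esum_mkcond nneseries_esumT//.
  by apply: eq_esum => j _; rewrite atomsE.
rewrite ge0_integral_measure_series//.
rewrite nneseries_esumT//; last by move=> n; exact: integral_ge0.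
rewrite [RHS]esum_mkcond; apply: eq_esum => j _; rewrite /atoms; case: (j \in L).
  by rewrite integral_dirac// diracT mul1e.
exact: integral_measure_zero.
Qed.

(** A configuration is purely atomic: grouping its Dirac masses by their points
turns the integral into a sum over all points of the space. *)
Lemma esum_pts xi (G : 'rV[R]_d -> \bar R) :
  measurable_fun setT G -> (forall y, 0 <= G y) ->
  (forall x, measurable [set x : 'rV[R]_d]) ->
  \esum_(x in [set: 'rV[R]_d]) (xi [set x] * G x) = \int[pts xi]_y G y.
Proof.
move=> mG G0 m1.
have [L [x [Lx xiE]]] := config_esum xi.
have xiG y : xi [set y] * G y = \esum_(j in [set j | L j /\ x j = y]) G (x j).
  rewrite -[xi [set y]]/(pts xi [set y]) muleC -integral_cst//.
  have -> : \int[pts xi]_(z in [set y]) cst (G y) z =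
            \int[pts xi]_z (G \_ [set y]) z.
    rewrite -integral_mkcond; apply: eq_integral => z; rewrite inE => -> //.
  rewrite (ge0_integral_pts_esum xiE)//.
    rewrite (_ : [set j | L j /\ x j = y] = L `&` [set j | x j = y])//.
    rewrite esum_mkcondr; apply: eq_esum => j Lj.
    rewrite patchE (_ : (x j \in _) = (j \in [set j | x j = y]))//.
  - by apply/measurable_restrict => //; exact: measurable_funTS.
  - by move=> z; rewrite patchE; case: ifP.
under eq_esum do rewrite xiG.
rewrite (esum_esum (a := fun _ j => G (x j)))//.
rewrite (ge0_integral_pts_esum xiE)//.
rewrite (@reindex_esum _ _ _ L _ (fun j => (x j, j)))//.
split.
- by move=> j Lj /=; split.
- by move=> i j _ _ [].
- by move=> [y j] /= [_ [Lj <-]]; exists j.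
Qed.

End configurations.

Section labels.
Local Open Scope ereal_scope.
Context (R : realType) (d : nat) (S : set 'rV[R]_d).
Implicit Types xi : mconfig S.

Lemma bounded_setP_le (A : set 'rV[R]_d) : bounded_set A ->
  exists n : nat, A `<=` [set x | (`|x| <= n%:R)%R].
Proof.
move=> [M [_ AM]]; exists (Num.truncn `|M|%R).+2 => x Ax /=.
apply: (AM _ _ x Ax); rewrite (le_lt_trans (ler_norm _))//.
by rewrite (lt_trans (truncnS_gt _))// ltr_nat.
Qed.

Hypothesis cS : closed S.

Lemma config_fin xi A : bounded_set A -> xi A < +oo.
Proof.
move=> /bounded_setP_le[n An].
apply: (@le_lt_trans _ _ (xi ([set x | (`|x| <= n%:R)%R] `&` S))).
  by apply: config_le => x [Ax Sx]; split=> //; exact: An.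
apply: (cmeasP xi).2; last by move=> x [].
apply: bounded_closed_compact.
  by exists n%:R; split=> // M nM x [/= xn _]; exact: le_trans xn (ltW nM).
apply: closedI => //.
rewrite (_ : [set x | _] = Num.Def.normr @^-1` [set r | (r <= n%:R)%R])//.
by apply: closed_comp; [move=> ? _; exact: norm_continuous|exact: closed_le].
Qed.

(** Infinitely many Dirac masses in a bounded set would give infinite mass to a
compact part of the closed set [S]. *)
Lemma config_labels xi A : bounded_set A ->
  exists s : seq 'rV[R]_d, (forall y, y \in s -> A y /\ S y) /\
    forall B, xi (A `&` B) = \sum_(y <- s) \d_y B.
Proof.
move=> bA; have := config_fin xi bA.
have [L [x [Lx xiE]]] := config_esum xi; rewrite xiE => finA.
have dE j B : \d_(x j) (A `&` B) =
    (if j \in [set j | A (x j)] then \d_(x j) B else 0 : \bar R).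
  rewrite !diracE in_setI (_ : (j \in _) = (x j \in A)); last first.
    by apply/idP/idP => /set_mem ?; exact/mem_set.
  by case: (x j \in A).
have fL : finite_set (L `&` [set j | A (x j)]).
  apply: contrapT => infL; move: finA; rewrite -[A]setIT.
  under eq_esum do rewrite dE; rewrite -esum_mkcondr.
  apply/negP; rewrite -leNgt leye_eq; apply/eqP/eqyP => M M0.
  have [B BL Bn] := infinite_set_fset (Num.truncn M).+1 infL.
  apply: esum_ge; exists [set` B]; first by split=> //; exact: finite_fset.
  rewrite fsbig_finite//= (eq_bigr (fun=> 1%:E)); last by move=> i _; rewrite diracT.
  rewrite set_fsetK sumEFin big_const_seq iter_addr addr0 lee_fin.
  rewrite (le_trans (ltW (truncnS_gt M)))// ler_nat.
  by rewrite count_predT; exact: leq_trans Bn.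
have /finite_fsetP[F LF] := fL.
exists [seq x j | j <- F]; split.
  move=> y /mapP[j jF ->]; have [Lj Axj] : (L `&` [set j | A (x j)]) j by rewrite LF.
  by split=> //; exact: Lx.
move=> B; rewrite xiE; under eq_esum do rewrite dE.
rewrite -esum_mkcondr LF esum_fset//= ?fsbig_finite//=; last first.
rewrite set_fsetK big_map//.
Qed.

Lemma config_natP xi A : bounded_set A -> exists n : nat, xi A = n%:R%:E.
Proof.
move=> /(config_labels xi)[s [_ /(_ setT)]]; rewrite setIT => ->.
exists (size s); under eq_bigr do rewrite diracT.
by rewrite sumEFin big_const_seq count_predT iter_addr addr0.
Qed.

Lemma config_fin_num xi A : bounded_set A -> xi A \is a fin_num.
Proof. by move=> /(config_natP xi)[n ->]. Qed.

End labels.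

(** * Adding, removing and moving particles *)

Section surgery.
Local Open Scope ereal_scope.
Context (R : realType) (d : nat) (S : set 'rV[R]_d).
Hypothesis cS : closed S.
Implicit Types xi : mconfig S.

Lemma bounded_set1 (x : 'rV[R]_d) : bounded_set [set x].
Proof. by exists `|x|%R; split=> // M xM _ ->; exact: ltW. Qed.

Definition is_particle xi (x : 'rV[R]_d) : Prop := xi [set x] != 0.

Lemma particleS xi x : is_particle xi x -> S x.
Proof.
move=> xix; apply: contrapT => nSx; move/eqP: xix; apply; apply: config_setI0.
by apply/seteqP; split=> // y [-> /nSx].
Qed.

Lemma particle_ge1 xi x : is_particle xi x -> 1 <= xi [set x].
Proof.
have [n xin] := config_natP cS xi (bounded_set1 x).
rewrite /is_particle xin eqe pnatr_eq0 -lt0n => n0.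
by rewrite lee_fin ler1n.
Qed.

Lemma particle_le xi x (A : set 'rV[R]_d) : is_particle xi x -> \d_x A <= xi A.
Proof.
move=> xix; rewrite diracE; have [/set_mem Ax|_] := boolP (x \in A).
  by rewrite (le_trans (particle_ge1 xix))//; apply: config_le => y [-> _].
exact: config_ge0.
Qed.

Lemma is_config_addp xi y : S y -> is_config S (fun A => xi A + \d_y A).
Proof.
move=> Sy; split; last first.
  by move=> K cK KS; rewrite diracE lte_add_pinfty ?ltry//; exact: (cmeasP xi).2.
have [L [x [Lx xiE]]] := config_esum xi.
exists ([set 0%N] `|` [set n.+1 | n in L]), (fun n => if n is m.+1 then x m else y).
split=> [[|j]//|A]; first by move=> [//|[m Lm [<-]]]; exact: Lx.
rewrite (esumID [set 0%N]); last by move=> *; exact: measure_ge0.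
rewrite addeC xiE; congr (_ + _); last first.
  rewrite (_ : _ `&` _ = [set 0%N]) ?esum_set1//.
  by apply/seteqP; split=> [j []//|j ->]; split=> //; left.
rewrite [RHS](@reindex_esum _ _ _ L _ succn)//; split.
- by move=> j Lj /=; split=> //; right; exists j.
- by move=> i j _ _ [].
- by move=> j /= [[->//|[m Lm <-] _]]; exists m.
Qed.

Lemma is_config_subp xi x : is_particle xi x ->
  is_config S (fun A => xi A - \d_x A).
Proof.
move=> xix; split; last first.
  move=> K cK KS; rewrite diracE lte_add_pinfty ?ltry//.
  exact: (cmeasP xi).2.
have [L [z [Lz xiE]]] := config_esum xi.
have [j0 Lj0 zj0] : exists2 j, L j & z j = x.
  apply: contrapT => nex; move/eqP: xix; apply; rewrite xiE esum1// => j Lj.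
  by rewrite diracE memNset// => zjx; apply: nex; exists j.
exists (L `&` ~` [set j0]), z; split=> [j [Lj _]|A]; first exact: Lz.
rewrite xiE (esumID [set j0]); last by move=> *; exact: measure_ge0.
rewrite (_ : L `&` [set j0] = [set j0]); last first.
  by apply/seteqP; split=> [j []//|j ->].
rewrite esum_set1// zj0 addeC addeK//.
Qed.

Lemma is_config_restr xi (B : set 'rV[R]_d) : is_config S (fun A => xi (A `&` B)).
Proof.
split; last first.
  move=> K cK KS; apply: le_lt_trans ((cmeasP xi).2 _ cK KS).
  by apply: config_le => x [[]].
have [L [z [Lz xiE]]] := config_esum xi.
exists (L `&` [set j | B (z j)]), z; split=> [j [Lj _]|A]; first exact: Lz.
rewrite xiE esum_mkcondr; apply: eq_esum => j Lj; rewrite !diracE in_setI.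
rewrite (_ : (j \in _) = (z j \in B)); last first.
  by apply/idP/idP => /set_mem ?; exact/mem_set.
by case: (z j \in B); rewrite ?andbT ?andbF.
Qed.

Lemma restrE r xi A : restr r xi A = xi (A `&` Uball S r).
Proof. by rewrite /restr config_ofE//; exact: is_config_restr. Qed.

Definition addp xi y : mconfig S := config_of S (fun A => xi A + \d_y A).

Lemma addpE xi y A : S y -> addp xi y A = xi A + \d_y A.
Proof. by move=> Sy; rewrite /addp config_ofE//; exact: is_config_addp. Qed.

Lemma jumpE xi x y A : is_particle xi x -> S y ->
  jump xi x y A = xi A - \d_x A + \d_y A.
Proof.
move=> xix Sy; rewrite /jump config_ofE//.
pose c : mconfig S := config_of S (fun A => xi A - \d_x A).
have cE : cmeas c = (fun A => xi A - \d_x A).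
  by rewrite config_ofE//; exact: is_config_subp.
by have := is_config_addp c Sy; rewrite cE.
Qed.

Lemma jump_id xi x : jump xi x x = xi.
Proof.
rewrite /jump.
rewrite (_ : (fun A => _) = cmeas xi); last first.
  by apply/funext => A; rewrite subeK.
by apply: config_eqP => A; rewrite config_ofE//; exact: cmeasP.
Qed.

Lemma sum_dirac_fin (s : seq 'rV[R]_d) A :
  \sum_(x <- s) \d_x A \is a (@fin_num R).
Proof. by under eq_bigr do rewrite diracE; rewrite sumEFin. Qed.

(** [s] is a sublist, with multiplicities, of the particles of [xi]. *)
Definition sub_particles xi (s : seq 'rV[R]_d) : Prop :=
  forall x, x \in s -> (\sum_(y <- s) \d_y [set x] <= xi [set x])%E.

Lemma sum_dirac_count (s : seq 'rV[R]_d) z :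
  \sum_(y <- s) \d_y [set z] = (count_mem z s)%:R%:E :> \bar R.
Proof.
under eq_bigr do rewrite diracE.
rewrite sumEFin -natr_sum; congr (_ %:R%:E)%R.
rewrite -sum1_count [RHS]big_mkcond; apply: eq_bigr => y _ /=.
rewrite (_ : (y \in _) = (y == z)); last first.
  by apply/idP/eqP => [/set_mem//|?]; exact/mem_set.
by case: (y == z).
Qed.

Lemma uniq_sub_particles xi s : uniq s ->
  (forall x, x \in s -> is_particle xi x) -> sub_particles xi s.
Proof.
move=> us sxi x xs; rewrite sum_dirac_count count_uniq_mem// xs.
by apply: particle_ge1; exact: sxi.
Qed.

(** Unless [s] is a sublist of the particles, the difference is negative on a
singleton, and [remove] takes its default value. *)
Lemma is_config_remove xi (s : seq 'rV[R]_d) :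
  sub_particles xi s <-> is_config S (fun A => xi A - \sum_(x <- s) \d_x A).
Proof.
split=> [|cs x xs]; last first.
  have := config_ge0 (Config cs : mconfig S) [set x].
  by rewrite /= sube_ge0 ?sum_dirac_fin//.
elim: s => [_|x s IH sxi].
  under eq_fun do rewrite big_nil sube0; exact: cmeasP.
have cs : is_config S (fun A => xi A - \sum_(x <- s) \d_x A).
  apply: IH => // y ys; apply: le_trans (sxi y _); last by rewrite inE ys orbT.
  by rewrite big_cons leeDr// measure_ge0.
pose c : mconfig S := Config cs.
rewrite (_ : (fun A => _) = (fun A => c A - \d_x A)).
  apply: is_config_subp; rewrite /is_particle /=.
  have := sxi x (mem_head _ _); rewrite big_cons diracE mem_set// => xs.
  rewrite gt_eqF// sube_gt0 (lt_le_trans _ xs)//.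
  by rewrite sum_dirac_count -EFinD lte_fin ltrDr.
apply/funext => A /=; rewrite big_cons fin_num_oppeD ?sum_dirac_fin//.
by rewrite addeA addeAC.
Qed.

Lemma remove_sub n (x : n.-tuple 'rV[R]_d) xi A :
  sub_particles xi x -> remove x xi A = xi A - \sum_(y <- x) \d_y A.
Proof.
move=> xxi; rewrite /remove config_ofE; first by rewrite big_tuple.
rewrite (_ : (fun A => _) = (fun A => xi A - \sum_(y <- x) \d_y A)).
  exact/is_config_remove.
by apply/funext => B; rewrite big_tuple.
Qed.

Lemma remove_nsub n (x : n.-tuple 'rV[R]_d) xi :
  ~ sub_particles xi x -> remove x xi = point.
Proof.
move=> xxi; rewrite /remove /config_of; case: xgetP => // eta _ /= etaE.
exfalso; apply: xxi; apply/is_config_remove; have := cmeasP eta; rewrite etaE.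
by under [X in _ -> _ X]eq_fun do rewrite big_tuple.
Qed.

Lemma removeE n (x : n.-tuple 'rV[R]_d) xi A :
  uniq x -> (forall y, y \in x -> is_particle xi y) ->
  remove x xi A = xi A - \sum_(y <- x) \d_y A.
Proof.
by move=> ux xxi; rewrite remove_sub//; exact: uniq_sub_particles.
Qed.

Definition simple_config xi : Prop := forall x, xi [set x] <= 1.

Lemma simple_particle xi x : simple_config xi -> is_particle xi x -> xi [set x] = 1.
Proof.
by move=> sxi /particle_ge1 x1; apply/eqP; rewrite eq_le x1 andbT; exact: sxi.
Qed.

(** Were [xi] not simple, a particle at a point of [x] could survive the removal
of [x]. *)
Lemma particle_remove n (x : n.-tuple 'rV[R]_d) xi z :
  simple_config xi -> uniq x -> (forall y, y \in x -> is_particle xi y) ->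
  is_particle (remove x xi) z <-> is_particle xi z /\ z \notin x.
Proof.
move=> sxi ux xxi; rewrite /is_particle removeE//.
rewrite sum_dirac_count count_uniq_mem//.
split=> [xiz|[xiz zx]]; last by rewrite (negbTE zx) sube0.
have [zx|zx] := boolP (z \in x); last by rewrite (negbTE zx) sube0 in xiz.
by move: xiz; rewrite (simple_particle sxi (xxi _ zx)) zx subee ?eqxx.
Qed.

(** The jump of a particle that is left when [x] is removed adds a point to what
is left when that particle is removed as well: this turns particle jumps into the
resampling of one more point of the tuple. *)
Lemma jump_remove n (x : n.-tuple 'rV[R]_d) xi z y :
  uniq x -> (forall y, y \in x -> is_particle xi y) ->
  is_particle xi z -> z \notin x -> is_particle (remove x xi) z -> S y ->
  jump (remove x xi) z y = addp (remove (tcons (z, x)) xi) y.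
Proof.
move=> ux xxi xiz zx rz Sy; apply: config_eqP => A.
have zxP w : w \in tcons (z, x) -> is_particle xi w.
  by rewrite inE => /orP[/eqP->//|]; exact: xxi.
rewrite jumpE// addpE// removeE// removeE ?[uniq _]/=; [|by rewrite zx|by []].
congr (_ + _); rewrite big_cons [in RHS]fin_num_oppeD ?sum_dirac_fin//.
by rewrite addeA addeAC.
Qed.

Lemma remove_addp n (x : n.-tuple 'rV[R]_d) xi z :
  uniq x -> (forall y, y \in x -> is_particle xi y) ->
  is_particle xi z -> z \notin x ->
  remove x xi = addp (remove (tcons (z, x)) xi) z.
Proof.
move=> ux xxi xiz zx; apply: config_eqP => A.
have zxP w : w \in tcons (z, x) -> is_particle xi w.
  by rewrite inE => /orP[/eqP->//|]; exact: xxi.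
rewrite addpE; last exact: particleS xiz.
rewrite removeE// removeE ?[uniq _]/=; [|by rewrite zx|by []].
rewrite big_cons [in RHS]fin_num_oppeD ?sum_dirac_fin//.
by rewrite addeA addeAC subeK.
Qed.

End surgery.

(** * Borel sets of matrices and row vectors *)

Section borel_row.
Context (R : realType).

(** An open set of matrices is a countable union of rational balls, and a ball is
a product of intervals. *)
Lemma measurable_to_mx dX (X : measurableType dX) m n (f : X -> 'M[R]_(m, n)) :
  (forall i j, measurable_fun setT (fun x => f x i j)) -> measurable_fun setT f.
Proof.
move=> mf; apply: (@measurability _ _ _ _ _ _ (open : set (set 'M[R]_(m, n)))) => //.
move=> _ [A oA <-]; rewrite setTI.
pose B (q : 'M[rat]_(m, n) * rat) : set 'M[R]_(m, n) :=
  if `[< ball (map_mx ratr q.1 : 'M[R]_(m, n)) (ratr q.2) `<=` A >]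
  then ball (map_mx ratr q.1 : 'M[R]_(m, n)) (ratr q.2) else set0.
have -> : A = \bigcup_q B q.
  apply/seteqP; split=> [x Ax|x [q _]]; last first.
    by rewrite /B; case: asboolP => // + qx; apply.
  have [Q [e [Qex QeA]]] := mx_ball_rat oA Ax.
  by exists (Q, e) => //; rewrite /B/=; case: asboolP.
rewrite preimage_bigcup.
apply: countable_bigcupT_measurable => [|[Q e]]; first exact: countableP.
rewrite /B/=; case: asboolP => _; last by rewrite preimage_set0.
have [e0|e0] := ltP 0 (ratr e : R); last first.
  rewrite (_ : _ @^-1` _ = set0)//; apply/seteqP; split=> // t [].
  by rewrite ltNge e0.
rewrite (_ : _ @^-1` _ = \bigcap_(ij in [set: 'I_m * 'I_n])
    ((fun x => f x ij.1 ij.2) @^-1` ball (ratr (Q ij.1 ij.2) : R) (ratr e))).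
  apply: fin_bigcap_measurable => // -[i j] _.
  rewrite -[X in measurable X]setTI; apply: mf => //.
  by apply: open_measurable; exact: ball_open.
apply/seteqP; split=> [t [_ Qt] [i j] _|t Qt].
  by have := Qt i j; rewrite !mxE.
by split=> // i j; rewrite !mxE; exact: (Qt (i, j)).
Qed.

Lemma closed_measurable_mx m n (A : set 'M[R]_(m, n)) : closed A -> measurable A.
Proof.
by move=> cA; rewrite -[A]setCK; apply: measurableC; apply: open_measurable_mx; rewrite openC.
Qed.

Lemma continuous_measurable_mx m n (f : 'M[R]_(m, n) -> R) : continuous f ->
  measurable_fun setT f.
Proof.
move=> cf; apply: (measurability _ (RGenOpens.measurableE R)).
move=> _ [_ [a [b ->]] <-]; rewrite setTI; apply: open_measurable_mx.
by apply: open_comp; [move=> ? _; exact: cf|exact: interval_open].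
Qed.

Context (d : nat).

Lemma measurable_set1_row (x : 'rV[R]_d) : measurable [set x].
Proof.
apply: closed_measurable_mx; apply: accessible_closed_set1.
by apply: hausdorff_accessible; exact: norm_hausdorff.
Qed.

Lemma measurable_norm_row : measurable_fun setT (fun x : 'rV[R]_d => `|x|).
Proof. by apply: continuous_measurable_mx; exact: norm_continuous. Qed.

Lemma measurable_diag_row dX (X : measurableType dX) (f g : X -> 'rV[R]_d) :
  measurable_fun setT f -> measurable_fun setT g ->
  measurable [set x | f x = g x].
Proof.
move=> mf mg.
rewrite (_ : [set x | _] =
    \bigcap_(j in [set: 'I_d]) ((fun x => f x 0 j - g x 0 j) @^-1` [set 0])).
  apply: fin_bigcap_measurable => // j _; rewrite -[X in measurable X]setTI.
  have mc (h : X -> 'rV[R]_d) : measurable_fun setT h ->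
      measurable_fun setT (fun x => h x 0 j).
    by move=> mh; apply: (measurableT_comp (@measurable_mx_coord R 1 d 0 j)).
  by apply: measurable_funB => //; exact: mc.
apply/seteqP; split=> x /= fg; first by move=> j _ /=; rewrite fg subrr.
by apply/rowP => j; apply/eqP; rewrite -subr_eq0; apply/eqP; exact: fg.
Qed.

Lemma measurable_enorm : measurable_fun setT (@enorm R d).
Proof.
rewrite /enorm; apply: (measurableT_comp (continuous_measurable_fun (@sqrt_continuous R))).
apply: measurable_sum => j; apply: measurable_funX; exact: measurable_mx_coord.
Qed.

(** Positivity sets rather than open sets: the function [u] yields at once the
continuous functions of bounded support that approximate the indicator of [A]. *)
Definition posset : set (set 'rV[R]_d) := [set A | bounded_set A /\
  exists2 u : 'rV[R]_d -> R, continuous u & A = [set x | 0 < u x]].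

Lemma continuous_ball_margin (V : normedModType R) (x : V) (e : R) :
  continuous (fun y => e - `|x - y|).
Proof.
move=> y; apply: cvgB; first exact: cvg_cst.
by apply: cvg_norm; apply: cvgB; [exact: cvg_cst|exact: cvg_id].
Qed.

Lemma posset_ball (x : 'rV[R]_d) (e : R) : 0 < e -> posset (ball x e).
Proof.
move=> e0; split.
  exists (`|x| + e); split; first by rewrite num_real.
  move=> M xeM y /=; rewrite mx_norm_ball /ball_ /= => xye.
  rewrite (le_trans _ (ltW xeM))// -lerBlDl.
  by rewrite (le_trans (lerB_dist _ _))// distrC ltW.
exists (fun y => e - `|x - y|).
  exact: continuous_ball_margin.
by rewrite mx_norm_ball /ball_; apply/seteqP; split=> y /=; rewrite subr_gt0.
Qed.

Lemma posset_measurable A : posset A -> measurable A.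
Proof.
move=> [_ [u cu ->]]; rewrite (_ : [set x | _] = u @^-1` `]0, +oo[%classic).
  by rewrite -[X in measurable X]setTI; exact: continuous_measurable_mx.
by apply/seteqP; split=> x /=; rewrite in_itv/= andbT.
Qed.

Lemma setI_closed_posset : setI_closed posset.
Proof.
move=> A B [bA [u cu uA]] [_ [v cv vB]]; rewrite uA vB; split.
  move: bA => [M [Mr MA]]; exists M; split=> // N MN x [Ax _].
  by apply: (MA N MN x); rewrite uA.
exists (fun x => Num.min (u x) (v x)).
  by move=> x; apply: continuous_min; [exact: cu|exact: cv].
by apply/seteqP; split=> x /=; rewrite lt_min => /andP.
Qed.

Lemma posset_generates : @measurable _ 'rV[R]_d = <<s posset >>.
Proof.
apply/seteqP; split; last first.
  apply: smallest_sub; first exact: sigma_algebra_measurable.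
  exact: posset_measurable.
apply: smallest_sub; first exact: smallest_sigma_algebra.
move=> A oA; pose B (q : 'rV[rat]_d * rat) : set 'rV[R]_d :=
  if `[< ball (map_mx ratr q.1 : 'rV[R]_d) (ratr q.2) `<=` A >] && (0 < ratr q.2 :> R)
  then ball (map_mx ratr q.1 : 'rV[R]_d) (ratr q.2) else set0.
have -> : A = \bigcup_q B q.
  apply/seteqP; split=> [x Ax|x [q _]]; last first.
    by rewrite /B; case: asboolP => //= + ; case: ifP => // _ + qx; apply.
  have [Q [e [Qex QeA]]] := mx_ball_rat oA Ax.
  exists (Q, e) => //; rewrite /B/=; case: asboolP => //= _; case: ifPn => // /negP[].
  by case: Qex.
apply: (@countable_bigcupT_measurable _ (g_sigma_algebraType posset)).
  exact: countableP.
move=> [Q e]; rewrite /B /=; case: ifPn => [/andP[_ e0]|_].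
  by apply: sub_sigma_algebra; exact: posset_ball.
exact: (@measurable0 _ (g_sigma_algebraType posset)).
Qed.

End borel_row.

(** * The vague Borel sets are generated by the counts *)

Section vague_borel.
Context (R : realType) (d : nat) (S : set 'rV[R]_d).
Hypothesis cS : closed S.
Implicit Types xi : mconfig S.

Lemma psum_labels xi (A : set 'rV[R]_d) (s : seq 'rV[R]_d) (g : 'rV[R]_d -> R) :
  (forall y, y \in s -> A y /\ S y) ->
  (forall B, xi (A `&` B) = \sum_(y <- s) \d_y B)%E ->
  (forall y, S y -> ~ A y -> g y = 0) ->
  psum xi (EFin \o g) = (\sum_(y <- s) g y)%:E.
Proof.
move=> sA xiA g0.
have key (h : 'rV[R]_d -> R) : (forall y, 0 <= h y) ->
    (forall y, S y -> ~ A y -> h y = 0) ->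
    (\esum_(x in [set: 'rV[R]_d]) (xi [set x] * (h x)%:E) = (\sum_(y <- s) h y)%:E)%E.
  move=> h0 hA.
  have xE x : (xi [set x] * (h x)%:E = \sum_(y <- s) (\d_y [set x] * (h x)%:E))%E.
    have [Sx|nSx] := pselect (S x); last first.
      rewrite config_setI0 ?mul0e; last by apply/seteqP; split=> // y [-> /nSx].
      rewrite big_seq big1// => y /sA[_ Sy]; rewrite diracE memNset ?mul0e//=.
      by move=> yx; apply: nSx; rewrite -yx.
    have [Ax|nAx] := pselect (A x); last first.
      by rewrite hA// mule0 big1// => y _; rewrite mule0.
    have -> : (xi [set x] = \sum_(y <- s) \d_y [set x])%E.
      by rewrite -xiA; congr (cmeas xi _); apply/seteqP; split=> [y ->|y []].
    by rewrite ge0_sume_distrl// => y _; exact: measure_ge0.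
  under eq_esum do rewrite xE.
  rewrite esum_sum; last by move=> x y _ _; rewrite mule_ge0// ?lee_fin// measure_ge0.
  rewrite -sumEFin; apply: eq_bigr => y _.
  rewrite (esumID [set y]); last by move=> x _; rewrite mule_ge0// ?lee_fin// measure_ge0.
  rewrite setTI esum_set1; last by rewrite mule_ge0// ?lee_fin// measure_ge0.
  rewrite diracE mem_set// mul1e esum1 ?adde0// => x [_ xy].
  by rewrite diracE memNset ?mul0e//= => yx; apply: xy; rewrite /= yx.
rewrite /psum.
under eq_esum do rewrite funeposE /=.
under [X in (_ - X)%E]eq_esum do rewrite funenegE /=.
under eq_esum do rewrite -EFin_max.
under [X in (_ - X)%E]eq_esum do rewrite -EFin_max.
rewrite (key (fun x => Num.max (g x) 0)); last 2 first.
  by move=> y; rewrite le_max lexx orbT.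
  by move=> y Sy nAy; rewrite g0// maxxx.
rewrite (key (fun x => Num.max (- g x) 0)); last 2 first.
  by move=> y; rewrite le_max lexx orbT.
  by move=> y Sy nAy; rewrite g0// oppr0 maxxx.
rewrite -EFinB -sumrB; congr EFin; apply: eq_bigr => y _.
have [gy|/ltW gy] := leP (g y) 0.
  by rewrite max_l ?sub0r ?opprK// oppr_ge0.
by rewrite max_r ?subr0// oppr_le0.
Qed.

Lemma continuous_truncation (T : topologicalType) (u : T -> R) (a : R) :
  continuous u -> continuous (fun x => Num.min 1 (a * Num.max 0 (u x))).
Proof.
move=> cu x; apply: (@continuous_min _ _ (fun=> 1) (fun x => a * Num.max 0 (u x))).
  exact: cvg_cst.
apply: cvgM; first exact: cvg_cst.
by apply: (@continuous_max _ _ (fun=> 0) u); [exact: cvg_cst|exact: cu].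
Qed.

(** Truncated at [1], the multiples of a continuous function increase to the
indicator of its positivity set; this gives the vague measurability of counts. *)
Lemma measurable_posset_count (A : set 'rV[R]_d) : posset A ->
  measurable_fun setT (fun xi : mconfig S => xi A).
Proof.
move=> [bA [u cu uA]].
pose g n (x : 'rV[R]_d) := Num.min 1 (n%:R * Num.max 0 (u x)).
have g0 n x : 0 <= g n x.
  by rewrite le_min ler01 mulr_ge0// le_max lexx.
have gA n y : S y -> ~ A y -> g n y = 0.
  rewrite uA /= => _ /negP; rewrite -leNgt => uy.
  by rewrite /g max_l// mulr0 min_r.
have cg n : continuous (g n).
  exact: continuous_truncation.
have CcgN n : Cc S (g n).
  split; first by apply: continuous_subspaceT.
  have [N AN] := bounded_setP_le bA.
  exists ([set x | `|x| <= N%:R] `&` S); split.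
  - apply: bounded_closed_compact.
      by exists N%:R; split=> // M NM x [/= xN _]; exact: le_trans xN (ltW NM).
    apply: closedI => //.
    rewrite (_ : [set x | _] = Num.Def.normr @^-1` [set r | (r <= N%:R)%R])//.
    by apply: closed_comp; [move=> ? _; exact: norm_continuous|exact: closed_le].
  - by move=> x [].
  - by move=> x Sx nx; apply: gA => // Ax; apply: nx; split=> //; exact: AN.
have mg n : measurable_fun setT (fun xi : mconfig S => psum xi (EFin \o g n)).
  apply: (measurability _ (ErealGenOInfty.measurableE R)) => //.
  move=> _ [_ [a ->] <-]; rewrite setTI; apply: sub_sigma_algebra.
  move=> xi /=; rewrite in_itv/= andbT.
  have [s [sA xiA]] := config_labels cS xi bA.
  rewrite (psum_labels sA xiA (gA n)) lte_fin => xia.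
  exists 1%N, (fun=> g n), (\sum_(y <- s) g n y - a); split=> //.
    by rewrite subr_gt0.
  move=> eta /(_ ord0).
  have [t [tA etaA]] := config_labels cS eta bA.
  rewrite (psum_labels tA etaA (gA n)) in_itv/= andbT.
  rewrite (psum_labels sA xiA (gA n)) -EFinB abse_EFin !lte_fin ltr_distl => /andP[+ _].
  by rewrite subKr.
apply: (@emeasurable_fun_cvg _ _ _ _ (fun n xi => psum xi (EFin \o g n))) => //.
move=> xi _; apply: cvg_near_cst.
have [s [sA xiA]] := config_labels cS xi bA.
have -> : (xi A = (\sum_(y <- s) 1)%:E)%E.
  rewrite -[A in LHS]setIT xiA; under eq_bigr do rewrite diracT.
  by rewrite sumEFin.
have : \forall n \near \oo, forall y, y \in s -> g n y = 1.
  elim: s sA {xiA} => [|y s IH] sA; first exact: nearW.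
  have {}IH : \forall n \near \oo, forall y, y \in s -> g n y = 1.
    by apply: IH => z zs; apply: sA; rewrite inE zs orbT.
  have uy : 0 < u y by have [] := sA y (mem_head _ _); rewrite uA.
  apply: filterS2 IH (nbhs_infty_ger (u y)^-1) => n IH uyn z.
  rewrite inE => /orP[/eqP ->|/IH//].
  by rewrite /g max_r ?(ltW uy)// min_l// -ler_pdivrMr// div1r.
apply: filterS => n gn; rewrite (psum_labels sA xiA (gA n)); congr EFin.
by rewrite big_seq [RHS]big_seq; apply: eq_bigr.
Qed.

Definition level (x : 'rV[R]_d) : nat := Num.truncn `|x|.

Lemma measurable_level (B : set nat) : measurable (level @^-1` B).
Proof.
rewrite (_ : _ @^-1` _ = \bigcup_(n in B)
    ((fun x : 'rV[R]_d => `|x|) @^-1` `[n%:R, n.+1%:R[%classic)).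
  apply: bigcup_measurable => n _; rewrite -[X in measurable X]setTI.
  by apply: measurable_norm_row => //; exact: measurable_itv.
apply/seteqP; split=> [x Bx|x [n Bn /=]].
  by exists (level x) => //=; rewrite in_itv/= truncn_itv.
by rewrite in_itv/= => nx; rewrite /level (truncn_def nx).
Qed.

(** Inside a bounded set the counts are finite, so that Dynkin induction applies;
the levels of the norm then cut the space into countably many bounded pieces. *)
Lemma measurable_count (A : set 'rV[R]_d) : measurable A ->
  measurable_fun setT (fun xi : mconfig S => xi A).
Proof.
move=> mA.
have mAB C B : measurable C -> posset B ->
    measurable_fun setT (fun xi : mconfig S => xi (C `&` B)).
  move=> mC pB; have mB := posset_measurable pB.
  pose P (A : set 'rV[R]_d) := measurable_fun setT (fun xi : mconfig S => xi (A `&` B)).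
  apply: (@dynkin_induction _ 'rV[R]_d (@posset R d) P) => //.
  - exact: posset_generates.
  - exact: setI_closed_posset.
  - by rewrite /P; under eq_fun do rewrite setTI; exact: measurable_posset_count.
  - move=> D pD; apply: measurable_posset_count; exact: setI_closed_posset.
  - move=> D mD PD; rewrite /P.
    rewrite (_ : (fun _ => _) = (fun xi : mconfig S => xi B - xi (D `&` B))%E).
      by apply: emeasurable_funB => //; exact: measurable_posset_count.
    apply/funext => xi; transitivity (pts xi (B `\` D)).
      by rewrite setDE setIC.
    rewrite measureD//; first by rewrite (setIC D).
    by rewrite ltey_eq; apply/orP; left; apply: config_fin_num => //; case: pB.
  - move=> F mF tF PF; rewrite /P.
    rewrite (_ : (fun _ => _) = (fun xi : mconfig S => \sum_(n <oo) pts xi (F n `&` B))%E).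
      apply: ge0_emeasurable_sum; last by move=> n _; exact: PF.
      by move=> n xi _ _; exact: measure_ge0.
    apply/funext => xi; rewrite setI_bigcupl -[LHS]/(pts xi _) measure_bigcup//.
    + by apply: eq_eseriesl => n; rewrite in_setT.
    + by move=> n _; exact: measurableI.
    + exact: trivIset_setIr.
  - by rewrite -posset_generates.
rewrite (_ : (fun _ => _) = (fun xi : mconfig S =>
    \sum_(n <oo) pts xi (A `&` level @^-1` [set n]))%E).
  apply: ge0_emeasurable_sum => [n xi _ _|n _]; first exact: measure_ge0.
  under eq_fun do rewrite -[pts _ _]/(cmeas _ _).
  rewrite (_ : A `&` _ = (A `&` level @^-1` [set n]) `&` ball (0 : 'rV[R]_d) n.+1%:R).
    apply: mAB; last exact: posset_ball.
    by apply: measurableI => //; exact: measurable_level.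
  apply/esym/setIidl => x [_ /= <-].
  by rewrite mx_norm_ball /ball_ /= sub0r normrN truncnS_gt.
apply/funext => xi; rewrite -[LHS]/(pts xi A) -[A in LHS]setIT.
rewrite (_ : setT = \bigcup_n level @^-1` [set n]); last first.
  by apply/seteqP; split=> // x _; exists (level x).
rewrite setI_bigcupr measure_bigcup//.
- by apply: eq_eseriesl => n; rewrite in_setT.
- by move=> n _; apply: measurableI => //; exact: measurable_level.
- by apply: trivIset_setIl => i j _ _ [x [<- <-]].
Qed.

(** The points of two lists with the same multiset of cells are paired cell by
cell. *)
Lemma perm_map_dist (T : eqType) (c : T -> 'rV[int]_d) (g : T -> R) (e : R)
    (s t : seq T) :
  perm_eq (map c t) (map c s) ->
  (forall x y, x \in s -> y \in t -> c y = c x -> `|g y - g x| <= e) ->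
  `|\sum_(y <- t) g y - \sum_(x <- s) g x| <= (size s)%:R * e.
Proof.
elim: s t => [|x s IH] t.
  move=> /perm_nilP; case: t => //= _ _.
  by rewrite !big_nil subrr normr0 mul0r.
move=> tsP tsg.
have /mapP[y yt cxy] : c x \in map c t by rewrite (perm_mem tsP) mem_head.
have tP := perm_to_rem yt.
rewrite (perm_big _ tP) !big_cons /= opprD addrACA.
rewrite (le_trans (ler_normD _ _))// -(addn1 (size s)) natrD mulrDl mul1r [leRHS]addrC.
rewrite lerD//; first by apply: tsg => //; rewrite mem_head.
apply: IH => [|x' y' x's y't]; last first.
  by apply: tsg; [rewrite inE x's orbT|exact: mem_rem y't].
rewrite -(perm_cons (c x)) -map_cons -(permPr tsP) /= {1}cxy.
by rewrite perm_sym -map_cons; exact: perm_map.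
Qed.

(** A cell of the grid of mesh [1 / m.+1] is named by the integer coordinates of
its lower corner. *)
Definition cell (m : nat) (x : 'rV[R]_d) : 'rV[int]_d :=
  \row_j Num.floor (x 0 j * m.+1%:R).

Lemma measurable_cell m c : measurable (cell m @^-1` [set c]).
Proof.
rewrite (_ : _ @^-1` _ = \bigcap_(j in [set: 'I_d])
    ((fun x : 'rV[R]_d => x 0 j * m.+1%:R) @^-1`
      `[(c 0 j)%:~R, (c 0 j + 1)%:~R[%classic)).
  apply: fin_bigcap_measurable => // j _; rewrite -[X in measurable X]setTI.
  have mj : measurable_fun setT (fun x : 'rV[R]_d => x 0 j * m.+1%:R).
    by apply: measurable_funM => //; exact: measurable_mx_coord.
  by apply: mj => //; exact: measurable_itv.
apply/seteqP; split=> [x <- j _|x xc /=].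
  by rewrite /= mxE in_itv/= floor_itv ?num_real.
apply/rowP => j; rewrite mxE; apply: floor_def.
by have := xc j Logic.I; rewrite /= in_itv.
Qed.

Lemma cell_dist m x y : cell m x = cell m y -> `|x - y| <= m.+1%:R^-1.
Proof.
move=> /rowP xy; rewrite [leLHS]mx_normrE; apply/bigmax_leP; split => // -[i j] _ /=.
rewrite ord1 !mxE; have := xy j; rewrite !mxE => xyj.
have := floor_itv (x 0 j * m.+1%:R).
have := floor_itv (y 0 j * m.+1%:R).
rewrite xyj intrD => /andP[y1 y2] /andP[x1 x2].
rewrite -[leRHS]mul1r ler_pdivlMr// -[X in _ * X]ger0_norm// -normrM mulrBl.
by rewrite ler_norml; apply/andP; split; lra.
Qed.

Definition gball (N : nat) : set 'rV[R]_d := [set x | `|x| <= N%:R].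

(** A pattern is made of a mesh, a radius and a list of cells with
multiplicities, hence there are countably many of them. *)
Definition cell_pattern (p : nat * nat * seq 'rV[int]_d) : set (mconfig S) :=
  [set eta : mconfig S | forall c,
    (eta (cell p.1.1 @^-1` [set c] `&` gball p.1.2) =
     (count_mem c p.2)%:R%:E)%E].

Lemma gball_bounded N : bounded_set (gball N).
Proof. by exists N%:R; split=> // M NM x /= xN; exact: le_trans xN (ltW NM). Qed.

Lemma measurable_gball N : measurable (gball N).
Proof.
rewrite (_ : gball N = (fun x : 'rV[R]_d => `|x|) @^-1` `]-oo, N%:R]%classic).
  rewrite -[X in measurable X]setTI.
  by apply: measurable_norm_row => //; exact: measurable_itv.
by apply/seteqP; split=> x /=; rewrite in_itv.
Qed.

(** A vague neighbourhood of [xi] constrains finitely many sums over the particles of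
a bounded set, so it contains all configurations with the same pattern as [xi] on
a fine enough grid. *)
Lemma vague_open_pattern (O : set (config S)) (xi : config S) :
  vague_open O -> O xi ->
  exists p, cell_pattern p xi /\ cell_pattern p `<=` O.
Proof.
move=> oO /oO[n [phi [e [phiC e0 xiO]]]].
have [N phiN] : exists N : nat, forall i y, S y -> ~ gball N y -> phi i y = 0.
  have /choice[M MP] i : exists M : nat, forall y, S y -> ~ gball M y -> phi i y = 0.
    have [_ [K [cK KS K0]]] := phiC i.
    have [M KM] := bounded_setP_le (compact_bounded cK).
    by exists M => y Sy yM; apply: K0 => // Ky; apply: yM; exact: KM.
  exists (\max_i M i)%N => i y Sy yN; apply: (MP i) => // yM; apply: yN.
  by rewrite /gball /= (le_trans yM)// ler_nat; exact: leq_bigmax.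
have [s [sN xiN]] := config_labels cS xi (gball_bounded N).
pose e' := e / (size s).+1%:R.
have e'0 : 0 < e' by rewrite divr_gt0.
have [m mP] : exists m, forall i x y, x \in s -> S y ->
    cell m y = cell m x -> `|phi i y - phi i x| <= e'.
  have H : \forall m \near \oo, forall x, x \in s -> forall i y, S y ->
      cell m y = cell m x -> `|phi i y - phi i x| <= e'.
    elim: s sN {xiN e' e'0} (e') e'0 => [|x s IH] sN e' e'0; first exact: nearW.
    have {}IH := IH (fun y ys => sN y (@mem_behead _ (x :: s) y ys)) e' e'0.
    have : \forall m \near \oo, forall i y, S y ->
        cell m y = cell m x -> `|phi i y - phi i x| <= e'.
      apply: filter_forall => i.
      have [phic _] := phiC i.
      have [_ Sx] := sN x (mem_head _ _).
      have /subspace_continuousP/(_ x Sx)/cvgrPdist_le/(_ e' e'0) := phic.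
      rewrite near_withinE => /nbhs_ballP[r /= r0 rP].
      have := near_infty_natSinv_lt (PosNum r0); apply: filterS => m mr y Sy yx.
      rewrite distrC; apply: rP => //.
      rewrite mx_norm_ball /ball_ /= distrC.
      by rewrite (le_lt_trans (cell_dist yx)).
    apply: filterS2 IH => m IH xP z; rewrite inE => /orP[/eqP ->|/IH//].
    exact: xP.
  have [m _ mP] := H; exists m => i x y xs; exact: (mP m (leqnn m) x xs i y).
exists (m, N, map (cell m) s); split=> [c|eta etaP].
  rewrite setIC xiN /= count_map.
  under eq_bigr do rewrite diracE.
  rewrite sumEFin; congr EFin; rewrite -sum1_count natr_sum [RHS]big_mkcond.
  apply: eq_bigr => y _ /=; rewrite (_ : (y \in _) = (cell m y == c)); last first.
    by apply/idP/eqP => [/set_mem//|?]; exact/mem_set.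
  by case: eqP.
apply: xiO => i.
have [t [tN etaN]] := config_labels cS eta (gball_bounded N).
rewrite (psum_labels sN xiN (phiN i)) (psum_labels tN etaN (phiN i)).
rewrite -EFinB abse_EFin lte_fin.
have ts : perm_eq (map (cell m) t) (map (cell m) s).
  apply/allP => c _ /=; apply/eqP.
  have := etaP c; rewrite setIC etaN /=.
  under eq_bigr do rewrite diracE.
  rewrite sumEFin => -[] /eqP; rewrite -natr_sum eqr_nat => /eqP <-.
  rewrite count_map -sum1_count [LHS]big_mkcond.
  apply: eq_bigr => y _ /=; rewrite (_ : (y \in _) = (cell m y == c)); last first.
    by apply/idP/eqP => [/set_mem//|?]; exact/mem_set.
  by case: eqP.
apply: le_lt_trans (perm_map_dist (e := e') ts _) _.
  by move=> x y xs /tN[_ Sy]; exact: mP.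
rewrite /e' mulrCA gtr_pMr// ltr_pdivrMr// mul1r ltr_nat//.
Qed.

(** A vaguely open set is the union of the cell patterns that it contains, which
are countably many and only constrain counts. *)
Lemma measurable_to_config dX (X : measurableType dX) (D : set X)
    (f : X -> mconfig S) : measurable D ->
  (forall A : set 'rV[R]_d, measurable A ->
    measurable_fun D (fun x => cmeas (f x) A)) ->
  measurable_fun D f.
Proof.
move=> mD mf; apply: (@measurability _ _ X (mconfig S) D f (@vague_open R d S)) => //.
move=> _ [V oV <-].
pose B p : set (mconfig S) := if `[< cell_pattern p `<=` V >] then cell_pattern p else set0.
have -> : V = \bigcup_p B p.
  apply/seteqP; split=> [xi Vxi|xi [p _]]; last first.
    by rewrite /B; case: asboolP => // + px; apply.
  have [p [pxi pV]] := vague_open_pattern oV Vxi.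
  by exists p => //; rewrite /B; case: asboolP.
rewrite preimage_bigcup setI_bigcupr.
apply: countable_bigcupT_measurable => [|p]; first exact: countableP.
rewrite /B; case: asboolP => _; last by rewrite preimage_set0 setI0.
pose h c := D `&` ((fun x => cmeas (f x) (cell p.1.1 @^-1` [set c] `&` gball p.1.2)) @^-1`
       (~` [set ((count_mem c p.2)%:R%:E)%E])).
rewrite (_ : D `&` _ = D `\` \bigcup_c h c).
  apply: measurableD => //.
  apply: countable_bigcupT_measurable => [|c]; first exact: countableP.
  apply: mf => //; last by apply: measurableC; exact: emeasurable_set1.
  by apply: measurableI; [exact: measurable_cell|exact: measurable_gball].
apply/seteqP; split=> x [Dx px]; split=> //.
  by move=> [c _ [_]]; apply; exact: px.
by move=> c; apply: contrapT => nc; apply: px; exists c.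
Qed.

Section kernel_of_particles.
Context dX (X : measurableType dX) (f : X -> mconfig S).
Hypothesis mf : measurable_fun setT f.

Let kf (x : X) : {measure set 'rV[R]_d -> \bar R} := pts (f x).

Let measurable_kf (U : set 'rV[R]_d) : measurable U -> measurable_fun setT (kf ^~ U).
Proof. by move=> mU; exact: (measurableT_comp (measurable_count mU)). Qed.

HB.instance Definition _ := isKernel.Build _ _ _ _ _ kf measurable_kf.

(** A configuration is only locally finite, so it is summed over the bounded
levels of the norm, where it is a finite kernel. *)
Lemma measurable_fun_xsection_pts (A : set (X * 'rV[R]_d)) : measurable A ->
  measurable_fun setT (fun x => pts (f x) (xsection A x)).
Proof.
move=> mA; have mL n : measurable (level @^-1` [set n]) by exact: measurable_level.
rewrite (_ : (fun _ => _) = (fun x =>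
    \sum_(n <oo) mrestr (kf x) (mL n) (xsection A x))%E).
  apply: ge0_emeasurable_sum; first by move=> n x _ _; exact: measure_ge0.
  move=> n _; apply: (measurable_prod_subset_xsection_kernel (k := kf) _ mA).2 => x.
  have [N xN] : exists N : nat, (f x (level @^-1` [set n]) = N%:R%:E)%E.
    apply: config_natP => //.
    exists n.+1%:R; split=> // M nM y /= yn.
    by rewrite (le_trans (ltW (truncnS_gt _)))// -/(level y) yn ltW.
  exists N.+1%:R => B mB; rewrite (le_lt_trans (y := N%:R%:E))// ?lte_fin ?ltr_nat//.
  by rewrite -xN; apply: config_le => y [[]].
apply/funext => x; rewrite -[xsection A x in LHS]setIT.
rewrite (_ : setT = \bigcup_n level @^-1` [set n]); last first.
  by apply/seteqP; split=> // y _; exists (level y).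
rewrite setI_bigcupr measure_bigcup//.
- by apply: eq_eseriesl => n; rewrite in_setT.
- by move=> n _; apply: measurableI => //; exact: measurable_xsection.
- by apply: trivIset_setIl => i j _ _ [y [<- <-]].
Qed.

Import HBNNSimple.

Lemma measurable_fun_integral_pts (F : X * 'rV[R]_d -> \bar R) :
  (forall z, 0 <= F z)%E -> measurable_fun setT F ->
  measurable_fun setT (fun x => \int[pts (f x)]_y F (x, y))%E.
Proof.
move=> F0 mF; pose k_ := nnsfun_approx measurableT mF.
apply: (@measurable_fun_xsection_integral _ _ _ _ _ F kf k_).
- by move=> a b ab; exact/nd_nnsfun_approx.
- by move=> z; exact/cvg_nnsfun_approx.
- by move=> n r; exact: measurable_fun_xsection_pts.
Qed.

Lemma measurable_particle (g : X -> 'rV[R]_d) : measurable_fun setT g ->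
  measurable [set x | is_particle (f x) (g x)].
Proof.
move=> mg; pose A := [set z : X * 'rV[R]_d | z.2 = g z.1].
have mA : measurable A.
  apply: measurable_diag_row; first exact: measurable_snd.
  exact: (measurableT_comp mg).
rewrite (_ : [set x | _] = (fun x => pts (f x) (xsection A x)) @^-1` (~` [set 0%E])).
  rewrite -[X in measurable X]setTI; apply: measurable_fun_xsection_pts => //.
  by apply: measurableC; exact: emeasurable_set1.
have xA x : xsection A x = [set g x].
    by apply/seteqP; split=> y; rewrite /xsection /=; [move=> /set_mem|move=> yg; apply/mem_set].
apply/seteqP; split=> x; rewrite /= xA /is_particle; first by move=> /eqP.
by move=> xg; apply/eqP.
Qed.

End kernel_of_particles.

End vague_borel.

(** * Measurability of the operations on configurations *)

Section measurable_surgery.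
Context (R : realType) (d : nat) (S : set 'rV[R]_d).
Hypothesis cS : closed S.

Let mS : measurable S.
Proof. exact: closed_measurable_mx. Qed.

Lemma measurable_Uball r : measurable (Uball S r).
Proof.
rewrite (_ : Uball S r = S `&` (@enorm R d) @^-1` `]-oo, r%:R]%classic).
  apply: measurableI => //; rewrite -[X in measurable X]setTI.
  by apply: measurable_enorm => //; exact: measurable_itv.
by apply/seteqP; split=> x; rewrite /Uball /= in_itv.
Qed.

Lemma measurable_restr r : measurable_fun setT (@restr R d S r).
Proof.
apply: measurable_to_config => // A mA; under eq_fun do rewrite restrE.
by apply: measurable_count => //; apply: measurableI => //; exact: measurable_Uball.
Qed.

Lemma measurable_tpow n (A : set 'rV[R]_d) : measurable A -> measurable (tpow n A).
Proof.
move=> mA; rewrite (_ : tpow n A = \bigcap_(i in [set: 'I_n])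
    ((fun x : n.-tuple 'rV[R]_d => tnth x i) @^-1` A)).
  apply: fin_bigcap_measurable => // i _; rewrite -[X in measurable X]setTI.
  exact: measurable_tnth.
by apply/seteqP; split=> x xA; [move=> i _; exact: xA|move=> i; exact: (xA i Logic.I)].
Qed.

Context dX (X : measurableType dX).

Lemma measurable_dirac_fun (D : set X) (g : X -> 'rV[R]_d) (A : set 'rV[R]_d) :
  measurable A -> measurable_fun D g ->
  measurable_fun D (fun x => \d_(g x) A : \bar R).
Proof.
move=> mA mg; rewrite /dirac; apply/measurable_EFinP.
have m1 : measurable_fun setT (\1_A : 'rV[R]_d -> R) by exact: measurable_indic.
exact: (measurableT_comp m1 mg).
Qed.

Variables (f : X -> mconfig S) (mf : measurable_fun setT f).

Let mcount (A : set 'rV[R]_d) : measurable A ->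
  measurable_fun setT (fun x => cmeas (f x) A).
Proof. by move=> mA; apply: (measurableT_comp (measurable_count cS mA)). Qed.

Lemma measurable_addp (g : X -> 'rV[R]_d) (D : set X) : measurable D ->
  measurable_fun setT g -> (forall x, D x -> S (g x)) ->
  measurable_fun D (fun x => addp (f x) (g x)).
Proof.
move=> mD mg gS; apply: measurable_to_config => // A mA.
apply: (eq_measurable_fun (fun x => cmeas (f x) A + \d_(g x) A)%E).
  by move=> x /set_mem Dx; rewrite addpE//; exact: gS.
apply: emeasurable_funD; first by apply: measurable_funTS; exact: mcount.
by apply: measurable_dirac_fun => //; exact: measurable_funTS.
Qed.

Lemma measurable_jump (g h : X -> 'rV[R]_d) (D : set X) : measurable D ->
  measurable_fun setT g -> measurable_fun setT h ->
  (forall x, D x -> is_particle (f x) (g x) /\ S (h x)) ->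
  measurable_fun D (fun x => jump (f x) (g x) (h x)).
Proof.
move=> mD mg mh gS; apply: measurable_to_config => // A mA.
apply: (eq_measurable_fun (fun x => cmeas (f x) A - \d_(g x) A + \d_(h x) A)%E).
  by move=> x /set_mem Dx; rewrite jumpE//; have [] := gS x Dx.
apply: emeasurable_funD.
  apply: emeasurable_funB; first by apply: measurable_funTS; exact: mcount.
  by apply: measurable_dirac_fun => //; exact: measurable_funTS.
by apply: measurable_dirac_fun => //; exact: measurable_funTS.
Qed.

Lemma measurable_mass (g : X -> 'rV[R]_d) : measurable_fun setT g ->
  measurable_fun setT (fun x => cmeas (f x) [set g x]).
Proof.
move=> mg; pose A := [set z : X * 'rV[R]_d | z.2 = g z.1].
have mA : measurable A.
  apply: measurable_diag_row; first exact: measurable_snd.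
  exact: (measurableT_comp mg).
rewrite (_ : (fun x => _) = (fun x => pts (f x) (xsection A x))).
  exact: measurable_fun_xsection_pts.
apply/funext => x; rewrite /pts; congr (cmeas _ _).
by apply/seteqP; split=> y; rewrite /xsection /=; [move=> yg; apply/mem_set|move=> /set_mem].
Qed.

Lemma measurable_dirac_set1 (g h : X -> 'rV[R]_d) :
  measurable_fun setT g -> measurable_fun setT h ->
  measurable_fun setT (fun x => \d_(g x) [set h x] : \bar R).
Proof.
move=> mg mh; rewrite /dirac; apply/measurable_EFinP.
rewrite (_ : (fun x => _) = \1_[set x | g x = h x]).
  by apply: measurable_indic; exact: measurable_diag_row.
apply/funext => x; rewrite !indicE; congr (_ %:R)%R; congr nat_of_bool.
Qed.

Variables (n : nat) (t : X -> n.-tuple 'rV[R]_d) (mt : measurable_fun setT t).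

Let mti i : measurable_fun setT (fun x => tnth (t x) i).
Proof. exact: (measurableT_comp (@measurable_tnth _ _ _ i)). Qed.

Lemma measurable_sub_particles : measurable [set x | sub_particles (f x) (t x)].
Proof.
rewrite (_ : [set x | _] = \bigcap_(i in [set: 'I_n])
    [set x | (\sum_(j < n) \d_(tnth (t x) j) [set tnth (t x) i] <=
              cmeas (f x) [set tnth (t x) i])%E]).
  apply: fin_bigcap_measurable => // i _.
  rewrite -[X in measurable X]setTI; apply: measurable_lee => //.
    by apply: emeasurable_sum => j; exact: measurable_dirac_set1.
  exact: measurable_mass.
apply/seteqP; split=> x /= h.
  move=> i _ /=; rewrite -(big_tuple _ _ _ xpredT (fun y => \d_y [set tnth (t x) i])).
  by apply: h; exact: mem_tnth.
move=> y /tnthP[i ->]; rewrite big_tuple; exact: (h i Logic.I).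
Qed.

Lemma measurable_remove : measurable_fun setT (fun x => remove (t x) (f x)).
Proof.
have mG := measurable_sub_particles.
rewrite -(setUv [set x | sub_particles (f x) (t x)]).
apply/measurable_funU => //; first exact: measurableC.
split.
  apply: measurable_to_config => // A mA.
  apply: (eq_measurable_fun
    (fun x => cmeas (f x) A - \sum_(j < n) \d_(tnth (t x) j) A)%E).
    by move=> x /set_mem xG; rewrite remove_sub// big_tuple.
  apply: emeasurable_funB; first by apply: measurable_funTS; exact: mcount.
  apply: emeasurable_sum => j; apply: measurable_dirac_fun => //.
  by apply: measurable_funTS; exact: mti.
apply: (eq_measurable_fun (fun=> point)); last exact: measurable_cst.
by move=> x /set_mem xG; rewrite remove_nsub.
Qed.

End measurable_surgery.

(** * Null sets of products *)

Section null_sections.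
Local Open Scope ereal_scope.
Context (R : realType).

Lemma ae_mono dX (X : measurableType dX) (m : {measure set X -> \bar R})
    (P Q : X -> Prop) : (forall x, P x -> Q x) ->
  {ae m, forall x, P x} -> {ae m, forall x, Q x}.
Proof. by move=> PQ; apply: filterS => // x; exact: PQ. Qed.

Lemma ae_and dX (X : measurableType dX) (m : {measure set X -> \bar R})
    (P Q : X -> Prop) :
  {ae m, forall x, P x} -> {ae m, forall x, Q x} -> {ae m, forall x, P x /\ Q x}.
Proof. by apply: filterS2 => x Px Qx; split. Qed.

Lemma ge0_integral_eq0P dX (X : measurableType dX) (m : {measure set X -> \bar R})
    (f : X -> \bar R) : measurable_fun setT f -> (forall x, 0 <= f x) ->
  \int[m]_x f x = 0 <-> {ae m, forall x, f x = 0}.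
Proof.
move=> mf f0.
have -> : \int[m]_x f x = \int[m]_x `|f x|.
  by apply: eq_integral => x _; rewrite gee0_abs.
rewrite ae_eq_integral_abs//; split; apply: filterS => x; first exact.
by move=> + _.
Qed.

Lemma ae_measurableP dX (X : measurableType dX) (m : {measure set X -> \bar R})
    (A : set X) : measurable A -> {ae m, forall x, ~ A x} <-> m A = 0.
Proof.
move=> mA; split=> [|A0]; last by exists A; split=> // x /contrapT.
move=> [N [mN N0 AN]]; apply/eqP; rewrite eq_le measure_ge0 andbT -N0.
by apply: (le_measure _ (mem_set mA) (mem_set mN)) => x Ax; apply: AN => /(_ Ax).
Qed.

Context d1 d2 (X : measurableType d1) (Y : measurableType d2).
Variables (m1 : {sigma_finite_measure set X -> \bar R})
  (m2 : {sigma_finite_measure set Y -> \bar R}).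

Lemma ae_xsection (A : set (X * Y)) : measurable A ->
  \int[m1]_x m2 (xsection A x) = 0 <-> {ae m1, forall x, m2 (xsection A x) = 0}.
Proof.
by move=> mA; apply: ge0_integral_eq0P => //; exact: measurable_fun_xsection.
Qed.

Lemma ae_ysection (A : set (X * Y)) : measurable A ->
  {ae m1, forall x, m2 (xsection A x) = 0} <->
  {ae m2, forall y, m1 (ysection A y) = 0}.
Proof.
move=> mA; rewrite -ae_xsection//.
have -> : \int[m1]_x m2 (xsection A x) = \int[m2]_y m1 (ysection A y).
  transitivity (\int[m1]_x (fubini_F m2 (EFin \o \1_A) x)).
    by rewrite indic_fubini_tonelli_FE.
  by rewrite indic_fubini_tonelli// indic_fubini_tonelli_GE.
by apply: ge0_integral_eq0P => //; exact: measurable_fun_ysection.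
Qed.

Lemma ae_prod (P : X * Y -> Prop) :
  (m1 \x m2).-negligible (~` [set z | P z]) ->
  {ae m1, forall x, {ae m2, forall y, P (x, y)}}.
Proof.
move=> [N [mN N0 PN]].
have /ae_xsection : \int[m1]_x m2 (xsection N x) = 0 by [].
move=> /(_ mN); apply: filterS => x Nx0.
exists (xsection N x); split=> //; first exact: measurable_xsection.
by move=> y nP; rewrite /xsection /=; apply/mem_set; exact: PN.
Qed.

End null_sections.

Section power_measure_null.
Local Open Scope ereal_scope.
Context dT (T : measurableType dT) (R : realType).
Variable m : {sigma_finite_measure set T -> \bar R}.

Let tc n (A : set (n.+1.-tuple T)) : set (T * n.-tuple T) := @tcons _ T n @^-1` A.

Let mtc n A : measurable A -> measurable (@tc n A).
Proof. by move=> mA; rewrite -[X in measurable X]setTI; exact: measurable_tcons. Qed.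

Lemma powmS n (A : set (n.+1.-tuple T)) :
  powm m n.+1 A = \int[m]_z powm m n (xsection (tc A) z).
Proof. by []. Qed.

Lemma ae_powmS n (A : set (n.+1.-tuple T)) : measurable A ->
  powm m n.+1 A = 0 <-> {ae m, forall z, powm m n (xsection (tc A) z) = 0}.
Proof. by move=> mA; rewrite powmS ae_xsection//; exact: mtc. Qed.

Lemma powm_coord n (i : 'I_n) (B : set T) : measurable B -> m B = 0 ->
  powm m n [set t | B (tnth t i)] = 0.
Proof.
move=> mB B0; elim: n i => [[]//|n IH] i.
have mi k (j : 'I_k) : measurable [set t : k.-tuple T | B (tnth t j)].
  by rewrite -[X in measurable X]setTI; exact: (measurable_tnth j).
apply/ae_powmS => //; case: (unliftP ord0 i) => [j ->|->].
  apply: aeW => z; rewrite (_ : xsection _ _ = [set t | B (tnth t j)]) ?IH//.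
  by apply/seteqP; split=> t; rewrite /xsection /=; [move=> /set_mem|move=> Bt; apply/mem_set];
    rewrite /tc/= tnthS.
have : {ae m, forall z, ~ B z} by apply/ae_measurableP.
apply: filterS => z nBz; rewrite (_ : xsection _ _ = set0) ?measure0//.
apply/seteqP; split=> t //; rewrite /xsection /= => /set_mem.
by rewrite /tc /= tnth0.
Qed.

Hypothesis m1 : forall x : T, measurable [set x].
Hypothesis m0 : forall x : T, m [set x] = 0.
Hypothesis mdiag : forall dX (X : measurableType dX) (f g : X -> T),
  measurable_fun setT f -> measurable_fun setT g -> measurable [set x | f x = g x].

Lemma measurable_uniq n : measurable [set t : n.-tuple T | uniq t].
Proof.
rewrite (_ : [set t | _] = \bigcap_(ij in [set: 'I_n * 'I_n])
    [set t : n.-tuple T | ij.1 != ij.2 -> tnth t ij.1 <> tnth t ij.2]).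
  apply: fin_bigcap_measurable => // -[i j] _ /=.
  have [->|ij] := eqVneq i j.
    by rewrite (_ : [set t | _] = setT)//; apply/seteqP; split=> t.
  rewrite (_ : [set t | _] = ~` [set t : n.-tuple T | tnth t i = tnth t j]).
    by apply: measurableC; apply: mdiag; exact: measurable_tnth.
  by apply/seteqP; split=> t /=; [exact|move=> ? _].
apply/seteqP; split=> t /=.
  by move=> /tuple_uniqP ti [i j] _ /= ij /ti; exact/eqP.
move=> h; apply/tuple_uniqP => i j tij; apply/eqP; apply: contrapT => /negP ij.
exact: (h (i, j) Logic.I ij).
Qed.

(** The first component of a tuple avoids the finitely many others. *)
Lemma powm_uniq n : {ae powm m n, forall t : n.-tuple T, uniq t}.
Proof.
suff : {ae powm m n, forall t : n.-tuple T, ~ [set t : n.-tuple T | ~ uniq t] t}.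
  by apply: filterS => t /contrapT.
have mU k : measurable [set t : k.-tuple T | ~ uniq t].
  by apply: measurableC; exact: measurable_uniq.
apply/(ae_measurableP _ (mU n)); elim: n => [|n IH].
  rewrite (_ : [set t | _] = set0) ?measure0//.
  by apply/seteqP; split=> // t /=; rewrite tuple0.
apply/(ae_powmS (mU _)); apply: aeW => z.
have mz : measurable (\bigcup_(i in [set: 'I_n]) [set t : n.-tuple T | tnth t i = z]).
  apply: fin_bigcup_measurable => // i _; apply: mdiag => //; exact: measurable_tnth.
apply/eqP; rewrite eq_le measure_ge0 andbT.
rewrite (_ : xsection _ _ = [set t : n.-tuple T | ~ uniq t] `|`
   \bigcup_(i in [set: 'I_n]) [set t : n.-tuple T | tnth t i = z]); last first.
  apply/seteqP; split=> t; rewrite /xsection /=.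
    move=> /set_mem; rewrite /tc /= => /negP; rewrite negb_and negbK => /orP[|/negP]; last by left.
    by move=> /tnthP[i ->]; right; exists i.
  move=> h; apply/mem_set; rewrite /tc /= => /andP[zt ut].
  case: h => [//|[i _ /= tz]]; move: zt; rewrite -tz mem_tnth//.
apply: (le_trans (measureU2 _ (mU n) mz)); rewrite [X in (X + _ <= _)%E]IH add0e.
rewrite le_eqVlt; apply/orP; left; apply/eqP/ae_measurableP => //.
have : {ae powm m n, forall t : n.-tuple T, forall i, tnth t i <> z}.
  apply: (@filter_forall _ _ (fun i => [set t : n.-tuple T | tnth t i <> z])) => i.
  apply/ae_measurableP; last exact: (powm_coord i (m1 z)).
  by apply: mdiag => //; exact: measurable_tnth.
by apply: filterS => t h [i _]; exact: h.
Qed.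

End power_measure_null.

Section lebesgue_tuples.
Local Open Scope ereal_scope.
Context (R : realType) (d : nat).
Local Notation T := 'rV[R]_d.
Local Notation leb := (lebd R d).

Lemma lebd_set1 (x : T) : (0 < d)%N -> leb [set x] = 0.
Proof.
move=> d0; have i0 : 'I_d := Ordinal d0.
have mtup : measurable (@row_tuple R d @^-1` [set x]).
  rewrite -[X in measurable X]setTI; apply: measurable_row_tuple => //.
  exact: measurable_set1_row.
rewrite -[LHS]/(powm (@lebesgue_measure R) d (@row_tuple R d @^-1` [set x])).
have m0 : powm (@lebesgue_measure R) d [set t | [set x ord0 i0] (tnth t i0)] = 0.
  by apply: powm_coord => //; exact: lebesgue_measure_set1.
apply/eqP; rewrite eq_le measure_ge0 andbT -m0; apply: le_measure; rewrite ?inE//.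
  rewrite -[X in measurable X]setTI.
  by apply: (measurable_tnth i0) => //; exact: measurable_set1.
by move=> t <- /=; rewrite mxE.
Qed.

Lemma lebdn_uniq n : (0 < d)%N -> {ae lebdn R d n, forall t : n.-tuple T, uniq t}.
Proof.
move=> d0; apply: powm_uniq.
- by move=> x; exact: measurable_set1_row.
- by move=> x; exact: lebd_set1.
- by move=> *; exact: measurable_diag_row.
Qed.

Lemma measurable_uniq_row n : measurable [set t : n.-tuple T | uniq t].
Proof. by apply: measurable_uniq => *; exact: measurable_diag_row. Qed.

Lemma measurable_set_tnth n (j : 'I_n) :
  measurable_fun setT (fun z : n.-tuple T * T => set_tnth z.1 j z.2).
Proof.
apply/measurable_fun_tnthP => i; have [->|ij] := eqVneq i j.
  rewrite (_ : _ \o _ = snd); first exact: measurable_snd.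
  by apply/funext => z; rewrite /= tnth_mktuple eqxx.
rewrite (_ : _ \o _ = (fun z => tnth z.1 i)).
  exact: (measurableT_comp (measurable_tnth i) measurable_fst).
by apply/funext => z; rewrite /= tnth_mktuple (negbTE ij).
Qed.

Lemma measurable_tuple_move dY (Y : measurableType dY) n (j : 'I_n) :
  measurable_fun setT (fun v : (n.-tuple T * Y) * T => (set_tnth v.1.1 j v.2, v.1.2)).
Proof.
apply: measurable_fun_pair; last exact: (measurableT_comp measurable_snd measurable_fst).
apply: (measurableT_comp (@measurable_set_tnth n j)
  (g := fun v : (n.-tuple T * Y) * T => (v.1.1, v.2))).
apply: measurable_fun_pair; last exact: measurable_snd.
exact: (measurableT_comp measurable_fst measurable_fst).
Qed.

Lemma set_tnth0 n (z y : T) (t : n.-tuple T) :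
  set_tnth (tcons (z, t)) ord0 y = tcons (y, t).
Proof.
apply: eq_from_tnth => i; rewrite tnth_mktuple.
by case: (unliftP ord0 i) => [i' ->|->]; rewrite ?tnthS ?tnth0 ?eqxx.
Qed.

Lemma set_tnthS n (j : 'I_n) (z y : T) (t : n.-tuple T) :
  set_tnth (tcons (z, t)) (lift ord0 j) y = tcons (z, set_tnth t j y).
Proof.
apply: eq_from_tnth => i; rewrite tnth_mktuple.
case: (unliftP ord0 i) => [i' ->|->]; last by rewrite !tnth0.
by rewrite !tnthS tnth_mktuple (inj_eq (@lift_inj _ ord0)).
Qed.

Definition resampled n (j : 'I_n) (B : set (n.-tuple T)) (x : n.-tuple T) : set T :=
  [set y | B (set_tnth x j y)].

Lemma measurable_fun_resampled n (j : 'I_n) B : measurable B ->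
  measurable_fun setT (fun x => leb (resampled j B x)).
Proof.
move=> mB; pose A := (fun z : n.-tuple T * T => set_tnth z.1 j z.2) @^-1` B.
have mA : measurable A.
  by rewrite -[X in measurable X]setTI; exact: measurable_set_tnth.
rewrite (_ : (fun x => _) = leb \o xsection A); first exact: measurable_fun_xsection.
apply/funext => x /=; congr (lebd R d _).
by apply/seteqP; split=> y; rewrite /xsection /=; [move=> ?; apply/mem_set|move=> /set_mem].
Qed.

(** By Fubini, for almost every choice of the other coordinates, the section of a
null set along the coordinate [j] is null. *)
Lemma lebdn_resampled n (j : 'I_n) B : measurable B -> lebdn R d n B = 0 ->
  {ae lebdn R d n, forall x, leb (resampled j B x) = 0}.
Proof.
move=> mB; suff : lebdn R d n B = 0 -> lebdn R d n [set x | leb (resampled j B x) != 0] = 0.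
  move=> h /h B0.
  have mA : measurable [set x | leb (resampled j B x) != 0].
    rewrite -[X in measurable X]setTI; apply: emeasurable_neq => //.
    exact: measurable_fun_resampled.
  have := (ae_measurableP (lebdn R d n) mA).2 B0.
  by apply: filterS => x /negP; rewrite negbK => /eqP.
elim: n j B mB => [[]//|n IH] j B mB.
have mN k (i : 'I_k) C : measurable C -> measurable [set x | leb (resampled i C x) != 0].
  move=> mC; rewrite -[X in measurable X]setTI; apply: emeasurable_neq => //.
  exact: measurable_fun_resampled.
have mtc A : measurable A -> measurable (@tcons _ T n @^-1` A).
  by move=> mA; rewrite -[X in measurable X]setTI; exact: measurable_tcons.
move=> /(ae_powmS _ mB) B0; apply/(ae_powmS _ (mN _ _ _ mB)).
case: (unliftP ord0 j) => [j' ->|->].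
  apply: filterS B0 => z Bz0.
  rewrite (_ : xsection _ z =
      [set t | leb (resampled j' (xsection (@tcons _ T n @^-1` B) z) t) != 0]).
    by apply: IH => //; apply: measurable_xsection; exact: mtc.
  have E t : resampled (lift ord0 j') B (tcons (z, t)) =
      resampled j' (xsection (@tcons _ T n @^-1` B) z) t.
    apply/seteqP; split=> y; rewrite /resampled /xsection /= set_tnthS.
      by move=> ?; apply/mem_set.
    by move=> /set_mem.
  apply/seteqP; split=> t; rewrite {1}/xsection /=.
    by move=> /set_mem /=; rewrite E.
  by rewrite -E => ?; apply/mem_set.
apply: aeW => z.
have /(ae_ysection (lebd R d) (lebdn R d n) (mtc _ mB)) := B0.
rewrite (_ : xsection _ z =
    [set t | leb (ysection (@tcons _ T n @^-1` B) t) != 0]); last first.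
  have E t : resampled ord0 B (tcons (z, t)) = ysection (@tcons _ T n @^-1` B) t.
    apply/seteqP; split=> y; rewrite /resampled /ysection /= set_tnth0.
      by move=> ?; apply/mem_set.
    by move=> /set_mem.
  apply/seteqP; split=> t; rewrite {1}/xsection /=.
    by move=> /set_mem /=; rewrite E.
  by rewrite -E => ?; apply/mem_set.
move=> h; apply/ae_measurableP.
  rewrite -[X in measurable X]setTI; apply: emeasurable_neq => //.
  by apply: measurable_fun_ysection; exact: mtc.
by apply: filterS h => t /= ->; rewrite eqxx.
Qed.

End lebesgue_tuples.

(** * Measures on tuples of particles *)

Section semidirect_measure.
Local Open Scope ereal_scope.
Context d1 d2 (X : measurableType d1) (Y : measurableType d2) (R : realType).
Variables (m : {measure set X -> \bar R}) (k : X -> {measure set Y -> \bar R}).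

Definition measurable_sections := forall E : set (X * Y), measurable E ->
  measurable_fun setT (fun x => k x (xsection E x)).

Hypothesis mk : measurable_sections.

(** The proof of measurability is an argument, so that the structure of a measure
can be attached to the constant. *)
Definition semidirect of measurable_sections : set (X * Y) -> \bar R :=
  fun E => \int[m]_x k x (xsection E x).

Let sd := semidirect mk.

Let sd0 : sd set0 = 0.
Proof.
by rewrite /sd /semidirect integral0_eq// => x _; rewrite xsection0 measure0.
Qed.

Let sd_ge0 E : 0 <= sd E.
Proof. by apply: integral_ge0 => x _; exact: measure_ge0. Qed.

Let sd_sigma_additive : semi_sigma_additive sd.
Proof.
move=> F mF tF mUF.
rewrite [X in _ --> X](_ : _ = \sum_(n <oo) sd (F n)).
  by apply/cvg_closeP; split; [exact: is_cvg_nneseries|rewrite closeE].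
rewrite -integral_nneseries//; last by move=> n; exact: mk.
apply: eq_integral => x _; apply/esym/cvg_lim => //=; rewrite xsection_bigcup.
apply: (measure_sigma_additive _ (trivIset_xsection tF)) => ?.
exact: measurable_xsection.
Qed.

HB.instance Definition _ := isMeasure.Build _ _ _ (semidirect mk)
  sd0 sd_ge0 sd_sigma_additive.

Lemma semidirect_eq0 E : measurable E ->
  semidirect mk E = 0 <-> {ae m, forall x, k x (xsection E x) = 0}.
Proof. by move=> mE; apply: ge0_integral_eq0P => //; exact: mk. Qed.

End semidirect_measure.

Section measure_eq_cover.
Local Open Scope ereal_scope.
Context dX (X : measurableType dX) (R : realType).
Variables m1 m2 : {measure set X -> \bar R}.

(** Both measures are split along the disjoint pieces of the cover. *)
Lemma measure_eq_cover (D : (set X)^nat) (mD : forall k, measurable (D k)) :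
  (forall k E, measurable E -> m1 (E `&` D k) = m2 (E `&` D k)) ->
  m1 (~` \bigcup_k D k) = 0 -> m2 (~` \bigcup_k D k) = 0 ->
  forall E, measurable E -> m1 E = m2 E.
Proof.
move=> m12 m10 m20 E mE.
have mU : measurable (\bigcup_k D k) by exact: bigcupT_measurable.
have mB k : measurable (\big[setU/set0]_(j < k) D j) by exact: bigsetU_measurable.
have mS k : measurable (seqDU D k) by exact: measurableD.
have split_ (m : {measure set X -> \bar R}) : m (~` \bigcup_k D k) = 0 ->
    m E = \sum_(k <oo) m (E `&` seqDU D k).
  move=> m0; rewrite -[E in LHS](setUIDK E (\bigcup_k D k)) measureU//; last 3 first.
  - exact: measurableI.
  - exact: measurableD.
  - by apply/seteqP; split=> // x [[_ ?] [_]].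
  rewrite [X in _ + X](_ : _ = 0) ?adde0; last first.
    apply/eqP; rewrite eq_le measure_ge0 andbT -m0.
    by apply: (le_measure _ (mem_set (measurableD mE mU)) (mem_set (measurableC mU))) => x [].
  rewrite (seqDU_bigcup_eq D) setI_bigcupr.
  have mES k : measurable (E `&` seqDU D k) by exact: measurableI.
  have tES : trivIset setT (fun k => E `&` seqDU D k).
    by apply: trivIset_setIl; exact: trivIset_seqDU.
  by apply: measure_semi_bigcup => //; exact: bigcupT_measurable.
rewrite (split_ m1)// (split_ m2)//; apply: eq_eseriesr => k _.
rewrite /seqDU setDE (setIC (D k)) setIA m12//.
by apply: measurableI => //; exact: measurableC.
Qed.

End measure_eq_cover.

Section factorial_campbell.
Local Open Scope ereal_scope.
Context (R : realType) (d : nat) (S : set 'rV[R]_d).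
Hypothesis cS : closed S.
Local Notation T := 'rV[R]_d.
Local Notation M := (mconfig S).

Let mS : measurable S.
Proof. exact: closed_measurable_mx. Qed.

Lemma bounded_sub (A B : set T) : A `<=` B -> bounded_set B -> bounded_set A.
Proof.
by move=> AB [m [mr mB]]; exists m; split=> // k mk x /AB Bx; exact: (mB k mk x Bx).
Qed.

Lemma count_inE (xi : M) (A : set T) : bounded_set A ->
  xi A = (count_in xi A)%:R%:E.
Proof. by move=> /(config_natP cS xi)[n]; rewrite /count_in => -> /=; rewrite natrK. Qed.

Lemma measurable_count_in (A : set T) (c : nat) : measurable A -> bounded_set A ->
  measurable [set xi : M | count_in xi A = c].
Proof.
move=> mA bA; rewrite (_ : [set xi | _] = (fun xi : M => xi A) @^-1` [set c%:R%:E]).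
  rewrite -[X in measurable X]setTI; apply: (measurable_count cS mA) => //.
apply/seteqP; split=> xi /=; rewrite (count_inE _ bA); first by move=> ->.
by move=> [] /eqP; rewrite eqr_nat => /eqP.
Qed.

Lemma measurable_count_inP (A : set T) (B : set nat) : measurable A -> bounded_set A ->
  measurable [set xi : M | B (count_in xi A)].
Proof.
move=> mA bA; rewrite (_ : [set xi | _] = \bigcup_(c in B) [set xi : M | count_in xi A = c]).
  by apply: bigcup_measurable => c _; exact: measurable_count_in.
by apply/seteqP; split=> [xi Bc|xi [c Bc /= ->]]//; exists (count_in xi A).
Qed.

Lemma measurable_count_comp (A : set T) (g : nat -> \bar R) : measurable A ->
  bounded_set A -> measurable_fun setT (fun xi : M => g (count_in xi A)).
Proof.
by move=> mA bA _ B mB; rewrite setTI; exact: (measurable_count_inP (g @^-1` B) mA bA).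
Qed.

Definition pbox n (A : 'I_n -> set T) : set (n.-tuple T) :=
  [set x | forall i, A i (tnth x i)].

Lemma measurable_pbox n (A : 'I_n -> set T) : (forall i, measurable (A i)) ->
  measurable (pbox A).
Proof.
move=> mA; rewrite (_ : pbox A = \bigcap_(i in [set: 'I_n])
    ((fun x : n.-tuple T => tnth x i) @^-1` A i)).
  apply: fin_bigcap_measurable => // i _; rewrite -[X in measurable X]setTI.
  exact: measurable_tnth.
by apply/seteqP; split=> x xA; [move=> i _; exact: xA|move=> i; exact: (xA i Logic.I)].
Qed.

Definition disjoint_family n (A : 'I_n -> set T) : Prop :=
  (forall i, [/\ measurable (A i), bounded_set (A i) & A i `<=` S]) /\
  forall i j, i != j -> A i `&` A j = set0.

Definition counts n (A : 'I_n -> set T) (xi : M) : nat :=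
  (\prod_(i < n) count_in xi (A i))%N.

Lemma measurable_counts n (A : 'I_n -> set T) : disjoint_family A ->
  measurable_fun setT (fun xi : M => (counts A xi)%:R%:E : \bar R).
Proof.
move=> [bA _]; apply/measurable_EFinP.
rewrite (_ : (fun xi => _) = (fun xi : M => \prod_(i <- index_enum 'I_n) fine (xi (A i)))%R).
  apply: measurable_prod => i _; have [mA bAi _] := bA i.
  exact: (measurableT_comp (fine_measurable measurableT) (measurable_count cS mA)).
apply/funext => xi; rewrite /counts natr_prod; apply: eq_bigr => i _.
by have [_ bAi _] := bA i; rewrite (count_inE _ bAi).
Qed.

Lemma pbox_generates n : @measurable _ (n.-tuple T * M)%type =
  <<s [set E | exists (A : 'I_n -> set T) (N : set M),
         [/\ forall i, measurable (A i), measurable N & E = pbox A `*` N]] >>.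
Proof.
set G := [set E | _]; apply/seteqP; split; last first.
  apply: smallest_sub; first exact: sigma_algebra_measurable.
  by move=> _ [A [N [mA mN ->]]]; apply: measurableX => //; exact: measurable_pbox.
move=> E mE; pose Z := g_sigma_algebraType G.
have m1 : measurable_fun [set: Z] (fun z : Z => z.1 : n.-tuple T).
  apply/measurable_fun_tnthP => i _ A mA; rewrite setTI; apply: sub_sigma_algebra.
  exists (fun j => if j == i then A else setT), setT; split=> //.
    by move=> j; case: ifP.
  apply/seteqP; split=> z /=.
    by move=> Az; split=> // j; case: eqP => // ->.
  by move=> [/(_ i)]; rewrite eqxx.
have m2 : measurable_fun [set: Z] (fun z : Z => z.2 : M).
  move=> _ N mN; rewrite setTI; apply: sub_sigma_algebra.
  by exists (fun=> setT), N; split=> //; apply/seteqP; split=> z /= => [|[]].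
have := measurable_fun_pair m1 m2.
move=> /(_ measurableT _ mE); rewrite setTI.
by rewrite (_ : _ @^-1` E = E)//; apply/seteqP; split=> -[].
Qed.

Variable mu : probability M R.

(** The law of [mu] together with the counting measure of the ordered choices of
[n] distinct particles: in a box with disjoint sides there are as many choices as
the product of the counts of the sides. *)
Definition factorial_campbell n
    (Q : {measure set (n.-tuple T * M) -> \bar R}) : Prop :=
  (forall (A : 'I_n -> set T) (N : set M), disjoint_family A -> measurable N ->
     Q (pbox A `*` N) = \int[mu]_(xi in N) (counts A xi)%:R%:E) /\
  {ae Q, forall z : n.-tuple T * M, uniq z.1 /\ tpow n S z.1}.

(** The balls are taken smaller than half the least distance between the points,
and rational so that the boxes they form are countably many. *)
Lemma separating_balls n (x : n.-tuple T) : uniq x ->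
  exists c : 'I_n -> 'rV[rat]_d * rat,
    (forall i, ball (map_mx ratr (c i).1 : T) (ratr (c i).2) (tnth x i)) /\
    forall i j, i != j ->
      ball (map_mx ratr (c i).1 : T) (ratr (c i).2) `&`
      ball (map_mx ratr (c j).1 : T) (ratr (c j).2) = set0.
Proof.
move=> /tuple_uniqP xI.
have [e e0 eP] : exists2 e : R, (0 < e)%R &
    forall i j, i != j -> (e <= `|tnth x i - tnth x j| / 2)%R.
  exists (\big[Num.min/1%R]_(ij : 'I_n * 'I_n | ij.1 != ij.2) (`|tnth x ij.1 - tnth x ij.2| / 2)%R).
    apply: lt_bigmin => // -[i j] /= ij; rewrite divr_gt0// normr_gt0 subr_eq0.
    by apply: contra ij => /eqP/xI ->.
  by move=> i j ij; apply: bigmin_le_cond (i, j) _ _ _.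
have /choice[c cP] i : exists c : 'rV[rat]_d * rat,
    ball (map_mx ratr c.1 : T) (ratr c.2) (tnth x i) /\
    ball (map_mx ratr c.1 : T) (ratr c.2) `<=` ball (tnth x i) e.
  have [Q [q [xQ Qx]]] := mx_ball_rat (ball_open (tnth x i) e) (ballxx (tnth x i) e0).
  by exists (Q, q).
exists c; split=> [i|i j ij]; first by have [] := cP i.
apply/seteqP; split=> // y [/(cP i).2 iy /(cP j).2 jy].
move: iy jy; rewrite mx_norm_ball /ball_ /= => iy jy.
have := eP i j ij; rewrite leNgt => /negP; apply.
rewrite ltr_pdivrMr// mulr_natr mulr2n.
rewrite -(subrKA y) (le_lt_trans (ler_normD _ _))// ltrD//.
by rewrite distrC.
Qed.

(** The boxes with disjoint sides are not closed under intersection, but the boxes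
contained in a given one of them are. Countably many such boxes, with the counts
bounded to make the measures finite, cover all tuples of distinct points. *)
Lemma factorial_campbell_unique n
    (Q1 Q2 : {measure set (n.-tuple T * M) -> \bar R}) :
  factorial_campbell Q1 -> factorial_campbell Q2 ->
  forall E, measurable E -> Q1 E = Q2 E.
Proof.
move=> [Q1E Q1u] [Q2E Q2u].
pose A (c : {ffun 'I_n -> 'rV[rat]_d * rat}) i : set T :=
  S `&` [set y | (`|y| <= `|map_mx ratr (c i).1 : T| + ratr (c i).2)%R] `&`
  ball (map_mx ratr (c i).1 : T) (ratr (c i).2).
pose N c m : set M := [set xi | (counts (A c) xi <= m)%N].
pose D (p : {ffun 'I_n -> 'rV[rat]_d * rat} * nat) : set (n.-tuple T * M) :=
  if `[< disjoint_family (A p.1) >] then pbox (A p.1) `*` N p.1 p.2 else set0.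
pose Dk k := oapp D set0 (choice.unpickle k).
have mN c m : disjoint_family (A c) -> measurable (N c m).
  move=> /measurable_counts mc.
  rewrite (_ : N c m = (fun xi => (counts (A c) xi)%:R%:E : \bar R) @^-1` `]-oo, m%:R%:E]%classic).
    by rewrite -[X in measurable X]setTI; apply: mc => //; exact: emeasurable_itv.
  by apply/seteqP; split=> xi; rewrite /N /= in_itv/= lee_fin ler_nat.
have mD p : measurable (D p).
  rewrite /D; case: asboolP => // dA; apply: measurableX; last exact: mN.
  by apply: measurable_pbox => i; have [] := dA.1 i.
have mDk k : measurable (Dk k).
  by rewrite /Dk; case: (choice.unpickle k) => [p|] /=; [exact: mD|exact: measurable0].
have cover (Q : {measure set (n.-tuple T * M) -> \bar R}) :
    {ae Q, forall z : n.-tuple T * M, uniq z.1 /\ tpow n S z.1} -> Q (~` \bigcup_k Dk k) = 0.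
  move=> Qu; apply/ae_measurableP.
    by apply: measurableC; exact: bigcupT_measurable.
  apply: filterS Qu => -[x xi] [/= ux xS]; apply; rewrite /setC /=.
  have [c [xc cd]] := separating_balls ux.
  pose c' := [ffun i => c i].
  have dA : disjoint_family (A c').
    split=> [i|i j ij]; last first.
      apply/seteqP; split=> // y [[_ yi] [_ yj]].
      by rewrite -(cd i j ij); move: yi yj; rewrite !ffunE.
    split.
    - apply: measurableI; last by apply: open_measurable_mx; exact: ball_open.
      apply: measurableI => //.
      rewrite (_ : [set y | _] = (fun y : T => `|y|%R) @^-1`
         `]-oo, (`|map_mx ratr (c' i).1 : T| + ratr (c' i).2)%R]%classic).
        rewrite -[X in measurable X]setTI.
        by apply: measurable_norm_row => //; exact: measurable_itv.
      by apply/seteqP; split=> y; rewrite /= in_itv.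
    - exists (`|map_mx ratr (c' i).1 : T| + ratr (c' i).2)%R.
      by split; [exact: num_real|move=> m cm y [[_ /= yc] _]; exact: le_trans yc (ltW cm)].
    - by move=> y [[]].
  exists (choice.pickle (c', counts (A c') xi)) => //.
  rewrite /Dk choice.pickleK /= /D /=; case: asboolP => // _; split; last by rewrite /N /=.
  move=> i; have := xc i; rewrite /A !ffunE => xci; split=> //; split; first exact: xS.
  move: xci; rewrite mx_norm_ball /ball_ /= => xci.
  by rewrite -lerBlDl (le_trans (lerB_dist _ _))// distrC ltW.
apply: (measure_eq_cover mDk); [|exact: cover|exact: cover] => k E mE.
rewrite /Dk; case: (choice.unpickle k) => [p|] /=; last by rewrite setI0 !measure0.
have [dA|ndA] := pselect (disjoint_family (A p.1)); last first.
  by rewrite /D; case: asboolP => // _; rewrite setI0 !measure0.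
have QD (Q : {measure set (n.-tuple T * M) -> \bar R}) (C : 'I_n -> set T) (L : set M) :
    (forall (A : 'I_n -> set T) (N : set M), disjoint_family A -> measurable N ->
     Q (pbox A `*` N) = \int[mu]_(xi in N) (counts A xi)%:R%:E) ->
    (forall i, measurable (C i)) -> measurable L ->
    Q ((pbox C `*` L) `&` D p) =
    \int[mu]_(xi in L `&` N p.1 p.2) (counts (fun i => C i `&` A p.1 i) xi)%:R%:E.
  move=> QE mC mL; rewrite -QE.
  - rewrite /D /=; case: asboolP => // _; congr (Q _).
    apply/seteqP; split=> -[x xi] /=.
      move=> [[xC xiL] [xA xiN]]; split; last by [].
      by move=> i; split; [exact: xC|exact: xA].
    move=> [xC [xiL xiN]]; split; split=> //.
      by move=> i; have [] := xC i.
    by move=> i; have [] := xC i.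
  - split=> [i|i j ij]; last first.
      apply/seteqP; split=> // y [[_ yi] [_ yj]].
      by rewrite -(dA.2 i j ij).
    have [mA bA AS] := dA.1 i; split; first exact: measurableI.
      by apply: (bounded_sub (B := A p.1 i)) => // y [].
    by move=> y [_ /AS].
  - by apply: measurableI => //; exact: mN.
set G := [set E | exists (A : 'I_n -> set T) (N : set M),
         [/\ forall i, measurable (A i), measurable N & E = pbox A `*` N]].
apply: (measure_unique G (fun=> setT) _ _ _ _
   (mrestr Q1 (mD p)) (mrestr Q2 (mD p))) => //.
- exact: pbox_generates.
- move=> _ _ [C [L [mC mL ->]]] [C' [L' [mC' mL' ->]]].
  exists (fun i => C i `&` C' i), (L `&` L'); split.
  + by move=> i; exact: measurableI.
  + exact: measurableI.
  + apply/seteqP; split=> -[x xi] /=.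
      move=> [[xC xiL] [xC' xiL']]; split; last by [].
      by move=> i; split; [exact: xC|exact: xC'].
    move=> [xC [xiL xiL']]; split; split=> //.
      by move=> i; have [] := xC i.
    by move=> i; have [] := xC i.
- move=> _; exists (fun=> setT), setT; split=> //.
  by apply/seteqP; split.
- by rewrite bigcup_const.
- move=> _ [C [L [mC mL ->]]].
  exact: etrans (QD Q1 C L Q1E mC mL) (esym (QD Q2 C L Q2E mC mL)).
- move=> _.
  have QDE : Q1 (setT `&` D p) = \int[mu]_(xi in N p.1 p.2) (counts (A p.1) xi)%:R%:E.
    have E1 : (fun i => setT `&` A p.1 i) = A p.1 by apply/funext => i; rewrite setTI.
    have := QD Q1 (fun=> setT) setT Q1E (fun=> measurableT) measurableT.
    rewrite E1 setTI => <-; congr (Q1 (_ `&` _)).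
    by apply/seteqP; split.
  change (Q1 (setT `&` D p) < +oo); rewrite QDE.
  apply: (@le_lt_trans _ _ (\int[mu]_(xi in N p.1 p.2) p.2%:R%:E)).
    apply: ge0_le_integral => //.
    + exact: mN.
    + by apply: measurable_funTS; exact: measurable_counts.
    + by move=> xi; rewrite lee_fin ler_nat.
  rewrite integral_cst; last exact: mN.
  rewrite lte_mul_pinfty// (le_lt_trans (probability_le1 _ _))// ?ltry//; exact: mN.
Qed.

End factorial_campbell.

Section extension.
Local Open Scope ereal_scope.
Context (R : realType) (d : nat) (S : set 'rV[R]_d).
Hypothesis cS : closed S.
Local Notation T := 'rV[R]_d.
Local Notation M := (mconfig S).

Lemma pts_eq0P (xi : M) (B : set T) :
  pts xi B = 0 <-> forall y, B y -> ~ is_particle xi y.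
Proof.
split=> [B0 y By xiy|nB].
  by have := particle_le cS B xiy; rewrite diracE mem_set// -[xi B]/(pts xi B) B0 lee_fin ler10.
have [L [x [_ xiE]]] := config_esum xi.
rewrite /pts xiE esum1// => j Lj; rewrite diracE memNset// => Bxj.
apply: (nB _ Bxj); rewrite /is_particle xiE gt_eqF//.
rewrite (lt_le_trans lte01)//; apply: esum_ge; exists [set j].
  by split=> // i ->.
by rewrite fsbig_set1 diracE mem_set.
Qed.

Section extend_measure.
Context (n : nat).
Local Notation Z := (n.-tuple T * M)%type.

Let fresh (z : Z) : set T := [set y | y \notin z.1].

Lemma measurable_fresh : measurable [set w : Z * T | w.2 \notin w.1.1].
Proof.
rewrite (_ : [set w | _] = \bigcap_(i in [set: 'I_n])
    ~` [set w : Z * T | tnth w.1.1 i = w.2]).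
  apply: fin_bigcap_measurable => // i _; apply: measurableC.
  apply: measurable_diag_row; last exact: measurable_snd.
  exact: (measurableT_comp (measurable_tnth i)
    (measurableT_comp measurable_fst measurable_fst)).
apply/seteqP; split=> -[[x xi] y] /=.
  by move=> yx i _ /= xy; move: yx; rewrite -xy mem_tnth.
by move=> h; apply/negP => /tnthP[i yx]; exact: (h i Logic.I).
Qed.

Let mfresh z : measurable (fresh z).
Proof.
rewrite (_ : fresh z = xsection [set w : Z * T | w.2 \notin w.1.1] z).
  by apply: measurable_xsection; exact: measurable_fresh.
by apply/seteqP; split=> y; rewrite /xsection /=; [move=> ?; apply/mem_set|move=> /set_mem].
Qed.

Let fresh_pts (z : Z) : {measure set T -> \bar R} := mrestr (pts z.2) (mfresh z).

Let mfresh_pts : measurable_sections fresh_pts.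
Proof.
move=> E mE; pose E' := E `&` [set w : Z * T | w.2 \notin w.1.1].
have mE' : measurable E' by apply: measurableI => //; exact: measurable_fresh.
rewrite (_ : (fun z => _) = (fun z : Z => pts z.2 (xsection E' z))).
  exact: (measurable_fun_xsection_pts cS measurable_snd mE').
apply/funext => z; rewrite /fresh_pts /mrestr; congr (pts z.2 _).
apply/seteqP; split=> y; rewrite /xsection /=.
  by move=> [/set_mem Ey zy]; apply/mem_set.
by move=> /set_mem [Ey zy]; split=> //; apply/mem_set.
Qed.

Let adjoin (w : Z * T) : n.+1.-tuple T * M := (tcons (w.2, w.1.1), w.1.2).

Let measurable_adjoin : measurable_fun setT adjoin.
Proof.
apply: measurable_fun_pair; last exact: (measurableT_comp measurable_snd measurable_fst).
apply: (measurableT_comp (@measurable_tcons _ T n)).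
apply: measurable_fun_pair; first exact: measurable_snd.
exact: (measurableT_comp measurable_fst measurable_fst).
Qed.

(** The law of the tuple preceded by each particle that it does not contain. *)
Definition extend (Q : {measure set Z -> \bar R}) :
    {measure set (n.+1.-tuple T * M) -> \bar R} :=
  measure_function_pushforward__canonical__measure_function_Measure
    (semidirect Q mfresh_pts) measurable_adjoin.

Definition extension (E : set (n.+1.-tuple T * M)) (z : Z) : set T :=
  [set y | y \notin z.1 /\ E (tcons (y, z.1), z.2)].

Lemma extendE Q E : extend Q E = \int[Q]_z pts z.2 (extension E z).
Proof.
rewrite -[LHS]/(\int[Q]_z pts z.2 (xsection (adjoin @^-1` E) z `&` fresh z)).
apply: eq_integral => z _; congr (pts z.2 _); apply/seteqP; split=> y.
  by rewrite /xsection /= => -[/set_mem Ey zy].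
by move=> [zy Ey]; split=> //; rewrite /xsection /=; apply/mem_set.
Qed.

Lemma measurable_fun_extension E : measurable E ->
  measurable_fun setT (fun z : Z => pts z.2 (extension E z)).
Proof.
move=> mE; pose E' := adjoin @^-1` E `&` [set w : Z * T | w.2 \notin w.1.1].
have mE' : measurable E'.
  apply: measurableI; last exact: measurable_fresh.
  by rewrite -[X in measurable X]setTI; exact: measurable_adjoin.
rewrite (_ : (fun z => _) = (fun z : Z => pts z.2 (xsection E' z))).
  exact: (measurable_fun_xsection_pts cS measurable_snd mE').
apply/funext => z; congr (pts z.2 _).
apply/seteqP; split=> y; rewrite /xsection /=.
  by move=> [zy Ey]; apply/mem_set.
by move=> /set_mem [Ey zy].
Qed.

Lemma extend_eq0 (Q : {measure set Z -> \bar R}) E : measurable E ->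
  extend Q E = 0 <->
  {ae Q, forall z, forall y, is_particle z.2 y -> y \notin z.1 ->
     ~ E (tcons (y, z.1), z.2)}.
Proof.
move=> mE; rewrite extendE.
have H := ge0_integral_eq0P Q (measurable_fun_extension mE)
  (fun z => measure_ge0 (pts z.2) (extension E z)).
split=> [/H|h].
  by apply: ae_mono => z /pts_eq0P h y xiy zy Ey; exact: (h y).
apply: H.2; apply: ae_mono h => z h; apply/pts_eq0P => y [zy Ey] xiy; exact: (h y).
Qed.

End extend_measure.

(** The layer-cake formula for an integer. *)
Lemma nneseries_lt (k a : nat) :
  \sum_(c <oo) (if (c < k)%N then a%:R%:E else 0) = (k * a)%:R%:E :> \bar R.
Proof.
apply/cvg_lim => //; apply: cvg_near_cst; exists k => // N /= kN.
rewrite (big_cat_nat _ kN)//= [X in _ + X]big_nat_cond [X in _ + X]big1 ?adde0.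
  rewrite big_nat (eq_bigr (fun=> a%:R%:E)) => [|i /andP[_ ->]//].
  by rewrite -big_nat sumEFin sumr_const_nat subn0 -mulrnA mulnC.
by move=> i /andP[/andP[ki _] _]; rewrite ltnNge ki.
Qed.

Variable mu : probability M R.

(** In a box with disjoint sides the new particle ranges over the first side and
is automatically fresh, so that it contributes the count of this side. This count
depends on the configuration: its layers are events, to which the identity for [Q]
applies. *)
Lemma factorial_campbell_extend n (Q : {measure set (n.-tuple T * M) -> \bar R}) :
  factorial_campbell mu Q -> factorial_campbell mu (extend Q).
Proof.
move=> [QE Qu]; split; last first.
  have mG : measurable [set z : n.+1.-tuple T * M | ~ (uniq z.1 /\ tpow n.+1 S z.1)].
    rewrite (_ : [set z | _] = ~` ((fst @^-1` [set t : n.+1.-tuple T | uniq t]) `&`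
      (fst @^-1` tpow n.+1 S)))//.
    apply: measurableC; apply: measurableI; rewrite -[X in measurable X]setTI;
      apply: measurable_fst => //; first exact: measurable_uniq_row.
    by apply: measurable_tpow => //; exact: closed_measurable_mx.
  have : extend Q [set z : n.+1.-tuple T * M | ~ (uniq z.1 /\ tpow n.+1 S z.1)] = 0.
    apply/extend_eq0 => //; apply: ae_mono Qu => -[x xi] [/= ux xS] y xiy yx; apply.
    split; first by rewrite yx.
    move=> i; case: (unliftP ord0 i) => [j ->|->]; first by rewrite tnthS; exact: xS.
    by rewrite tnth0; exact: particleS xiy.
  move=> /(ae_measurableP _ mG); apply: ae_mono => z /contrapT//.
move=> A N dA mN; rewrite extendE.
pose A0 := A ord0; pose A' i := A (lift ord0 i).
have [mA0 bA0 _] := dA.1 ord0.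
have dA' : disjoint_family S A'.
  by split=> [i|i j ij]; [exact: dA.1|apply: dA.2; rewrite (inj_eq (@lift_inj _ ord0))].
pose L c : set M := N `&` [set xi | (c < count_in xi A0)%N].
have mL c : measurable (L c).
  by apply: measurableI => //; exact: (measurable_count_inP cS (fun k => (c < k)%N)).
have mBL c : measurable (pbox A' `*` L c).
  by apply: measurableX => //; apply: measurable_pbox => i; have [] := dA'.1 i.
transitivity (\int[Q]_z \sum_(c <oo) (\1_(pbox A' `*` L c) z)%:E).
  apply: eq_integral => -[x xi] _.
  have [[xA xiN]|nD] := pselect (pbox A' x /\ N xi); last first.
    rewrite eseries0; last first.
      by move=> c _ _; rewrite indicE memNset//= => -[xA [xiN _]]; apply: nD.
    rewrite (_ : extension _ _ = set0) ?measure0//.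
    apply/seteqP; split=> // y [/= yx [/= xA xiN]]; apply: nD; split=> //.
    by move=> i; have := xA (lift ord0 i); rewrite tnthS.
  rewrite (_ : extension _ _ = A0); last first.
    apply/seteqP; split=> y /=.
      by move=> [yx [/(_ ord0)]]; rewrite tnth0.
    move=> A0y; split.
      apply/negP => /tnthP[i yx].
      have : (A0 `&` A (lift ord0 i)) y by split=> //; rewrite yx; exact: xA.
      by rewrite (dA.2 ord0 (lift ord0 i))// eq_sym neq_lift.
    split=> //= i; case: (unliftP ord0 i) => [j ->|->]; first by rewrite tnthS; exact: xA.
    by rewrite tnth0.
  rewrite /pts (count_inE cS _ bA0) -[in LHS](muln1 (count_in _ _)) -nneseries_lt.
  apply: eq_eseriesr => c _; rewrite indicE.
  have [lc|lc] := boolP (c < count_in xi A0)%N; first by rewrite mem_set.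
  by rewrite memNset//= => -[_ [_]]; exact/negP.
rewrite integral_nneseries//; last first.
  by move=> c; apply/measurable_EFinP; exact: measurable_indic.
transitivity (\sum_(c <oo) \int[mu]_xi
    ((\1_(L c) xi)%:E * (counts A' xi)%:R%:E)).
  apply: eq_eseriesr => c _; rewrite integral_indic// setIT QE//.
  rewrite integral_mkcond; apply: eq_integral => xi _.
  by rewrite patchE indicE; case: ifP => _; rewrite ?mul1e ?mul0e.
have mcA' := measurable_counts cS dA'.
have mLA c : measurable_fun setT
    (fun xi => (\1_(L c) xi)%:E * (counts A' xi)%:R%:E : \bar R).
  by apply: emeasurable_funM => //; apply/measurable_EFinP; exact: measurable_indic.
have LA0 c xi : 0 <= (\1_(L c) xi)%:E * (counts A' xi)%:R%:E :> \bar R.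
  by rewrite mule_ge0// lee_fin.
rewrite -integral_nneseries//.
rewrite [RHS]integral_mkcond; apply: eq_integral => xi _; rewrite patchE.
case: ifPn => [/set_mem xiN|/negP xiN].
  rewrite /counts big_ord_recl -nneseries_lt; apply: eq_eseriesr => c _.
  rewrite indicE; case: ifPn => lc; first by rewrite mem_set ?mul1e.
  by rewrite memNset ?mul0e//= => -[_]; exact/negP.
rewrite eseries0// => c _ _; rewrite indicE memNset ?mul0e// => -[xiN' _].
by apply: xiN; exact/mem_set.
Qed.

Definition empty_tuple (xi : M) : 0.-tuple T * M := ([tuple], xi).

Let measurable_empty_tuple : measurable_fun setT empty_tuple.
Proof. by apply: measurable_fun_pair => //; exact: measurable_cst. Qed.

(** By uniqueness these are all the factorial measures, so a property can be
proved along this recursion. *)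
Fixpoint factorial_measure n : {measure set (n.-tuple T * M) -> \bar R} :=
  if n is n'.+1 then extend (factorial_measure n') else
  measure_function_pushforward__canonical__measure_function_Measure
    mu measurable_empty_tuple.

Lemma factorial_measureP n : factorial_campbell mu (factorial_measure n).
Proof.
elim: n => [|n IH]; last exact: factorial_campbell_extend.
split=> [A N _ mN|]; last by apply: aeW => -[x xi]; split=> [|[]//]; rewrite /= tuple0.
rewrite -[LHS]/(mu (empty_tuple @^-1` (pbox A `*` N))).
rewrite (_ : _ @^-1` _ = N); last first.
  by apply/seteqP; split=> xi => [[]//|xiN]; split=> // -[].
under eq_integral do rewrite /counts big_ord0.
by rewrite integral_cst// mul1e.
Qed.

Lemma factorial_campbell_ind (P : forall n, set (n.-tuple T * M)) :
  (forall n, measurable (P n)) ->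
  {ae mu, forall xi, P 0%N (empty_tuple xi)} ->
  (forall n (x : n.-tuple T) xi y, P n (x, xi) -> is_particle xi y -> y \notin x ->
     P n.+1 (tcons (y, x), xi)) ->
  forall n (Q : {measure set (n.-tuple T * M) -> \bar R}),
    factorial_campbell mu Q -> {ae Q, forall z, P n z}.
Proof.
move=> mP P0 PS n Q QP.
suff : Q (~` P n) = 0.
  move=> /(ae_measurableP _ (measurableC (mP n))); apply: ae_mono => z; exact: contrapT.
rewrite (factorial_campbell_unique cS QP (factorial_measureP n) (measurableC (mP n))).
elim: n {Q QP} => [|n IH].
  apply/(ae_measurableP mu (A := empty_tuple @^-1` (~` P 0%N))).
    rewrite -[X in measurable X]setTI; apply: measurable_empty_tuple => //.
    apply: measurableC; exact: mP.
  by apply: ae_mono P0 => xi Pxi; exact.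
apply/extend_eq0; first by apply: measurableC; exact: mP.
apply: ae_mono ((ae_measurableP _ (measurableC (mP n))).2 IH) => -[x xi] /= Pz.
by move=> y xiy yx nPy; apply: nPy; apply: PS => //; exact: contrapT.
Qed.

(** By uniqueness, the measure of degree [n.+1] extends that of degree [n] by one
particle. *)
Lemma factorial_campbell_eq0 n (Q : {measure set (n.-tuple T * M) -> \bar R})
    (Q' : {measure set (n.+1.-tuple T * M) -> \bar R}) E :
  factorial_campbell mu Q -> factorial_campbell mu Q' -> measurable E ->
  Q' E = 0 <->
  {ae Q, forall z, forall y, is_particle z.2 y -> y \notin z.1 ->
     ~ E (tcons (y, z.1), z.2)}.
Proof.
move=> QP QP' mE; rewrite -extend_eq0//.
by rewrite (factorial_campbell_unique cS QP' (factorial_campbell_extend QP)).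
Qed.

End extension.

(** * Campbell measures of the Palm measures, and simplicity *)

Section palm_campbell.
Local Open Scope ereal_scope.
Context (R : realType) (d : nat) (S : set 'rV[R]_d).
Hypotheses (d0 : (0 < d)%N) (cS : closed S).
Local Notation T := 'rV[R]_d.
Local Notation M := (mconfig S).

Let mS : measurable S.
Proof. exact: closed_measurable_mx. Qed.

Let mtpow n : measurable (tpow n S).
Proof. exact: measurable_tpow. Qed.

Variable mu : probability M R.

Section one_degree.
Variables (n : nat) (rho : n.-tuple T -> R) (palm : R.-pker (n.-tuple T) ~> M).
Hypotheses (hrho : is_correlation mu rho) (hpalm : is_palm mu rho palm).

(** The correlation function is only controlled on the tuples of [S]. *)
Definition density (x : n.-tuple T) : R := (rho \_ (tpow n S)) x.

Lemma density_ge0 x : (0 <= density x)%R.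
Proof.
have [_ rho0 _ _] := hrho; rewrite /density patchE.
by case: ifPn => // /set_mem; exact: rho0.
Qed.

Lemma measurable_density : measurable_fun setT density.
Proof. by have [mrho _ _ _] := hrho; apply/(measurable_restrictT _ (@mtpow n)). Qed.

Let palm_law (x : n.-tuple T) : {measure set M -> \bar R} :=
  mscale (NngNum (density_ge0 x)) (palm x).

Lemma measurable_palm_xsection (E : set (n.-tuple T * M)) : measurable E ->
  measurable_fun setT (fun x => palm x (xsection E x)).
Proof.
by move=> mE; apply: measurable_fun_xsection_finite_kernel; rewrite inE.
Qed.

Let mpalm_law : measurable_sections palm_law.
Proof.
move=> E mE; apply: emeasurable_funM; last exact: measurable_palm_xsection.
by apply/measurable_EFinP; exact: measurable_density.
Qed.

(** The unreduced Campbell measure: the particles of the tuple are still in the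
configuration. *)
Definition palm_campbell : {measure set (n.-tuple T * M) -> \bar R} :=
  semidirect (lebdn R d n) mpalm_law.

Lemma palm_campbellE E :
  palm_campbell E = \int[lebdn R d n]_x ((density x)%:E * palm x (xsection E x)).
Proof. by []. Qed.

Lemma palm_campbell_eq0 E : measurable E ->
  palm_campbell E = 0 <->
  {ae lebdn R d n, forall x, density x = 0%R \/ palm x (xsection E x) = 0}.
Proof.
move=> mE; apply: (iff_trans (semidirect_eq0 _ mpalm_law mE)).
have H x : palm_law x (xsection E x) = 0 <->
    (density x = 0%R \/ palm x (xsection E x) = 0).
  rewrite -[palm_law _ _]/((density x)%:E * palm x (xsection E x)).
  split=> [/eqP|[->|->]]; rewrite ?mul0e ?mule0//.
  by rewrite mule_eq0 => /orP[/eqP[]|/eqP]; [left|right].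
by split; apply: ae_mono => x /H.
Qed.

Lemma integral_block (D : set (n.-tuple T)) N : measurable D -> D `<=` tpow n S ->
  measurable N ->
  palm_campbell (D `*` N) = \int[lebdn R d n]_(x in D) (palm x N * (rho x)%:E).
Proof.
move=> mD DS mN; rewrite palm_campbellE [RHS]integral_mkcond.
apply: eq_integral => x _; rewrite patchE; case: ifPn => [/set_mem Dx|nDx].
  rewrite muleC /density patchE mem_set; last exact: DS.
  congr (_ * _); congr (palm x _); apply/seteqP; split=> xi; rewrite /xsection /=.
    by move=> /set_mem [].
  by move=> ?; apply/mem_set.
rewrite (_ : xsection _ x = set0) ?measure0 ?mule0//.
apply/seteqP; split=> // xi; rewrite /xsection /= => /set_mem [/= Dx _].
by move/negP: nDx; apply; exact/mem_set.
Qed.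

Lemma block_ones (A : 'I_n -> set T) : @block R d n n A (fun=> 1%N) = pbox A.
Proof.
have E (j : 'I_n) : nth set0 (flatten [seq nseq 1 (A i) | i <- enum 'I_n]) j = A j.
  rewrite (_ : flatten _ = map A (enum 'I_n)); last first.
    by elim: (enum 'I_n) => //= a l ->.
  by rewrite (nth_map j) ?size_enum_ord// nth_ord_enum.
by apply/seteqP; split=> x xA i; have := xA i; rewrite ?E.
Qed.

(** With all exponents equal to one, the falling factorials that define the Palm
measures are the counts; and almost every tuple has distinct components. *)
Lemma factorial_campbell_palm : factorial_campbell mu palm_campbell.
Proof.
split=> [A N dA mN|].
  have mA i : measurable (A i) by have [] := dA.1 i.
  have AS i : A i `<=` S by have [] := dA.1 i.
  rewrite integral_block//; last 2 first.
  - exact: measurable_pbox.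
  - by move=> x xA i; apply: AS; exact: xA.
  rewrite -block_ones hpalm//; last first.
    split; [exact: dA.1|exact: dA.2|by []|].
    by rewrite sum_nat_const card_ord muln1.
  apply: eq_integral => xi _; rewrite /falling /counts; congr (_%:R%:E)%R.
  by apply: eq_bigr => i _; rewrite ffactn1.
have mu_ : measurable [set t : n.-tuple T | ~ (uniq t /\ tpow n S t)].
  rewrite (_ : [set t | _] = ~` ([set t : n.-tuple T | uniq t] `&` tpow n S))//.
  by apply: measurableC; apply: measurableI; [exact: measurable_uniq_row|exact: mtpow].
have mE : measurable ((fst : n.-tuple T * M -> _) @^-1`
    [set t : n.-tuple T | ~ (uniq t /\ tpow n S t)]).
  by rewrite -[X in measurable X]setTI; exact: measurable_fst.
suff : palm_campbell ((fst : n.-tuple T * M -> _) @^-1`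
    [set t : n.-tuple T | ~ (uniq t /\ tpow n S t)]) = 0.
  by move=> /(ae_measurableP _ mE); apply: ae_mono => z /contrapT.
apply/palm_campbell_eq0 => //; apply: ae_mono (lebdn_uniq R n d0) => x ux.
have [xS|nxS] := pselect (tpow n S x); last by left; rewrite /density patchE memNset.
right; rewrite (_ : xsection _ x = set0) ?measure0//.
by apply/seteqP; split=> // xi; rewrite /xsection /= => /set_mem; apply.
Qed.

End one_degree.

Section simplicity.
Variables (rho : 2.-tuple T -> R) (palm : R.-pker (2.-tuple T) ~> M).
Hypotheses (hrho : is_correlation mu rho) (hpalm : is_palm mu rho palm).

Let Q := palm_campbell palm hrho.

Lemma palm_campbell_square (C : set T) N : measurable C -> bounded_set C -> C `<=` S ->
  measurable N ->
  Q (tpow 2 C `*` N) = \int[mu]_(xi in N) (count_in xi C ^_ 2)%:R%:E.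
Proof.
move=> mC bC CS mN; rewrite /Q integral_block//; last 2 first.
- exact: measurable_tpow.
- by move=> x xC i; apply: CS; exact: xC.
have blockE : tpow 2 C = @block R d 2 1 (fun=> C) (fun=> 2%N).
  have E (j : 'I_2) : nth set0 (flatten [seq nseq 2 C | i <- enum 'I_1]) j = C.
    rewrite enum_ordSl /=; case: j => -[|[|]]//= _.
  by apply/seteqP; split=> x xC i; have := xC i; rewrite ?E.
rewrite blockE hpalm//; last first.
  split=> //; [by move=> i j; rewrite !ord1 eqxx|by rewrite big_ord1].
by apply: eq_integral => xi _; rewrite /falling big_ord1.
Qed.

(** Two particles at the same point lie in a common cell of every grid. So the
event that there are such particles in [A] is bounded by the mass that the second
factorial measure gives to the pairs lying in a common cell of a fine grid. These
sets of pairs shrink to the diagonal, which has mass zero because the second factorial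
measure has a density. *)
Lemma ae_no_double (A : set T) (b : nat) : measurable A -> bounded_set A -> A `<=` S ->
  {ae mu, forall xi, (count_in xi A <= b)%N -> forall x, A x -> xi [set x] <= 1}.
Proof.
move=> mA bA AS; pose N : set M := [set xi | (count_in xi A <= b)%N].
have mN : measurable N by exact: (measurable_count_inP cS (fun k => (k <= b)%N)).
pose C m (k : nat) : set T := oapp (fun c => cell m @^-1` [set c] `&` A) set0 (choice.pickle_inv k).
have mC m k : measurable (C m k).
  rewrite /C; case: (choice.pickle_inv k) => [c|] /=; last exact: measurable0.
  by apply: measurableI => //; exact: measurable_cell.
have CA m k : C m k `<=` A.
  by rewrite /C; case: (choice.pickle_inv k) => [c|] //= x [].
have bC m k : bounded_set (C m k) by exact: bounded_sub bA.
have CS m k : C m k `<=` S by move=> x /CA /AS.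
(* the pairs in a common cell of the m-th grid *)
pose D m : set (2.-tuple T) := \bigcup_k tpow 2 (C m k).
have mD m : measurable (D m).
  by apply: bigcupT_measurable => k; exact: measurable_tpow.
pose F m : set (2.-tuple T * M) := \bigcup_(j in [set j | (m <= j)%N]) (D j `*` N).
have mF m : measurable (F m).
  by apply: bigcup_measurable => j _; exact: measurableX.
have FA m : F m `<=` tpow 2 A `*` N.
  move=> [x xi] [j _ [[k _ xC] xiN]]; split=> // i; exact: CA (xC i).
(* the bound on the count makes the masses finite, hence continuous from above *)
have QA : Q (tpow 2 A `*` N) < +oo.
  rewrite palm_campbell_square//.
  apply: (@le_lt_trans _ _ (\int[mu]_(xi in N) (b ^ 2)%:R%:E)).
    apply: ge0_le_integral => //.
    - apply: measurable_funTS.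
      exact: (measurable_count_comp cS (fun k => (k ^_ 2)%:R%:E)).
    - move=> xi xiN; rewrite lee_fin ler_nat.
      by rewrite ffactnS ffactn1 expnS expn1 leq_mul// (leq_trans (leq_pred _)).
  rewrite integral_cst// lte_mul_pinfty//.
  by rewrite (le_lt_trans (probability_le1 _ _))// ltry.
have tC m k k' y : C m k y -> C m k' y -> k = k'.
  rewrite /C; have := @choice.pickle_invK 'rV[int]_d k; have := @choice.pickle_invK 'rV[int]_d k'.
  case: (choice.pickle_inv k) => [c|] //=; case: (choice.pickle_inv k') => [c'|] //=.
  by move=> <- <- [<- _] [<- _].
have QD m : Q (D m `*` N) = \sum_(k <oo) Q (tpow 2 (C m k) `*` N).
  rewrite /D setX_bigcupl; apply: measure_semi_bigcup.
  - by move=> k; apply: measurableX => //; exact: measurable_tpow.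
  - by move=> k k' _ _ [[x xi] [[xC _] [xC' _]]]; exact: tC (xC ord0) (xC' ord0).
  - by apply: bigcupT_measurable => k; apply: measurableX => //; exact: measurable_tpow.
pose H m k : set M := N `&` [set xi | (2 <= count_in xi (C m k))%N].
have mH m k : measurable (H m k).
  by apply: measurableI => //; exact: (measurable_count_inP cS (fun j => (2 <= j)%N)).
pose G m : set M := \bigcup_k H m k.
have mG m : measurable (G m) by exact: bigcupT_measurable.
have GF m : mu (G m) <= Q (F m).
  apply: (@le_trans _ _ (Q (D m `*` N))); last first.
    apply: le_measure; rewrite ?inE//; first exact: measurableX.
    by move=> z Dz; exists m => //=.
  rewrite QD; apply: (@le_trans _ _ (\sum_(k <oo) mu (H m k))).
    exact: measure_sigma_subadditive.
  apply: lee_nneseries => [k _ _|k _]; first by [].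
  rewrite palm_campbell_square//.
  have mc : measurable_fun setT (fun xi : M => (count_in xi (C m k) ^_ 2)%:R%:E : \bar R).
    exact: (measurable_count_comp cS (fun k => (k ^_ 2)%:R%:E)).
  rewrite -[leLHS]mul1e -integral_cst//.
  apply: (@le_trans _ _ (\int[mu]_(xi in H m k) (count_in xi (C m k) ^_ 2)%:R%:E)).
    apply: ge0_le_integral => //; first exact: measurable_funTS.
    by move=> xi [_ c2]; rewrite /= lee_fin ler1n ffact_gt0.
  apply: ge0_subset_integral => //; first exact: measurable_funTS.
  by move=> xi [].
have Qcap : Q (\bigcap_m F m) = 0.
  have [_ Qu] := factorial_campbell_palm hrho hpalm.
  apply/(ae_measurableP Q); first exact: bigcapT_measurable.
  apply: ae_mono Qu => -[x xi] /= [/tuple_uniqP ux _] xF.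
  suff /ux/(congr1 val) : tnth x ord0 = tnth x (lift ord0 ord0).
  by [].
  apply: subr0_eq; apply: normr0_eq0; apply/eqP; rewrite eq_le normr_ge0 andbT.
  apply/ler_addgt0Pl => e e0; rewrite addr0.
  have [m _ me] := near_infty_natSinv_lt (PosNum e0).
  have [j /= mj [[k _ xC] _]] := xF m Logic.I.
  have xj : cell j (tnth x ord0) = cell j (tnth x (lift ord0 ord0)).
    have := xC ord0; have := xC (lift ord0 ord0); rewrite /C.
    by case: (choice.pickle_inv k) => [c|] //= [-> _] [-> _].
  by rewrite (le_trans (cell_dist xj))// ltW// me.
have F0 : Q (F m) @[m --> \oo] --> 0.
  rewrite -Qcap; apply: nonincreasing_cvg_mu => //.
  - apply: le_lt_trans QA; apply: le_measure; rewrite ?inE//.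
    by apply: measurableX => //; exact: measurable_tpow.
  - exact: bigcapT_measurable.
  - move=> m m' mm'; apply/subsetPset => z [j /= m'j Dz]; exists j => //=.
    exact: leq_trans mm' m'j.
have G0 : mu (\bigcap_m G m) = 0.
  apply/eqP; rewrite eq_le measure_ge0 andbT.
  apply: (cvge_ge _ F0); apply: nearW => m; apply: le_trans (GF m).
  apply: le_measure; rewrite ?inE//; first exact: bigcapT_measurable.
  exact: bigcap_inf.
have := (ae_measurableP mu (bigcapT_measurable mG)).2 G0.
apply: ae_mono => xi nG xib x Ax; rewrite leNgt; apply/negP => xi2; apply: nG => m _.
exists (choice.pickle (cell m x)) => //; split=> //=.
have xC : C m (choice.pickle (cell m x)) x by rewrite /C choice.pickleK_inv.
have : xi [set x] <= xi (C m (choice.pickle (cell m x))).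
  by apply: config_le => y [-> _].
move: xi2; rewrite !(count_inE cS _ (bC _ _)) (count_inE cS _ (bounded_set1 x)).
by rewrite !lte_fin lee_fin ltr1n ler_nat; exact: leq_trans.
Qed.

Lemma ae_simple : {ae mu, forall xi, simple_config xi}.
Proof.
have h (rb : nat * nat) : {ae mu, forall xi, (count_in xi (gball rb.1 `&` S) <= rb.2)%N ->
    forall x, (gball rb.1 `&` S) x -> xi [set x] <= 1}.
  apply: ae_no_double.
  - by apply: measurableI => //; exact: measurable_gball.
  - by apply: (@bounded_sub _ _ _ (gball rb.1)); [move=> x []|exact: gball_bounded].
  - by move=> x [].
have : {ae mu, forall xi, forall k, oapp (fun rb : nat * nat =>
    (count_in xi (gball rb.1 `&` S) <= rb.2)%N -> forall x, (gball rb.1 `&` S) x ->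
      xi [set x] <= 1) True (choice.unpickle k)}.
  apply: ae_foralln => k; case: (choice.unpickle k) => [rb|] /=; first exact: h.
  exact: aeW.
apply: ae_mono => xi xiP x; have [Sx|nSx] := pselect (S x); last first.
  by rewrite config_setI0//; apply/seteqP; split=> // y [-> /nSx].
pose r := (Num.truncn `|x|%R).+1.
have := xiP (choice.pickle (r, count_in xi (gball r `&` S))).
rewrite choice.pickleK /=; apply=> //; split=> //.
by rewrite /gball /= ltW// truncnS_gt.
Qed.

End simplicity.

Lemma measurable_tuple_particles n :
  measurable [set z : n.-tuple T * M | forall y, y \in z.1 -> is_particle z.2 y].
Proof.
rewrite (_ : [set z | _] = \bigcap_(i in [set: 'I_n])
    [set z : n.-tuple T * M | is_particle z.2 (tnth z.1 i)]).
  apply: fin_bigcap_measurable => // i _; apply: measurable_particle => //.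
  exact: (measurableT_comp (measurable_tnth i) measurable_fst).
apply/seteqP; split=> z h; first by move=> i _; apply: h; exact: mem_tnth.
by move=> y /tnthP[i ->]; exact: (h i Logic.I).
Qed.

(** Along the construction of the factorial measures, the configuration keeps the
law of [mu] up to null sets, and each new point of the tuple is a particle. *)
Lemma factorial_campbell_support n (Q : {measure set (n.-tuple T * M) -> \bar R}) :
  {ae mu, forall xi, simple_config xi} -> factorial_campbell mu Q ->
  {ae Q, forall z : n.-tuple T * M, [/\ uniq z.1,
     forall y, y \in z.1 -> is_particle z.2 y & simple_config z.2]}.
Proof.
move=> [N [mN N0 Nsimple]] QP.
have mNn k : measurable [set z : k.-tuple T * M | ~ N z.2].
  rewrite (_ : [set z | _] = snd @^-1` ~` N)// -[X in measurable X]setTI.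
  by apply: measurable_snd => //; exact: measurableC.
have H1 : {ae Q, forall z, [set z : n.-tuple T * M | ~ N z.2] z}.
  apply: (factorial_campbell_ind cS mNn _ _ QP) => //.
  by apply/ae_measurableP.
have H2 := factorial_campbell_ind cS measurable_tuple_particles _ _ QP.
have {}H2 : {ae Q, forall z : n.-tuple T * M,
    forall y, y \in z.1 -> is_particle z.2 y}.
  apply: H2 => [|k x xi y xP xiy yx w].
    by apply: aeW => xi y.
  by rewrite /= inE => /orP[/eqP ->//|]; exact: xP.
apply: ae_mono (ae_and QP.2 (ae_and H1 H2)) => -[x xi] /= [[ux _] [nN xP]]; split=> //.
by apply: contrapT => ns; apply: nN; exact: Nsimple.
Qed.

End palm_campbell.

(** * Equivalent Palm measures and resampling *)

Section finite_as_sigma_finite.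
Local Open Scope ereal_scope.
Context dX (X : measurableType dX) (R : realType).
Variables (m : {measure set X -> \bar R}) (moo : m setT < +oo).

(** The theorems on product measures expect a structure of sigma-finite measure. *)
Definition finite_copy of m setT < +oo : set X -> \bar R := m.

HB.instance Definition _ := Measure.on (finite_copy moo).

Let finite_copy_sigma_finite : sigma_finite setT (finite_copy moo).
Proof. by exists (fun=> setT) => [|_]; [rewrite bigcup_const|split]. Qed.

HB.instance Definition _ := Measure_isSigmaFinite.Build _ _ _
  (finite_copy moo) finite_copy_sigma_finite.

End finite_as_sigma_finite.

Section equivalent_palm_measures.
Local Open Scope ereal_scope.
Context (R : realType) (d : nat) (S : set 'rV[R]_d).
Hypothesis cS : closed S.
Local Notation T := 'rV[R]_d.
Local Notation M := (mconfig S).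

Let mS : measurable S.
Proof. exact: closed_measurable_mx. Qed.

Let mtpow n : measurable (tpow n S).
Proof. exact: measurable_tpow. Qed.

Definition remove_pair n (z : n.-tuple T * M) : n.-tuple T * M :=
  (z.1, remove z.1 z.2).

Lemma measurable_remove_pair n : measurable_fun setT (@remove_pair n).
Proof.
apply: measurable_fun_pair; first exact: measurable_fst.
exact: (measurable_remove cS measurable_snd measurable_fst).
Qed.

Lemma measurable_remove1 n (x : n.-tuple T) : measurable_fun setT (@remove R d S n x).
Proof.
have m1 : measurable_fun setT (fun _ : M => x) by exact: measurable_cst.
exact: (measurable_remove cS (@measurable_id _ M setT) m1).
Qed.

Variable mu : probability M R.

Section one_degree.
Variables (n : nat) (rho : n.-tuple T -> R) (palm : R.-pker (n.-tuple T) ~> M).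
Hypothesis hrho : is_correlation mu rho.

Local Notation red := (reduced_palm palm).

Lemma palm1 x : palm x setT = 1.
Proof. exact: prob_kernel. Qed.

Definition reduced_palm_measure (x : n.-tuple T) : {measure set M -> \bar R} :=
  measure_function_pushforward__canonical__measure_function_Measure
    (palm x) (measurable_remove1 x).

Lemma reduced_palm_null x (A B : set M) : measurable A -> measurable B ->
  A `<=` B -> red x B = 0 -> red x A = 0.
Proof.
move=> mA mB AB B0; apply/eqP; rewrite eq_le; apply/andP; split.
  by rewrite -B0; apply: (le_measure (reduced_palm_measure x)); rewrite ?inE.
exact: (measure_ge0 (reduced_palm_measure x)).
Qed.

Lemma reduced_palm_dominated x y (A : set M) : red x `<< red y -> measurable A ->
  red y A = 0 -> red x A = 0.
Proof.
move=> xy mA yA; apply: (xy A) => // B mB BA.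
exact: reduced_palm_null yA.
Qed.

Lemma remove_xsection (E : set (n.-tuple T * M)) x :
  xsection (@remove_pair n @^-1` E) x = remove x @^-1` xsection E x.
Proof.
by apply/seteqP; split=> xi; rewrite /xsection /=;
  move=> /set_mem h; apply/mem_set.
Qed.

Lemma palm_campbell_remove (E : set (n.-tuple T * M)) : measurable E ->
  {ae lebdn R d n, forall x, tpow n S x -> red x (xsection E x) = 0} ->
  palm_campbell cS palm hrho (@remove_pair n @^-1` E) = 0.
Proof.
move=> mE h; apply/palm_campbell_eq0.
  by rewrite -[X in measurable X]setTI; exact: measurable_remove_pair.
apply: ae_mono h => x h; rewrite remove_xsection.
have [xS|xS] := pselect (tpow n S x); first by right; exact: h.
by left; rewrite /density patchE memNset.
Qed.

Hypothesis EQ : {ae (lebdn R d n \x lebdn R d n)%E, forall z,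
  tpow n S z.1 -> tpow n S z.2 ->
  [/\ red z.1 `<< red z.2, red z.2 `<< red z.1 & (0 < rho z.1)%R]}.

(** By Fubini, the measure at almost every [w] in [S^n] is equivalent to almost all
the others; one such [w] is picked, unless almost no tuple lies in [S^n]. *)
Lemma reduced_palm_pivot :
  {ae lebdn R d n, forall x, ~ tpow n S x} \/
  exists w, {ae lebdn R d n, forall x, tpow n S x ->
    [/\ red w `<< red x, red x `<< red w & (0 < rho x)%R]}.
Proof.
have [|nS] := pselect {ae lebdn R d n, forall x, ~ tpow n S x}; [by left|right].
have H := ae_prod EQ.
have rho0 : {ae lebdn R d n, forall x, tpow n S x -> (0 < rho x)%R}.
  apply: ae_mono H => x Hx xS; apply: contrapT => nrho; apply: nS.
  by apply: ae_mono Hx => y /= + yS => /(_ xS yS)[].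
have [w [wS wP]] : exists w, tpow n S w /\ {ae lebdn R d n, forall y,
    tpow n S w -> tpow n S y ->
    [/\ red w `<< red y, red y `<< red w & (0 < rho w)%R]}.
  apply: contrapT => nw; apply: nS; apply: ae_mono H => x Hx xS.
  by apply: nw; exists x.
exists w; apply: ae_mono (ae_and wP rho0) => x [/(_ wS) wx rx] xS.
by have [? ? _] := wx xS; split=> //; exact: rx.
Qed.

Lemma ae_rho_gt0 : {ae lebdn R d n, forall x, tpow n S x -> (0 < rho x)%R}.
Proof.
have [nS|[w wP]] := reduced_palm_pivot; first by apply: ae_mono nS => x /[apply].
by apply: ae_mono wP => x /[apply] -[].
Qed.

Lemma palm_campbell_removeP (E : set (n.-tuple T * M)) : measurable E ->
  palm_campbell cS palm hrho (@remove_pair n @^-1` E) = 0 <->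
  {ae lebdn R d n, forall x, tpow n S x -> red x (xsection E x) = 0}.
Proof.
move=> mE; split; last exact: palm_campbell_remove.
have mE' : measurable (@remove_pair n @^-1` E).
  by rewrite -[X in measurable X]setTI; exact: measurable_remove_pair.
move=> /(palm_campbell_eq0 _ _ _ mE') h.
apply: ae_mono (ae_and h ae_rho_gt0) => x [+ rx] xS.
rewrite remove_xsection => -[] // /eqP.
by rewrite /density patchE mem_set// gt_eqF// rx.
Qed.

(** The correlation function is positive almost everywhere on [S^n], so the factor
that it brings does not create null sets. *)
Lemma campbell_eq0P (cm : {measure set (n.-tuple T * M) -> \bar R}) :
  is_campbell rho palm cm -> forall E, measurable E ->
  cm E = 0 <->
  {ae lebdn R d n, forall x, tpow n S x -> red x (xsection E x) = 0}.
Proof.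
move=> cmE E mE; rewrite cmE//.
have [mrho rho0 _ _] := hrho.
have mE' : measurable (@remove_pair n @^-1` E).
  by rewrite -[X in measurable X]setTI; exact: measurable_remove_pair.
have -> : \int[lebdn R d n]_(x in tpow n S) (red x (xsection E x) * (rho x)%:E) =
    palm_campbell cS palm hrho (@remove_pair n @^-1` E).
  rewrite palm_campbellE integral_mkcond; apply: eq_integral => x _.
  rewrite patchE /density patchE remove_xsection; case: ifPn => _; last by rewrite mul0e.
  by rewrite muleC.
exact: palm_campbell_removeP.
Qed.

(** The reduced Palm measures can be replaced by the one at the pivot [w], which
does not depend on the tuple: up to null sets the Campbell measure is a product, and
Fubini applies to the coordinate [j]. *)
Lemma reduced_palm_resample (j : 'I_n) (E : set (n.-tuple T * M)) : measurable E ->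
  {ae lebdn R d n, forall x, tpow n S x -> red x (xsection E x) = 0} ->
  {ae lebdn R d n, forall x, tpow n S x ->
    red x [set eta | lebd R d [set y | S y /\ E (set_tnth x j y, eta)] != 0] = 0}.
Proof.
move=> mE E0; have [nS|[w wP]] := reduced_palm_pivot.
  by apply: ae_mono nS => x /[apply].
have woo : reduced_palm_measure w setT < +oo.
  by rewrite -[X in X < _]/(palm w (remove w @^-1` setT)) preimage_setT palm1 ltry.
pose nu : {sigma_finite_measure set M -> \bar R} := finite_copy woo.
pose ES := E `&` (fst @^-1` tpow n S).
have mES : measurable ES.
  apply: measurableI => //; rewrite -[X in measurable X]setTI.
  by apply: measurable_fst => //; exact: mtpow.
have ES0 : {ae lebdn R d n, forall x, nu (xsection ES x) = 0}.
  apply: ae_mono (ae_and E0 wP) => x [xE xw].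
  have [xS|nxS] := pselect (tpow n S x); last first.
    rewrite (_ : xsection _ _ = set0) ?measure0//.
    by apply/seteqP; split=> // eta; rewrite /xsection /= => /set_mem [].
  have [wx _ _] := xw xS.
  apply: (@reduced_palm_null w _ (xsection E x)).
  - exact: measurable_xsection.
  - exact: measurable_xsection.
  - by move=> eta; rewrite /xsection /= => /set_mem [? _]; apply/mem_set.
  - by apply: (reduced_palm_dominated wx); [exact: measurable_xsection|exact: xE].
pose F : set ((n.-tuple T * M) * T) := [set v | ES (set_tnth v.1.1 j v.2, v.1.2)].
have mF : measurable F.
  by rewrite -[X in measurable X]setTI; exact: (@measurable_tuple_move R d _ M n j).
pose G : set (n.-tuple T * M) := [set z | lebd R d (xsection F z) != 0].
have mG : measurable G.
  rewrite -[X in measurable X]setTI; apply: emeasurable_neq => //.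
  exact: measurable_fun_xsection.
have G0 : {ae nu, forall eta, lebdn R d n (ysection G eta) = 0}.
  have := (ae_ysection (lebdn R d n) nu mES).1 ES0.
  apply: ae_mono => eta ESeta.
  have mY : measurable (ysection ES eta) by exact: measurable_ysection.
  apply/ae_measurableP; first exact: measurable_ysection.
  apply: ae_mono (lebdn_resampled j mY ESeta) => x x0.
  rewrite /ysection /= => /set_mem; rewrite /G /= => /eqP; apply.
  rewrite -x0; congr (lebd R d _).
have := (ae_ysection (lebdn R d n) nu mG).2 G0.
move=> h; apply: ae_mono (ae_and h wP) => x [Gx0 xw] xS.
have [_ xw' _] := xw xS.
rewrite (_ : [set eta | _] = xsection G x).
  by apply: (reduced_palm_dominated xw') => //; exact: measurable_xsection.
apply/seteqP; split=> eta; rewrite {1}/xsection /=.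
  move=> h'; apply/mem_set; move: h'; rewrite /G /=; congr (is_true (_ != _)).
  congr (lebd R d _); apply/seteqP; split=> y; rewrite /xsection /=.
    move=> [Sy Ey]; apply/mem_set; split=> // i /=.
    by rewrite tnth_mktuple; case: ifP => // _; exact: xS.
  move=> /set_mem [Ey yS]; split=> //.
  by have := yS j; rewrite /= tnth_mktuple eqxx.
move=> /set_mem; rewrite /G /=; congr (is_true (_ != _)).
congr (lebd R d _); apply/seteqP; split=> y; rewrite /xsection /=.
  move=> /set_mem [Ey yS]; split=> //.
  by have := yS j; rewrite /= tnth_mktuple eqxx.
move=> [Sy Ey]; apply/mem_set; split=> // i /=.
by rewrite tnth_mktuple; case: ifP => // _; exact: xS.
Qed.

End one_degree.

End equivalent_palm_measures.

(** * Jumps preserve the null sets of the Campbell measure *)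

Lemma measurable_fun_pair_on d0 d1 d2 (X : measurableType d0) (Y1 : measurableType d1)
    (Y2 : measurableType d2) (D : set X) (f : X -> Y1) (g : X -> Y2) :
  measurable D -> measurable_fun D f -> measurable_fun D g ->
  measurable_fun D (fun x => (f x, g x)).
Proof.
move=> mD /(measurable_restrictT _ mD) mf /(measurable_restrictT _ mD) mg.
apply: (eq_measurable_fun (fun x => ((f \_ D) x, (g \_ D) x))).
  by move=> x xD; rewrite !patchE xD.
by apply: measurable_funTS; exact: measurable_fun_pair.
Qed.

Section jumps_preserve_null_sets.
Local Open Scope ereal_scope.
Context (R : realType) (d : nat) (S : set 'rV[R]_d).
Hypotheses (d0 : (0 < d)%N) (cS : closed S).
Local Notation T := 'rV[R]_d.
Local Notation M := (mconfig S).

Let mS : measurable S.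
Proof. exact: closed_measurable_mx. Qed.

Variables (mu : probability M R).
Variables (rho : forall n, n.-tuple T -> R)
  (hrho : forall n, (0 < n)%N -> is_correlation mu (@rho n))
  (palm : forall n, R.-pker (n.-tuple T) ~> M)
  (hpalm : forall n, (0 < n)%N -> is_palm mu (@rho n) (palm n))
  (campbell : forall n, {measure set (n.-tuple T * M) -> \bar R})
  (hcampbell : forall n, (0 < n)%N ->
      is_campbell (@rho n) (palm n) (campbell n)).
Hypothesis EQ : forall m, (0 < m)%N ->
  {ae (lebdn R d m \x lebdn R d m)%E, forall z,
    tpow m S z.1 -> tpow m S z.2 ->
    [/\ reduced_palm (palm m) z.1 `<< reduced_palm (palm m) z.2,
        reduced_palm (palm m) z.2 `<< reduced_palm (palm m) z.1 &
        (0 < @rho m z.1)%R]}.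
Variables (k : nat) (k0 : (0 < k)%N).
Local Notation Z := (k.-tuple T * M)%type.

Definition tuple_landing (j : 'I_k) (N : set Z) (z : Z) : set T :=
  [set y | S y /\ N (set_tnth z.1 j y, z.2)].

Definition particle_landing (N : set Z) (z : Z) (x : T) : set T :=
  [set y | S y /\ N (z.1, jump z.2 x y)].

Lemma measurable_tuple_landing (j : 'I_k) (N : set Z) : measurable N ->
  measurable [set v : Z * T | tuple_landing j N v.1 v.2].
Proof.
move=> mN; rewrite (_ : [set v | _] = (snd @^-1` S) `&`
    ((fun v : Z * T => (set_tnth v.1.1 j v.2, v.1.2)) @^-1` N))//.
apply: measurableI; rewrite -[X in measurable X]setTI.
  by apply: measurable_snd => //.
exact: (@measurable_tuple_move R d _ M k j).
Qed.

(** A jump of a point of the tuple resamples it. *)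
Lemma campbell_tuple_jump (j : 'I_k) (N : set Z) : measurable N ->
  campbell k N = 0 ->
  {ae campbell k, forall z, tpow k S z.1 -> lebd R d (tuple_landing j N z) = 0}.
Proof.
move=> mN N0.
have cmP := campbell_eq0P cS (hrho k0) (EQ k0) (hcampbell k0).
have mL : measurable [set z | lebd R d (tuple_landing j N z) != 0].
  rewrite (_ : [set z | _] = [set z | lebd R d
      (xsection [set v : Z * T | tuple_landing j N v.1 v.2] z) != 0]).
    rewrite -[X in measurable X]setTI; apply: emeasurable_neq => //.
    by apply: measurable_fun_xsection; exact: measurable_tuple_landing.
  apply/seteqP; split=> z /=; congr (is_true (_ != _)); congr (lebd R d _);
    apply/seteqP; split=> y; rewrite /xsection /=;
    by [move=> ?; apply/mem_set|move=> /set_mem].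
have : campbell k [set z | lebd R d (tuple_landing j N z) != 0] = 0.
  apply/cmP => //.
  have := (cmP _ mN).1 N0.
  move=> /(reduced_palm_resample cS (EQ k0) j mN).
  apply: ae_mono => x h xS; rewrite -[RHS](h xS); congr (reduced_palm _ _ _).
  apply/seteqP; split=> eta; rewrite /xsection /tuple_landing /=.
    by move=> /set_mem.
  by move=> ?; apply/mem_set.
move=> /(ae_measurableP _ mL); apply: ae_mono => z /negP; rewrite negbK => /eqP h _.
exact: h.
Qed.

Lemma measurable_particle_landing (N : set Z) : measurable N ->
  measurable [set v : (Z * T) * T | is_particle v.1.1.2 v.1.2 /\
    particle_landing N v.1.1 v.1.2 v.2].
Proof.
move=> mN.
pose D : set ((Z * T) * T) := [set v | is_particle v.1.1.2 v.1.2 /\ S v.2].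
have m2 : measurable_fun setT (fun v : (Z * T) * T => v.1.1.2).
  exact: (measurableT_comp measurable_snd (measurableT_comp measurable_fst measurable_fst)).
have m3 : measurable_fun setT (fun v : (Z * T) * T => v.1.2).
  exact: (measurableT_comp measurable_snd measurable_fst).
have mD : measurable D.
  apply: measurableI; first exact: (measurable_particle cS m2 m3).
  by rewrite -[X in measurable X]setTI; apply: measurable_snd.
have mJ : measurable_fun D (fun v : (Z * T) * T => (v.1.1.1, jump v.1.1.2 v.1.2 v.2)).
  apply: measurable_fun_pair_on => //.
    apply: measurable_funTS.
    exact: (measurableT_comp measurable_fst (measurableT_comp measurable_fst measurable_fst)).
  exact: (measurable_jump cS m2 mD m3 measurable_snd).
rewrite (_ : [set v | _] = D `&` (fun v => (v.1.1.1, jump v.1.1.2 v.1.2 v.2)) @^-1` N).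
  exact: mJ.
by apply/seteqP; split=> v; [move=> [? [? ?]]; split|move=> [[? ?] ?]; split].
Qed.

(** A particle [y] of the configuration that is left when the tuple [x] is removed
makes [y :: x] a tuple of [k.+1] particles of the full configuration, and its jump
resamples the first point of this tuple. So the null set [N] of degree [k] is lifted
to degree [k.+1], where resampling preserves null sets, and brought back. *)
Lemma campbell_particle_jump (N : set Z) : measurable N ->
  campbell k N = 0 ->
  {ae campbell k, forall z, forall x, is_particle z.2 x ->
    lebd R d (particle_landing N z x) = 0}.
Proof.
move=> mN N0.
pose Qk := palm_campbell cS (palm k) (hrho k0).
pose Qk1 := palm_campbell cS (palm k.+1) (hrho (ltn0Sn k)).
have QkP : factorial_campbell mu Qk by exact: (factorial_campbell_palm d0 cS _ (hpalm k0)).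
have Qk1P : factorial_campbell mu Qk1.
  exact: (factorial_campbell_palm d0 cS _ (hpalm (ltn0Sn k))).
have simple : {ae mu, forall xi, simple_config xi}.
  exact: (ae_simple d0 cS (hrho (ltn0Sn 1)) (hpalm (ltn0Sn 1))).
have Qks := factorial_campbell_support cS simple QkP.
have Qk1s := factorial_campbell_support cS simple Qk1P.
have cmP := campbell_eq0P cS (hrho k0) (EQ k0) (hcampbell k0).
have mtl : measurable_fun setT (fun z : k.+1.-tuple T * M => (tuncons z.1).2).
  apply: (measurableT_comp measurable_snd).
  exact: (measurableT_comp (@measurable_tuncons _ T k) measurable_fst).
have mhd : measurable_fun setT (fun z : k.+1.-tuple T * M => (tuncons z.1).1).
  apply: (measurableT_comp measurable_fst).
  exact: (measurableT_comp (@measurable_tuncons _ T k) measurable_fst).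
have QN : Qk (@remove_pair R d S k @^-1` N) = 0.
  by apply: palm_campbell_remove => //; exact/cmP.
have mrN : measurable (@remove_pair R d S k @^-1` N).
  by rewrite -[X in measurable X]setTI; exact: measurable_remove_pair.
(* lifted null set: [y] is adjoined to the tuple, and stays in the configuration *)
pose E1 : set (k.+1.-tuple T * M) :=
  (fun z => ((tuncons z.1).2, z.2)) @^-1` (@remove_pair R d S k @^-1` N).
have mE1 : measurable E1.
  rewrite -[X in measurable X]setTI.
  have h := measurable_fun_pair mtl (@measurable_snd _ _ _ _ : measurable_fun setT
     (snd : k.+1.-tuple T * M -> M)).
  exact: h.
have E10 : Qk1 E1 = 0.
  apply/(factorial_campbell_eq0 cS QkP Qk1P mE1).
  apply: ae_mono ((ae_measurableP _ mrN).2 QN) => -[x xi] /= nN y _ _.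
  suff : ~ N (remove_pair ((tuncons (tcons (y, x))).2, xi)) by [].
  by rewrite tconsK.
(* its reduced form: [y] has left the configuration, which it completes *)
pose D2 : set (k.+1.-tuple T * M) := [set z | S (tuncons z.1).1].
have mD2 : measurable D2 by rewrite -[X in measurable X]setTI; exact: mhd.
pose E2 : set (k.+1.-tuple T * M) := D2 `&`
  ((fun z => ((tuncons z.1).2, addp z.2 (tuncons z.1).1)) @^-1` N).
have E2E yx eta : E2 (tcons yx, eta) <-> S yx.1 /\ N (yx.2, addp eta yx.1).
  have -> : E2 (tcons yx, eta) = (S (tuncons (tcons yx)).1 /\
      N ((tuncons (tcons yx)).2, addp eta (tuncons (tcons yx)).1)) by [].
  by rewrite tconsK.
have mE2 : measurable E2.
  have h : measurable_fun D2 (fun z : k.+1.-tuple T * M =>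
      ((tuncons z.1).2, addp z.2 (tuncons z.1).1)).
    apply: measurable_fun_pair_on => //; first exact: measurable_funTS.
    exact: (measurable_addp cS measurable_snd mD2 mhd).
  exact: h.
have tunK (w : k.+1.-tuple T) : tcons ((tuncons w).1, (tuncons w).2) = w.
  by apply: val_inj; rewrite /= /thead; case: w => -[].
have QE2 : Qk1 (@remove_pair R d S k.+1 @^-1` E2) = 0.
  have mE2' : measurable (@remove_pair R d S k.+1 @^-1` E2).
    by rewrite -[X in measurable X]setTI; exact: measurable_remove_pair.
  apply/(ae_measurableP _ mE2').
  apply: ae_mono (ae_and Qk1s ((ae_measurableP _ mE1).2 E10)) => -[w xi].
  have [[y x] ->] : exists yx, w = tcons yx.
    by exists (tuncons w); rewrite -[LHS](tunK w); case: (tuncons w).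
  move=> [[/= /andP[yx ux] yxxi sxi] nE1] [Sy Ny]; apply: nE1.
  have {}Sy : S (tuncons (tcons (y, x))).1 by exact: Sy.
  have {}Ny : N ((tuncons (tcons (y, x))).2,
    addp (remove (tcons (y, x)) xi) (tuncons (tcons (y, x))).1) by exact: Ny.
  suff : N (remove_pair ((tuncons (tcons (y, x))).2, xi)) by [].
  rewrite tconsK in Sy Ny *; rewrite /remove_pair /= (remove_addp cS (z := y))//.
  - by move=> v vx; apply: yxxi; rewrite inE vx orbT.
  - by apply: yxxi; rewrite inE eqxx.
have := (palm_campbell_removeP cS (hrho (ltn0Sn k)) (EQ (ltn0Sn k)) mE2).1 QE2.
move=> /(reduced_palm_resample cS (EQ (ltn0Sn k)) ord0 mE2).
(* the positions from which the resampled first point can fall in [E2] *)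
pose E3 : set (k.+1.-tuple T * M) :=
  [set z | lebd R d [set y | S y /\ E2 (set_tnth z.1 ord0 y, z.2)] != 0].
have mE3 : measurable E3.
  pose L : set ((k.+1.-tuple T * M) * T) :=
    [set v | S v.2 /\ E2 (set_tnth v.1.1 ord0 v.2, v.1.2)].
  have mL : measurable L.
    apply: measurableI; rewrite -[X in measurable X]setTI.
      by apply: measurable_snd.
    exact: (@measurable_tuple_move R d _ M k.+1 ord0).
  rewrite (_ : E3 = [set z | lebd R d (xsection L z) != 0]).
    rewrite -[X in measurable X]setTI; apply: emeasurable_neq => //.
    exact: measurable_fun_xsection.
  apply/seteqP; split=> z; rewrite /E3 /=; congr (is_true (_ != _)); congr (lebd R d _);
    apply/seteqP; split=> y; rewrite /xsection /=;
    by [move=> ?; apply/mem_set|move=> /set_mem].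
move=> E30.
have {E30} QE3 : Qk1 (@remove_pair R d S k.+1 @^-1` E3) = 0.
  apply: palm_campbell_remove => //; apply: ae_mono E30 => w h wS.
  rewrite -[RHS](h wS); congr (reduced_palm _ _ _).
  by apply/seteqP; split=> eta; rewrite /xsection /=; [move=> /set_mem|move=> ?; apply/mem_set].
have mE3' : measurable (@remove_pair R d S k.+1 @^-1` E3).
  by rewrite -[X in measurable X]setTI; exact: measurable_remove_pair.
have QkE3 := (factorial_campbell_eq0 cS QkP Qk1P mE3').1 QE3.
(* the particles whose jumps can fall in [N], as a measurable event of degree k *)
pose B : set Z := [set z | pts z.2 [set x | lebd R d (xsection
  [set v : (Z * T) * T | is_particle v.1.1.2 v.1.2 /\
    particle_landing N v.1.1 v.1.2 v.2] (z, x)) != 0] != 0].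
have BP z : B z <-> exists x, is_particle z.2 x /\ lebd R d (particle_landing N z x) != 0.
  have secE x : is_particle z.2 x -> xsection [set v : (Z * T) * T |
      is_particle v.1.1.2 v.1.2 /\ particle_landing N v.1.1 v.1.2 v.2] (z, x) =
      particle_landing N z x.
    move=> zx; apply/seteqP; split=> y; rewrite /xsection /=; first by move=> /set_mem [].
    by move=> h; apply/mem_set.
  split=> [/eqP nB|[x [zx xN]]].
    apply: contrapT => nx; apply: nB; apply/(pts_eq0P cS) => x xN zx.
    by apply: nx; exists x; split=> //; rewrite -secE.
  apply/eqP => /(pts_eq0P cS)/(_ x); apply => //.
  by rewrite /= secE.
have mB : measurable B.
  pose W : set (Z * T) := [set v | lebd R d (xsection
    [set v : (Z * T) * T | is_particle v.1.1.2 v.1.2 /\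
    particle_landing N v.1.1 v.1.2 v.2] v) != 0].
  have mW : measurable W.
    rewrite -[X in measurable X]setTI; apply: emeasurable_neq => //.
    by apply: measurable_fun_xsection; exact: measurable_particle_landing.
  rewrite (_ : B = [set z : Z | pts z.2 (xsection W z) != 0]).
    rewrite -[X in measurable X]setTI; apply: emeasurable_neq => //.
    exact: (measurable_fun_xsection_pts cS measurable_snd mW).
  apply/seteqP; split=> z; rewrite /B /=; congr (is_true (_ != _)); congr (pts z.2 _);
    apply/seteqP; split=> y; rewrite /(xsection W z) /=;
    by [move=> ?; apply/mem_set|move=> /set_mem].
have QB : Qk (@remove_pair R d S k @^-1` B) = 0.
  have mB' : measurable (@remove_pair R d S k @^-1` B).
    by rewrite -[X in measurable X]setTI; exact: measurable_remove_pair.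
  apply/(ae_measurableP _ mB').
  apply: ae_mono (ae_and Qks QkE3) => -[x xi] /= [[ux xxi sxi] h].
  move=> /BP /= [y [ry /eqP]]; apply.
  have [xiy yx] := (particle_remove cS y sxi ux xxi).1 ry.
  have := h y xiy yx; rewrite /E3 /= => /negP; rewrite negbK => /eqP <-.
  congr (lebd R d _); apply/seteqP; split=> y'.
    by move=> [Sy' Ny']; split=> //=; rewrite set_tnth0; apply/E2E; rewrite -(jump_remove cS).
  by move=> [Sy' /=]; rewrite set_tnth0 => /E2E [_ /=]; rewrite -(jump_remove cS).
have cB : campbell k B = 0.
  by apply/(cmP _ mB); apply/(palm_campbell_removeP cS (hrho k0) (EQ k0) mB).
apply: ae_mono ((ae_measurableP _ mB).2 cB) => z nB x zx.
by apply/eqP; apply: contrapT => /negP xN; apply: nB; apply/BP; exists x.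
Qed.

End jumps_preserve_null_sets.

(** * Closability from Fatou's lemma *)

Section limn_einf_sum.
Local Open Scope ereal_scope.
Context (R : realType).

Lemma limn_einf_ge0 (u : (\bar R)^nat) : (forall n, 0 <= u n) -> 0 <= limn_einf u.
Proof.
move=> u0; rewrite limn_einf_lim; apply: lime_ge; first exact: is_cvg_einfs.
by apply: nearW => n; apply: le_ereal_inf_tmp => _ [k /= nk <-].
Qed.

Lemma limn_einfD_ge0 (u v : (\bar R)^nat) :
  (forall n, 0 <= u n) -> (forall n, 0 <= v n) ->
  limn_einf u + limn_einf v <= limn_einf (fun n => u n + v n).
Proof.
move=> u0 v0; rewrite !limn_einf_lim.
have e0 (w : (\bar R)^nat) : (forall n, 0 <= w n) -> forall n, 0 <= einfs w n.
  by move=> w0 n; apply: le_ereal_inf_tmp => _ [k /= nk <-].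
rewrite -limeD; [|exact: is_cvg_einfs|exact: is_cvg_einfs|]; last first.
  by apply: ge0_adde_def; rewrite inE; apply: lime_ge;
    [exact: is_cvg_einfs|apply: nearW => n; exact: e0
    |exact: is_cvg_einfs|apply: nearW => n; exact: e0].
apply: lee_lim.
- apply: is_cvgeD; [|exact: is_cvg_einfs|exact: is_cvg_einfs].
  by apply: ge0_adde_def; rewrite inE; apply: lime_ge;
    [exact: is_cvg_einfs|apply: nearW => n; exact: e0
    |exact: is_cvg_einfs|apply: nearW => n; exact: e0].
- exact: is_cvg_einfs.
- apply: nearW => n; apply: le_ereal_inf_tmp => _ [k /= nk <-].
  by apply: leeD; apply: ereal_inf_lbound; exists k.
Qed.

Lemma limn_einf_sum_ge0 (I : Type) (s : seq I) (u : I -> (\bar R)^nat) :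
  (forall i n, 0 <= u i n) ->
  \sum_(i <- s) limn_einf (u i) <= limn_einf (fun n => \sum_(i <- s) u i n).
Proof.
move=> u0; elim: s => [|i s IH].
  by rewrite big_nil; apply: limn_einf_ge0 => n; rewrite big_nil.
under [X in _ <= limn_einf X]eq_fun do rewrite big_cons.
rewrite big_cons; apply: le_trans (limn_einfD_ge0 _ _); first exact: leeD.
  exact: u0.
by move=> n; apply: sume_ge0.
Qed.

End limn_einf_sum.

Section closability_by_fatou.
Local Open Scope ereal_scope.
Context (R : realType).

Lemma limn_einf_le_near (u : (\bar R)^nat) (e : \bar R) :
  (\forall n \near \oo, u n <= e) -> limn_einf u <= e.
Proof.
move=> ue; rewrite limn_einf_lim; apply: lime_le; first exact: is_cvg_einfs.
apply: filterS ue => n; apply: le_trans; apply: ereal_inf_lbound.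
by exists n => /=.
Qed.

Lemma cvge0P (u : (\bar R)^nat) : (forall n, 0 <= u n) ->
  u @ \oo --> 0 <-> forall e : R, (0 < e)%R -> \forall n \near \oo, u n < e%:E.
Proof.
move=> u0; split=> [/fine_cvgP[fu /cvgr0Pnorm_lt cu] e e0|ue].
  apply: filterS2 fu (cu e e0) => n fn; rewrite /= => une.
  by rewrite -(fineK fn) lte_fin (le_lt_trans (ler_norm _)).
apply/fine_cvgP; split.
  apply: filterS (ue 1%R ltr01) => n un.
  by rewrite ge0_fin_numE// (lt_trans un)// ltry.
apply/cvgr0Pnorm_lt => e e0; apply: filterS (ue e e0) => n une /=.
have fn : u n \is a fin_num by rewrite ge0_fin_numE// (lt_trans une)// ltry.
by rewrite ger0_norm ?fine_ge0// -lte_fin fineK.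
Qed.

Lemma fatou_ae dX (X : measurableType dX) (m : {measure set X -> \bar R})
    (F : (X -> \bar R)^nat) (G : X -> \bar R) :
  (forall n, measurable_fun setT (F n)) -> (forall n x, 0 <= F n x) ->
  measurable_fun setT G -> (forall x, 0 <= G x) ->
  {ae m, forall x, G x <= limn_einf (F^~ x)} ->
  \int[m]_x G x <= limn_einf (fun n => \int[m]_x F n x).
Proof.
move=> mF F0 mG G0 GF; apply: le_trans (fatou m measurableT mF (fun n x _ => F0 n x)).
apply: ae_ge0_le_integral => //.
- by move=> x _; apply: limn_einf_ge0 => n; exact: F0.
- rewrite (_ : (fun x => _) = (fun x => - limn_esup (fun n => - F n x))).
    apply: measurableT_comp => //; apply: measurable_fun_limn_esup => n.
    exact: measurableT_comp.
  apply/funext => x; rewrite -[in LHS](oppeK (limn_einf _)) -limn_esupN.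
  by [].
- by apply: ae_mono GF => x h _.
Qed.

Section square_increments.
Context dY (Y : measurableType dY) (m : {measure set Y -> \bar R}).
Variables (c g : Y -> R) (h : nat -> Y -> R).
Hypotheses (c0 : forall y, (0 <= c y)%R) (mc : measurable_fun setT c)
  (mg : measurable_fun setT g) (mh : forall l, measurable_fun setT (h l)).

Let mint (f : Y -> R) : measurable_fun setT f ->
  measurable_fun setT (fun y => ((f y * f y) * c y)%:E).
Proof.
by move=> mf; apply/measurable_EFinP; apply: measurable_funM => //; exact: measurable_funM.
Qed.

Let int0 (f : Y -> R) y : 0 <= ((f y * f y) * c y)%:E.
Proof. by rewrite lee_fin mulr_ge0// -expr2 sqr_ge0. Qed.

(** The increments converge wherever jumps occur, that is where the rate [c] is
positive. *)
Lemma fatou_increments :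
  {ae m, forall y, (0 < c y)%R -> h l y @[l --> \oo] --> (0:R)%R} ->
  \int[m]_y ((g y * g y) * c y)%:E <=
  limn_einf (fun l => \int[m]_y (((g y - h l y) * (g y - h l y)) * c y)%:E).
Proof.
move=> h0; apply: fatou_ae.
- move=> l; exact: (mint (measurable_funB mg (mh l))).
- by move=> l y; exact: (int0 (fun y => (g y - h l y)%R)).
- exact: mint.
- by move=> y; exact: int0.
- apply: ae_mono h0 => y hy.
  have [cy|cy] := ltP 0%R (c y); last first.
    have -> : c y = 0%R by apply/eqP; rewrite eq_le cy c0.
    under [X in limn_einf X]eq_fun do rewrite mulr0.
    by rewrite mulr0 (cvg_limn_einf_sup (cvg_cst _)).1.
  have gh : (g y - h l y)%R @[l --> \oo] --> (g y)%R.
    by rewrite -[X in _ --> X]subr0; apply: cvgB; [exact: cvg_cst|exact: hy].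
  have : (((g y - h l y) * (g y - h l y)) * c y)%:E @[l --> \oo] --> ((g y * g y) * c y)%:E.
    apply: cvg_EFin; first exact: nearW.
    by apply: cvgM; [exact: cvgM|exact: cvg_cst].
  by move=> /cvg_limn_einf_sup [->].
Qed.

End square_increments.

Section closable.
Context dZ (Z : measurableType dZ) (cm : {measure set Z -> \bar R}).

(** A subsequence whose squared norms are summable has summable squares almost
everywhere. *)
Lemma L2_cvg_ae_subseq (f : nat -> Z -> R) :
  (forall n, measurable_fun setT (f n)) ->
  Lnorm cm 2%:E (EFin \o f n) @[n --> \oo] --> 0 ->
  exists phi : nat -> nat, (forall l, (l <= phi l)%N) /\
    {ae cm, forall z, f (phi l) z @[l --> \oo] --> (0:R)%R}.
Proof.
move=> mf /(cvge0P (fun n => Lnorm_ge0 _ _ _)).1 f0.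
have fE n : \int[cm]_z (f n z ^+ 2)%:E = (Lnorm cm 2%:E (EFin \o f n)) `^ 2.
  rewrite poweR_Lnorm//; apply: eq_integral => z _ /=.
  by rewrite powR_mulrn// real_normK// num_real.
have /choice[phi phiP] l : exists n, (l <= n)%N /\
    \int[cm]_z (f n z ^+ 2)%:E <= (1 / (2 ^ l.+1)%:R)%R%:E.
  pose e : R := (1 / (2 ^ l.+1)%:R)%R.
  have e0 : (0 < e)%R by rewrite divr_gt0// ltr0n expn_gt0.
  have e1 : (e <= 1)%R by rewrite ler_pdivrMr ?ltr0n ?expn_gt0// mul1r ler1n expn_gt0.
  have [N _ NP] := f0 e e0; exists (maxn l N); split; first exact: leq_maxl.
  have := NP (maxn l N) (leq_maxr _ _); rewrite fE /=.
  have := Lnorm_ge0 cm 2%:E (EFin \o f (maxn l N)).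
  case: (Lnorm _ _ _) => [r| |]//; rewrite lee_fin lte_fin => r0 re.
  rewrite /= powR_mulrn// lee_fin expr2 -[leRHS]mulr1 ler_pM//; first exact: ltW.
  exact: le_trans (ltW re) e1.
exists phi; split=> [l|]; first by have [] := phiP l.
have mf2 l : measurable_fun setT (fun z => (f (phi l) z ^+ 2)%:E).
  by apply/measurable_EFinP; exact: measurable_funX.
have f20 l z : 0 <= (f (phi l) z ^+ 2)%:E by rewrite lee_fin sqr_ge0.
have Soo : \int[cm]_z \sum_(l <oo) (f (phi l) z ^+ 2)%:E < +oo.
  rewrite integral_nneseries//.
  apply: (@le_lt_trans _ _ (\sum_(l <oo) (1 / (2 ^ l.+1)%:R)%R%:E)).
    apply: lee_nneseries => [l _ _|l _]; first by apply: integral_ge0 => z _.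
    by have [] := phiP l.
  by apply: (le_lt_trans (epsilon_trick0 xpredT ler01)); rewrite ltry.
have mS : measurable_fun setT (fun z => \sum_(l <oo) (f (phi l) z ^+ 2)%:E).
  by apply: ge0_emeasurable_sum => // l z _ _.
have S0 z : 0 <= \sum_(l <oo) (f (phi l) z ^+ 2)%:E by exact: nneseries_ge0.
have /integrable_ae : cm.-integrable setT (fun z => \sum_(l <oo) (f (phi l) z ^+ 2)%:E).
  apply/integrableP; split=> //.
  by under eq_integral do rewrite gee0_abs//.
move=> /(_ measurableT); apply: ae_mono => z /(_ Logic.I) fz.
have Sz : \sum_(0 <= l <oo) (f (phi l) z ^+ 2)%:E < +oo by rewrite ltey_eq fz.
have := nneseries_tail_cvg Sz (fun k _ => f20 k z).
move=> /(cvge0P (fun N => nneseries_ge0 (fun k _ _ => f20 k z))).1 tail0.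
apply/cvgr0Pnorm_lt => e e0.
apply: filterS (tail0 (e ^+ 2)%R (exprn_gt0 _ e0)) => N tN.
rewrite -(ltr_pXn2r (n := 2))// ?nnegrE ?(ltW e0)// real_normK ?num_real//.
rewrite -lte_fin; apply: le_lt_trans tN.
rewrite (nneseries_split _ 1)//.
by rewrite addn1 big_nat1 leeDl// nneseries_ge0.
Qed.

Variables (D : set Z) (mD : measurable D).
Variable Gam : (Z -> R) -> Z -> \bar R.
Hypothesis Gam0 : forall f z, 0 <= Gam f z.
Hypothesis mGam : forall f, measurable_fun setT f -> measurable_fun setT (Gam f).
Hypothesis lscGam : forall g (h : nat -> Z -> R), measurable_fun setT g ->
  (forall l, measurable_fun setT (h l)) ->
  {ae cm, forall z, h l z @[l --> \oo] --> (0:R)%R} ->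
  {ae cm, forall z, D z -> Gam g z <= limn_einf (fun l => Gam (g \- h l)%R z)}.

(** Let [l] tend to infinity in the energy of [f n - f l]: by lower semicontinuity
and Fatou, the limit inferior bounds the energy of [f n], and it is small by the
Cauchy property. *)
Lemma energy_cvg0 (f : nat -> Z -> R) :
  (forall n, measurable_fun setT (f n)) ->
  Lnorm cm 2%:E (EFin \o f n) @[n --> \oo] --> 0 ->
  (forall e : R, (0 < e)%R -> exists N, forall m n, (N <= m)%N -> (N <= n)%N ->
     \int[cm]_(z in D) Gam (f m \- f n)%R z < e%:E) ->
  \int[cm]_(z in D) Gam (f n) z @[n --> \oo] --> 0.
Proof.
move=> mf f0 fC; have [phi [phil phi0]] := L2_cvg_ae_subseq mf f0.
apply/cvge0P; first by move=> n; apply: integral_ge0.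
move=> e e0; have [N NP] := fC (e / 2)%R (divr_gt0 e0 (ltr0Sn R 1)).
exists N => // n /= Nn.
have mD' (g : Z -> \bar R) : measurable_fun setT g -> measurable_fun setT (g \_ D).
  by move=> mg; apply/(measurable_restrictT _ mD); exact: measurable_funTS.
have pD0 (g : Z -> R) z : 0 <= (Gam g \_ D) z by rewrite patchE; case: ifP.
apply: (@le_lt_trans _ _ (e / 2)%:E); last by rewrite lte_fin ltr_pdivrMr// ltr_pMr// ltr1n.
rewrite integral_mkcond.
apply: (@le_trans _ _ (limn_einf (fun l => \int[cm]_z (Gam (f n \- f (phi l))%R \_ D) z))).
  apply: fatou_ae => //.
  - by move=> l; apply: mD'; apply: mGam; exact: measurable_funB.
  - by apply: mD'; exact: mGam.
  - have := lscGam (mf n) (fun l => mf (phi l)) phi0; apply: ae_mono => z Dz.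
    rewrite patchE; case: ifPn => [zD|nzD].
      under [X in limn_einf X]eq_fun do rewrite patchE zD.
      by apply: Dz; exact/set_mem.
    under [X in limn_einf X]eq_fun do rewrite patchE (negbTE nzD).
    by rewrite (cvg_limn_einf_sup (cvg_cst _)).1.
apply: limn_einf_le_near; exists N => // l /= Nl.
by rewrite -integral_mkcond; apply/ltW; apply: NP => //; exact: leq_trans Nl (phil l).
Qed.

End closable.

End closability_by_fatou.

(** * The square field and the closability of the form *)

Section measurability_of_the_domain.
Context (R : realType) (d : nat) (S : set 'rV[R]_d).
Hypothesis cS : closed S.
Local Notation T := 'rV[R]_d.
Local Notation M := (mconfig S).

Lemma measurable_mx_of_tuple k : measurable_fun setT (@mx_of_tuple R d k).
Proof.
apply: measurable_to_mx => i j; under eq_fun do rewrite mxE.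
exact: (measurableT_comp (@measurable_mx_coord R 1 d 0 j) (@measurable_tnth _ T k i)).
Qed.

Lemma measurable_C0oo k (phi : k.-tuple T -> R) : C0oo S phi ->
  measurable_fun setT phi.
Proof.
move=> [[h [sh phih]] [K [_ KS K0]]].
rewrite (_ : phi = (h \o @mx_of_tuple R d k) \_ (tpow k S)).
  have mt : measurable (tpow k S) by apply: measurable_tpow; exact: closed_measurable_mx.
  apply: (measurable_restrictT _ mt).1.
  apply: measurable_funTS; apply: measurableT_comp (@measurable_mx_of_tuple k).
  exact: continuous_measurable_mx (sh [::]).1.
apply/funext => x; rewrite patchE; case: ifPn => [/set_mem xS|/negP xS].
  exact: phih.
by apply: K0 => Kx; apply: xS; apply/mem_set; exact: KS.
Qed.

Lemma measurable_Dcirc (h : M -> R) : Dcirc h -> measurable_fun setT h.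
Proof.
move=> [[r _ hr] _] _ B mB; have [C mC <-] := hr measurableT B mB.
rewrite setTI -[X in measurable X]setTI; exact: measurable_restr.
Qed.

Lemma measurable_Dcirck k (f : k.-tuple T * M -> R) : Dcirck f ->
  measurable_fun setT f.
Proof.
move=> [n [phi [h [Cphi Dh fE]]]].
rewrite (_ : f = fun z => \sum_(i < n) phi i z.1 * h i z.2)%R; last first.
  by apply/funext => -[x eta]; exact: fE.
apply: measurable_sum => i; apply: measurable_funM.
  exact: measurableT_comp (measurable_C0oo (Cphi i)) measurable_fst.
exact: measurableT_comp (measurable_Dcirc (Dh i)) measurable_snd.
Qed.

End measurability_of_the_domain.

Section jump_energy.
Local Open Scope ereal_scope.
Context (R : realType) (d : nat) (S : set 'rV[R]_d).
Hypothesis cS : closed S.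
Local Notation T := 'rV[R]_d.
Local Notation M := (mconfig S).
Variables (p : T -> T -> R) (hp : jump_rate S p).
Variable k : nat.
Local Notation Z := (k.-tuple T * M)%type.

Let mS : measurable S.
Proof. exact: closed_measurable_mx. Qed.

Let moves : set (T * T) := [set v | [/\ S v.1, S v.2 & v.1 != v.2]].

Let mmoves : measurable moves.
Proof.
rewrite (_ : moves = (fst @^-1` S `&` snd @^-1` S) `&` ~` [set v | v.1 = v.2]).
  apply: measurableI; first apply: measurableI.
  - by rewrite -[X in measurable X]setTI; exact: measurable_fst.
  - by rewrite -[X in measurable X]setTI; exact: measurable_snd.
  - by apply: measurableC; exact: measurable_diag_row.
apply/seteqP; split=> v; first by move=> [? ? /eqP].
by move=> [[? ?] /eqP].
Qed.

(** The rate is only controlled between distinct points of [S]. Cutting it off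
elsewhere makes it measurable and nonnegative, and does not affect the energies
because the increments vanish on the diagonal. *)
Definition rate : T * T -> R := (fun v => p v.1 v.2) \_ moves.

Lemma rate_ge0 v : (0 <= rate v)%R.
Proof.
case: hp => p0 _ _ _ _; rewrite /rate patchE.
by case: ifPn => // /set_mem [? ? ?]; exact: p0.
Qed.

Lemma measurable_rate : measurable_fun setT rate.
Proof. by case: hp => _ mp _ _ _; exact: (measurable_restrictT _ mmoves).1. Qed.

Lemma rate_gt0 v : (0 < rate v)%R -> S v.1 /\ S v.2.
Proof. by rewrite /rate patchE; case: ifPn => [/set_mem[]//|_]; rewrite ltxx. Qed.

Lemma rateE x y (c : R) : S x -> S y -> (x = y -> c = 0%R) ->
  (c * c * rate (x, y) = c * c * p x y)%R.
Proof.
move=> Sx Sy c0; have [xy|xy] := eqVneq x y; first by rewrite c0// !mul0r.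
by rewrite /rate patchE mem_set.
Qed.

Lemma rate_out x y : ~ S y -> rate (x, y) = 0%R.
Proof. by move=> nSy; rewrite /rate patchE memNset// => -[]. Qed.

Definition tuple_energy (j : 'I_k) (f : Z -> R) (z : Z) : \bar R :=
  \int[lebd R d]_y ((nabla j y f z * nabla j y f z) * rate (tnth z.1 j, y))%R%:E.

Let particle_moves : set ((Z * T) * T) :=
  [set v | is_particle v.1.1.2 v.1.2 /\ S v.2].

(** Where a particle moves to a point of [S], the jump is a configuration with
explicit counts; elsewhere it may be a default value. *)
Definition particle_increment (f : Z -> R) : (Z * T) * T -> R :=
  (fun v => f (v.1.1.1, jump v.1.1.2 v.1.2 v.2) - f v.1.1)%R \_ particle_moves.

Definition particle_energy (f : Z -> R) (z : Z) : \bar R :=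
  \int[pts z.2]_x \int[lebd R d]_y
    ((particle_increment f (z, x, y) * particle_increment f (z, x, y)) *
     rate (x, y))%R%:E.

(** Twice the square field of the form. *)
Definition jump_energy (f : Z -> R) (z : Z) : \bar R :=
  \sum_(j < k) tuple_energy j f z + particle_energy f z.

Lemma square_rate_ge0 (c : R) v : 0 <= ((c * c) * rate v)%R%:E.
Proof. by rewrite lee_fin mulr_ge0 ?rate_ge0// -expr2 sqr_ge0. Qed.

Lemma tuple_energy_ge0 j f z : 0 <= tuple_energy j f z.
Proof. by apply: integral_ge0 => y _; exact: square_rate_ge0. Qed.

Lemma particle_energy_ge0 f z : 0 <= particle_energy f z.
Proof.
by apply: integral_ge0 => x _; apply: integral_ge0 => y _; exact: square_rate_ge0.
Qed.

Lemma jump_energy_ge0 f z : 0 <= jump_energy f z.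
Proof.
apply: adde_ge0; last exact: particle_energy_ge0.
by apply: sume_ge0 => j _; exact: tuple_energy_ge0.
Qed.

Lemma measurable_nabla j f : measurable_fun setT f ->
  measurable_fun setT (fun v : Z * T => nabla j v.2 f v.1).
Proof.
move=> mf; apply: measurable_funB; last exact: measurableT_comp mf measurable_fst.
exact: (measurableT_comp mf (@measurable_tuple_move R d _ M k j)).
Qed.

Lemma measurable_tuple_rate j :
  measurable_fun setT (fun v : Z * T => rate (tnth v.1.1 j, v.2)).
Proof.
apply: (measurableT_comp measurable_rate (g := fun v : Z * T => (tnth v.1.1 j, v.2))).
apply: measurable_fun_pair; last exact: measurable_snd.
apply: (measurableT_comp (@measurable_tnth _ T k j)).
exact: (measurableT_comp measurable_fst measurable_fst).
Qed.

Lemma measurable_tuple_energy j f : measurable_fun setT f ->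
  measurable_fun setT (tuple_energy j f).
Proof.
move=> mf; apply: (measurable_fun_fubini_tonelli_F (m2 := lebd R d)
  (fun v : Z * T => ((nabla j v.2 f v.1 * nabla j v.2 f v.1) *
    rate (tnth v.1.1 j, v.2))%R%:E)); last by move=> v; exact: square_rate_ge0.
apply/measurable_EFinP; apply: measurable_funM; last exact: measurable_tuple_rate.
by apply: measurable_funM; exact: measurable_nabla.
Qed.

Let mparticle_moves : measurable particle_moves.
Proof.
apply: measurableI; last by rewrite -[X in measurable X]setTI; exact: measurable_snd.
apply: (measurable_particle cS).
  exact: (measurableT_comp measurable_snd (measurableT_comp measurable_fst measurable_fst)).
exact: (measurableT_comp measurable_snd measurable_fst).
Qed.

Lemma measurable_particle_increment f : measurable_fun setT f ->
  measurable_fun setT (particle_increment f).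
Proof.
move=> mf; apply: (measurable_restrictT _ mparticle_moves).1; apply: measurable_funB.
  apply: (measurableT_comp mf).
  apply: measurable_fun_pair_on => //.
    apply: measurable_funTS.
    exact: (measurableT_comp measurable_fst (measurableT_comp measurable_fst measurable_fst)).
  apply: (measurable_jump cS _ mparticle_moves) => //.
  - exact: (measurableT_comp measurable_snd (measurableT_comp measurable_fst measurable_fst)).
  - exact: (measurableT_comp measurable_snd measurable_fst).
apply: measurable_funTS; apply: (measurableT_comp mf).
exact: (measurableT_comp measurable_fst measurable_fst).
Qed.

Let measurable_particle_integrand f : measurable_fun setT f ->
  measurable_fun setT (fun v : Z * T => \int[lebd R d]_y
    ((particle_increment f (v, y) * particle_increment f (v, y)) *
     rate (v.2, y))%R%:E).
Proof.
move=> mf; apply: (measurable_fun_fubini_tonelli_F (m2 := lebd R d)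
  (fun w : (Z * T) * T => ((particle_increment f w * particle_increment f w) *
    rate (w.1.2, w.2))%R%:E)); last by move=> v; exact: square_rate_ge0.
apply/measurable_EFinP; apply: measurable_funM.
  by apply: measurable_funM; exact: measurable_particle_increment.
apply: (measurableT_comp measurable_rate (g := fun w : (Z * T) * T => (w.1.2, w.2))).
apply: measurable_fun_pair; last exact: measurable_snd.
exact: (measurableT_comp measurable_snd measurable_fst).
Qed.

Lemma measurable_particle_energy f : measurable_fun setT f ->
  measurable_fun setT (particle_energy f).
Proof.
move=> mf; apply: (measurable_fun_integral_pts cS measurable_snd
  (F := fun v : Z * T => \int[lebd R d]_y
    ((particle_increment f (v, y) * particle_increment f (v, y)) *
     rate (v.2, y))%R%:E)).
  by move=> v; apply: integral_ge0 => y _; exact: square_rate_ge0.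
exact: measurable_particle_integrand.
Qed.

Lemma measurable_jump_energy f : measurable_fun setT f ->
  measurable_fun setT (jump_energy f).
Proof.
move=> mf; apply: emeasurable_funD; last exact: measurable_particle_energy.
by apply: emeasurable_sum => j; exact: measurable_tuple_energy.
Qed.

(** At a particle the summand is nonnegative, so the negative part of [psum]
vanishes and what remains is an integral against the configuration. *)
Lemma carrekE f z : measurable_fun setT f -> tpow k S z.1 ->
  carrek p f f z = (2^-1)%R%:E * jump_energy f z.
Proof.
move=> mf zS; rewrite /carrek /jump_energy ge0_muleDr; last 2 first.
- by apply: sume_ge0 => j _; exact: tuple_energy_ge0.
- exact: particle_energy_ge0.
congr (_ * _ + _).
  apply: eq_bigr => j _; rewrite integral_mkcond; apply: eq_integral => y _.
  rewrite patchE; case: ifPn => [/set_mem Sy|/negP nSy].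
    rewrite rateE// => jy; rewrite /nabla -jy (_ : set_tnth _ _ _ = z.1).
      by rewrite -surjective_pairing subrr.
    by apply: eq_from_tnth => i; rewrite tnth_mktuple; case: eqP => [->|].
  by rewrite rate_out ?mulr0// => Sy; apply: nSy; exact/mem_set.
rewrite /carre /psum; congr (_ * _).
set G := (X in funepos X).
pose H x := \int[lebd R d]_y
    ((particle_increment f (z, x, y) * particle_increment f (z, x, y)) *
     rate (x, y))%R%:E.
have H0 x : 0 <= H x by apply: integral_ge0 => y _; exact: square_rate_ge0.
have GH x : is_particle z.2 x -> G x = H x.
  move=> zx; rewrite /G /H [LHS]integral_mkcond /=; apply: eq_integral => y _.
  rewrite patchE; case: ifPn => [/set_mem Sy|/negP nSy].
    rewrite /particle_increment patchE mem_set//= -surjective_pairing rateE//.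
      exact: particleS zx.
    by move=> <-; rewrite jump_id -surjective_pairing subrr.
  by rewrite rate_out ?mulr0// => Sy; apply: nSy; exact/mem_set.
rewrite [X in _ - X]esum1 ?sube0; last first.
  move=> x _; have [->|zx] := eqVneq (z.2 [set x]) 0; first by rewrite mul0e.
  by rewrite funenegE [X in - X](GH x zx) max_r ?mule0// oppe_le0.
rewrite (@eq_esum _ _ _ _ (fun x => z.2 [set x] * H x)); last first.
  move=> x _; have [->|zx] := eqVneq (z.2 [set x]) 0; first by rewrite !mul0e.
  by rewrite funeposE (GH x zx) max_l.
apply: esum_pts => //; last exact: measurable_set1_row.
have := measurable_particle_integrand mf.
by move=> /measurableT_comp; apply; exact: pair1_measurable.
Qed.

Section lower_semicontinuity.
Variable cm : {measure set Z -> \bar R}.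
Hypothesis tuple_jump : forall j N, measurable N -> cm N = 0 ->
  {ae cm, forall z, tpow k S z.1 -> lebd R d (tuple_landing j N z) = 0}.
Hypothesis particle_jump : forall N, measurable N -> cm N = 0 ->
  {ae cm, forall z, forall x, is_particle z.2 x ->
    lebd R d (particle_landing N z x) = 0}.

(** The functions [h l] converge off a null set [N]. From almost every state almost
every jump avoids [N], so the increments of [h l] along the jumps converge as well,
and Fatou applies to the integrals over the jumps. *)
Lemma jump_energy_lsc (g : Z -> R) (h : nat -> Z -> R) : measurable_fun setT g ->
  (forall l, measurable_fun setT (h l)) ->
  {ae cm, forall z, h l z @[l --> \oo] --> (0:R)%R} ->
  {ae cm, forall z, (tpow k S `*` setT) z ->
    jump_energy g z <= limn_einf (fun l => jump_energy (g \- h l)%R z)}.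
Proof.
move=> mg mh [N [mN N0 hN]].
have {}hN z : ~ N z -> h l z @[l --> \oo] --> (0:R)%R.
  by move=> nN; apply: contrapT => nh; apply: nN; exact: hN.
have ae_tuple : {ae cm, forall z, tpow k S z.1 -> forall j : 'I_k,
    lebd R d (tuple_landing j N z) = 0}.
  have : {ae cm, forall z, forall n, forall j : 'I_k, j = n :> nat ->
      tpow k S z.1 -> lebd R d (tuple_landing j N z) = 0}.
    apply: ae_foralln => n; have [nk|kn] := ltnP n k.
      apply: ae_mono (tuple_jump (Ordinal nk) mN N0) => z hz j jn.
      by rewrite (_ : j = Ordinal nk)//; exact: val_inj.
    by apply: aeW => z j jn; move: (ltn_ord j); rewrite jn ltnNge kn.
  by apply: ae_mono => z hz zS j; exact: (hz j j).
have nN : {ae cm, forall z, ~ N z} by exact/ae_measurableP.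
apply: ae_mono (ae_and nN (ae_and ae_tuple (particle_jump mN N0))).
move=> z [nNz [ztup zpart]] [zS _].
apply: le_trans (limn_einfD_ge0 _ _); last 2 first.
- by move=> l; apply: sume_ge0 => j _; exact: tuple_energy_ge0.
- by move=> l; exact: particle_energy_ge0.
apply: leeD.
  apply: le_trans (limn_einf_sum_ge0 _ _); last by move=> j l; exact: tuple_energy_ge0.
  apply: lee_sum => j _.
  have nablaB l y : nabla j y (g \- h l)%R z = (nabla j y g z - nabla j y (h l) z)%R.
    by rewrite /nabla /=; ring.
  rewrite /tuple_energy; under [X in _ <= limn_einf X]eq_fun do
    under eq_integral do rewrite nablaB.
  have mz : measurable_fun setT (fun y : T => (z, y)) by exact: pair1_measurable.
  apply: fatou_increments.
  - by move=> y; exact: rate_ge0.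
  - exact: (measurableT_comp (measurable_tuple_rate j) mz).
  - exact: (measurableT_comp (measurable_nabla j mg) mz).
  - by move=> l; exact: (measurableT_comp (measurable_nabla j (mh l)) mz).
  - exists (tuple_landing j N z); split.
    + rewrite -[X in measurable X]setTI.
      exact: (mz measurableT _ (measurable_tuple_landing cS j mN)).
    + exact: ztup.
    move=> y nh; apply: contrapT => nl; apply: nh => /rate_gt0 [_ /= Sy].
    rewrite /nabla -[X in _ --> X]subr0.
    apply: cvgB; last exact: hN.
    by apply: hN => Ny; apply: nl.
have incrB l v : particle_increment (g \- h l)%R v =
    (particle_increment g v - particle_increment (h l) v)%R.
  by rewrite /particle_increment !patchE; case: ifP => _ /=; [ring|rewrite subr0].
rewrite /particle_energy.
have mpair : measurable_fun setT (fun x : T => (z, x)) by exact: pair1_measurable.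
apply: fatou_ae.
- move=> l; exact: (measurableT_comp (measurable_particle_integrand
    (measurable_funB mg (mh l))) mpair).
- by move=> l x; apply: integral_ge0 => y _; exact: square_rate_ge0.
- exact: (measurableT_comp (measurable_particle_integrand mg) mpair).
- by move=> x; apply: integral_ge0 => y _; exact: square_rate_ge0.
apply: aeW => x.
under [X in _ <= limn_einf X]eq_fun do under eq_integral do rewrite incrB.
have mx : measurable_fun setT (fun y : T => (z, x, y)) by exact: pair1_measurable.
apply: fatou_increments.
- by move=> y; exact: rate_ge0.
- exact: (measurableT_comp measurable_rate (pair1_measurable x)).
- exact: (measurableT_comp (measurable_particle_increment mg) mx).
- by move=> l; exact: (measurableT_comp (measurable_particle_increment (mh l)) mx).
have [zx|nzx] := pselect (is_particle z.2 x); last first.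
  apply: aeW => y _; rewrite /particle_increment.
  by apply: cvg_near_cst; apply: nearW => l; rewrite patchE memNset// => -[].
exists (particle_landing N z x); split.
- have -> : particle_landing N z x = (fun y => (z, x, y)) @^-1`
      [set v : (Z * T) * T | is_particle v.1.1.2 v.1.2 /\
        particle_landing N v.1.1 v.1.2 v.2].
    by apply/seteqP; split=> y; [split|move=> []].
  rewrite -[X in measurable X]setTI; apply: mx => //.
  exact: measurable_particle_landing.
- exact: zpart.
move=> y nh; apply: contrapT => nl; apply: nh => /rate_gt0 [_ /= Sy].
rewrite (_ : (fun l => _) = fun l => (h l (z.1, jump z.2 x y) - h l z)%R); last first.
  by apply/funext => l; rewrite /particle_increment patchE mem_set.
rewrite -[X in _ --> X]subr0; apply: cvgB; last first.
  exact: hN.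
by apply: hN => Ny; apply: nl.
Qed.

End lower_semicontinuity.
End jump_energy.

Theorem theorem3p2 (R : realType) (d : nat) (hd : (0 < d)%N)
    (S : set 'rV[R]_d) (hSclosed : closed S) (hS0 : S 0)
    (hSint : closure S° = S)
    (mu : probability (mconfig S) R)
    (rho : forall n, n.-tuple 'rV[R]_d -> R)
    (hrho : forall n, (0 < n)%N -> is_correlation mu (rho n))
    (palm : forall n, R.-pker (n.-tuple 'rV[R]_d) ~> mconfig S)
    (hpalm : forall n, (0 < n)%N -> is_palm mu (rho n) (palm n))
    (campbell : forall n, {measure set (n.-tuple 'rV[R]_d * mconfig S) -> \bar R})
    (hcampbell : forall n, (0 < n)%N ->
      is_campbell (rho n) (palm n) (campbell n))
    (Lambda : nat -> probability (mconfig S) R)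
    (hLambda : forall r, is_poisson (fun A => lebd R d (A `&` Uball S r)) (Lambda r))
    (Phi : 'rV[R]_d -> \bar R) (hPhi : forall x, S x -> Phi x != -oo%E)
    (Psi : 'rV[R]_d -> 'rV[R]_d -> \bar R)
    (hPsi : forall x y, S x -> S y -> Psi x y != -oo%E)
    (hPsisym : forall x y, S x -> S y -> Psi x y = Psi y x)
    (p : 'rV[R]_d -> 'rV[R]_d -> R) (hp : jump_rate S p)
    (k : nat) (hk : (0 < k)%N)
    (QG : quasi_gibbs Lambda Phi Psi mu /\
      let SS := [set z : 'rV[R]_d | exists x y, [/\ S x, S y & z = x - y]] in
      exists (Phi0 Psi0 : 'rV[R]_d -> \bar R) (c1 c2 : R),
        [/\ (forall x, S x -> Phi0 x != -oo%E) /\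
              (forall z, SS z -> Psi0 z != -oo%E),
            upper_semicontinuous_on S Phi0 /\ upper_semicontinuous_on SS Psi0,
            0 < c1 /\ 0 < c2,
            forall x, S x ->
              (c1^-1%:E * Phi0 x <= Phi x /\ Phi x <= c1%:E * Phi0 x)%E &
            forall x y, S x -> S y ->
              (c2^-1%:E * Psi0 (x - y)%R <= Psi x y /\
               Psi x y <= c2%:E * Psi0 (x - y)%R)%E])
    (EQ : forall m, (0 < m)%N ->
      {ae (lebdn R d m \x lebdn R d m)%E, forall z,
        tpow m S z.1 -> tpow m S z.2 ->
        [/\ reduced_palm (palm m) z.1 `<< reduced_palm (palm m) z.2,
            reduced_palm (palm m) z.2 `<< reduced_palm (palm m) z.1 &
            0 < rho m z.1]}) :
  closable (campbell k) (jform p (campbell k)) (jform_domain p (campbell k)).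
Proof.
move=> f fD f0 fC.
have mf n : measurable_fun setT (f n).
  by have [Df _ _] := fD n; exact: measurable_Dcirck Df.
pose D : set (k.-tuple 'rV[R]_d * mconfig S) := tpow k S `*` setT.
have mD : measurable D.
  by apply: measurableX => //; apply: measurable_tpow; exact: closed_measurable_mx.
have jformE g : measurable_fun setT g -> jform p (campbell k) g g =
    ((2^-1)%:E * \int[campbell k]_(z in D) jump_energy p g z)%E.
  move=> mg; rewrite -ge0_integralZl//.
  - apply: eq_integral => z /set_mem[zS _]; exact: carrekE.
  - by apply: measurable_funTS; exact: measurable_jump_energy.
  - by move=> z _; exact: jump_energy_ge0.
have lsc := jump_energy_lsc hSclosed hp
  (campbell_tuple_jump hSclosed hrho hcampbell EQ hk)
  (campbell_particle_jump hd hSclosed hrho hpalm hcampbell EQ hk).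
have cvgE : (\int[campbell k]_(z in D) jump_energy p (f n) z)%E @[n --> \oo] --> 0%E.
  apply: (energy_cvg0 mD (Gam := @jump_energy R d S p k)
    (@jump_energy_ge0 _ _ _ _ hp k)
    (fun g mg => measurable_jump_energy hSclosed hp mg) lsc mf f0).
  move=> e e0; have [N NP] := fC (e / 2) (divr_gt0 e0 (ltr0Sn R 1)).
  exists N => m n Nm Nn; have := NP m n Nm Nn.
  rewrite jformE; last exact: measurable_funB.
  by rewrite [in ltRHS]mulrC EFinM lte_pmul2l// lte_fin invr_gt0.
under eq_fun do rewrite jformE//.
rewrite -[0%E](mule0 (2^-1)%:E); apply: cvgeZl => //.
Qed.
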